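(* Let $p>0$ and $n\ge 1$. (i) Suppose that $P=\sum_{\alpha\in\mathbb{Z}_{\ge 0}^n} a_\alpha(z)\partial_z^\alpha$ belongs to $\boldsymbol{D}_{p,0}$. Then for every entire function $f\in A_{p,0}$ the series $$Pf:=\sum_{\alpha} a_\alpha(z)\,\partial_z^\alpha f$$ converges and $Pf\in A_{p,0}$. Moreover, $f\mapsto Pf$ defines a linear continuous operator $P:A_{p,0}\to A_{p,0}$. (ii) Let $F:A_{p,0}\to A_{p,0}$ be a linear continuous operator. Then there is a unique $P\in\boldsymbol{D}_{p,0}$ such that $Ff=Pf$ holds for every $f\in A_{p,0}$.
   Context: For $z\in\mathbb{C}^n$ put $|z|=\sqrt{|z_1|^2+\cdots+|z_n|^2}$. For $p,\tau>0$, $A_{p,\tau}$ is the Banach space of all entire functions $f$ on $\mathbb{C}^n$ with $\|f\|_{p,\tau}:=\sup_{z\in\mathbb{C}^n}|f(z)|\exp(-\tau|z|^p)<\infty$. The space $A_{p,0}:=\varprojlim_{\tau>0}A_{p,\tau}=\bigcap_{\tau>0}A_{p,\tau}$ carries the projective limit topology, i.e. the topology defined by the norms $\|\cdot\|_{p,\tau}$, $\tau>0$ (it is an FS space). A linear operator $F:A_{p,0}\to A_{p,0}$ is continuous if and only if for every $\tau>0$ there exist $C>0$ and $\tau'>0$ such that $\|Ff\|_{p,\tau}\le C\|f\|_{p,\tau'}$ for all $f\in A_{p,0}$. For a multi-index $\alpha\in\mathbb{Z}_{\ge0}^n$: $|\alpha|=\alpha_1+\cdots+\alpha_n$, $\alpha!=\alpha_1!\cdots\alpha_n!$,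 $\partial_z^\alpha=(\partial/\partial z_1)^{\alpha_1}\cdots(\partial/\partial z_n)^{\alpha_n}$. Put $1/q:=1-1/p$ (so $1/q=0$ if $p=1$), and $0^0=1$. A formal differential operator of infinite order with entire coefficients is a formal sum $P=\sum_{\alpha\in\mathbb{Z}_{\ge0}^n}a_\alpha(z)\partial_z^\alpha$ with each $a_\alpha$ entire on $\mathbb{C}^n$; two such operators are equal iff all their coefficients agree. $\boldsymbol{D}_{p,0}$ is the set of all such $P$ satisfying one of the following equivalent conditions: (I)$_0$ for every $\varepsilon>0$ there exists $B>0$ such that $|a_\alpha(z)|\le \frac{B^{|\alpha|+1}}{(|\alpha|!)^{1/q}}\exp(\varepsilon|z|^p)$ for all $z\in\mathbb{C}^n$, $\alpha\in\mathbb{Z}_{\ge0}^n$; (II)$_0$ for every $\varepsilon>0$ there exists $B>0$ such that $|a_\alpha(z)|\le \frac{|\alpha|^{|\alpha|/p}}{\alpha!}B^{|\alpha|+1}\exp(\varepsilon|z|^p)$ for all $z\in\mathbb{C}^n$, $\alpha\in\mathbb{Z}_{\ge0}^n$; (III)$_0$ for every $\varepsilon>0$ there exists $B>0$ such that $\|a_\alpha\|_{p,\varepsilon}\le \frac{B^{|\alpha|+1}}{(|\alpha|!)^{1/q}}$ for all $\alpha$; (IV)$_0$ for every $\varepsilon>0$ there exists $B>0$ such that $\|a_\alpha\|_{p,\varepsilon}\le \frac{|\alpha|^{|\alpha|/p}}{\alpha!}B^{|\alpha|+1}$ for all $\alpha$. Convergence of the series $\sum_\alpha a_\alpha(z)\partial_z^\alpha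 f(z)$, indexed by the unordered set $\mathbb{Z}_{\ge0}^n$, means absolute convergence at every $z\in\mathbb{C}^n$. *)

(* Defs.v *)
From HB Require Import structures.
From mathcomp Require Import all_boot all_order all_algebra finmap.
From mathcomp Require Import complex.
From mathcomp Require Import all_classical all_reals all_analysis.
From mathcomp Require summability.
Import Order.TTheory GRing.Theory Num.Theory.
Import numFieldNormedType.Exports.
Import ComplexField.Normc.

Set Implicit Arguments.
Unset Strict Implicit.
Unset Printing Implicit Defensive.

Local Open Scope classical_set_scope.
Local Open Scope ring_scope.

(* The complex plane R[i] as a normed space over itself; this is the structure
   that R[i]^o carries for any numFieldType. *)
HB.instance Definition _ (R : realType) := NormedModule.copy R[i] R[i]^o.

Section Entire.
Context {R : realType} {n : nat}.
Implicit Types (f : 'rV[R[i]]_n -> R[i]) (z : 'rV[R[i]]_n).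

Definition enorm z : R := Num.sqrt (\sum_i normc (z 0 i) ^+ 2).

(* [differentiable] over the scalar field R[i] is Frechet differentiability
   with a C-linear differential. *)
Definition entire f := forall z, differentiable f z.

Definition mindex := {ffun 'I_n -> nat}.

Definition mdeg (a : mindex) : nat := (\sum_i a i)%N.

Definition pderiv (i : 'I_n) f : 'rV[R[i]]_n -> R[i] :=
  fun z => 'D_(delta_mx 0 i) f z.

Definition mderiv (a : mindex) f : 'rV[R[i]]_n -> R[i] :=
  foldr (fun i g => iter (a i) (pderiv i) g) f (enum 'I_n).

Definition expnorm (p tau : R) f : \bar R :=
  ereal_sup [set (normc (f z) * expR (- tau * enorm z `^ p))%:E | z in setT].

Definition Aptau (p tau : R) : set ('rV[R[i]]_n -> R[i]) :=
  [set f | entire f /\ (expnorm p tau f < +oo)%E].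

Definition Ap0 (p : R) : set ('rV[R[i]]_n -> R[i]) :=
  \bigcap_(tau in [set t | 0 < t]) Aptau p tau.

Definition Ap0_pred (p : R) : {pred 'rV[R[i]]_n -> R[i]} := mem (Ap0 p).

Lemma expnorm_ltyP p tau f :
  (exists M : R, forall z, normc (f z) * expR (- tau * enorm z `^ p) <= M) <->
  (expnorm p tau f < +oo)%E.
Proof.
split=> [[M fM]|].
  apply: (@le_lt_trans _ _ M%:E); last by rewrite ltry.
  by apply: ge_ereal_sup => _ [z _ <-]; rewrite lee_fin.
move=> fy; exists (fine (expnorm p tau f)) => z.
have fz : ((normc (f z) * expR (- tau * enorm z `^ p))%:E <= expnorm p tau f)%E.
  by apply: ereal_sup_ubound; exists z.
have fNy := lt_le_trans (ltNyr _) fz.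
by rewrite -lee_fin fineK// fin_numE gt_eqF//= lt_eqF.
Qed.

Lemma Ap0_submod_closed p : submod_closed (Ap0_pred p).
Proof.
have normc_ge0 (c : R[i]) : 0 <= normc c by case: c => a b; exact: sqrtr_ge0.
split=> [|c f g].
  rewrite /Ap0_pred inE => tau /= _; split; first by move=> z; exact: differentiable_cst.
  by apply/expnorm_ltyP; exists 0 => z; rewrite normc0 mul0r.
rewrite /Ap0_pred !inE => Af Ag tau /= tau0.
have [df /expnorm_ltyP[M fM]] := Af _ tau0.
have [dg /expnorm_ltyP[N gN]] := Ag _ tau0.
split=> [z|].
  by apply: differentiableD => //; apply: differentiableZ.
apply/expnorm_ltyP; exists (normc c * M + N) => z.
apply: le_trans (lerD (ler_wpM2l (normc_ge0 c) (fM z)) (gN z)).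
rewrite mulrA -mulrDl ler_wpM2r ?expR_ge0//.
by rewrite -normcM; exact: le_normcD.
Qed.

End Entire.
Arguments mindex : clear implicits.
Arguments Ap0 : clear implicits.

Section Ap0_space.
Context (R : realType) (n : nat) (p : R).

Record Ap0_space := MkAp0 {
  Ap0_val :> 'rV[R[i]]_n -> R[i];
  _ : Ap0_val \in @Ap0_pred R n p }.

HB.instance Definition _ := [isSub for Ap0_val].
HB.instance Definition _ := [Choice of Ap0_space by <:].
HB.instance Definition _ := GRing.isSubmodClosed.Build R[i]
  ('rV[R[i]]_n -> R[i]) (@Ap0_pred R n p) (@Ap0_submod_closed R n p).
HB.instance Definition _ := [SubChoice_isSubLmodule of Ap0_space by <:].
HB.instance Definition _ := isPointed.Build Ap0_space 0.

(* The projective limit topology: the coarsest one containing all open balls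
   of all the norms expnorm p tau, tau > 0. *)
Definition Ap0_ball (b : Ap0_space * (R * R)) : set Ap0_space :=
  [set g | (expnorm p b.2.1 (g - b.1)%R < b.2.2%:E)%E].

HB.instance Definition _ := isSubBaseTopological.Build Ap0_space
  [set b : Ap0_space * (R * R) | 0 < b.2.1 /\ 0 < b.2.2] Ap0_ball.

End Ap0_space.

Section Operators.
Context {R : realType} {n : nat}.

(* A formal operator sum_a P_a(z) d^a is its family of coefficients. *)
Definition foperator := mindex n -> 'rV[R[i]]_n -> R[i].

(* 1 / q = 1 - 1 / p may be negative. *)
Definition Dp0 (p : R) : set foperator :=
  [set P | (forall a, entire (P a)) /\
    forall eps, 0 < eps -> exists2 B, 0 < B & forall z a,
      normc (P a z) <=
        B ^+ (mdeg a).+1 / (mdeg a)`!%:R `^ (1 - p^-1)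
        * expR (eps * enorm z `^ p)].

Definition op_term (P : foperator) (f : 'rV[R[i]]_n -> R[i]) z
  : mindex n -> R[i] := fun a => P a z * mderiv a f z.

Definition op_cvg (P : foperator) f := forall z,
  esum.summable [set: mindex n] (fun a => (normc (op_term P f z a))%:E).

Definition op_apply (P : foperator) f : 'rV[R[i]]_n -> R[i] :=
  fun z => summability.sum (op_term P f z).

End Operators.
Arguments foperator : clear implicits.
Arguments Dp0 : clear implicits.

(* Main.v *)
Require Import Defs.
From HB Require Import structures.
From mathcomp Require Import all_boot all_order all_algebra finmap.
From mathcomp Require Import complex.
From mathcomp Require Import all_classical all_reals all_analysis.
From mathcomp Require Import ring lra.
From mathcomp Require summability.
Import Order.TTheory GRing.Theory Num.Theory.
Import numFieldNormedType.Exports.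
Import ComplexField.Normc.

(** Why the theorem holds. Both directions come down to balancing Cauchy's
    estimates against exponential weights.

    An operator with symbol in D_{p,0} acts (Dp0_op_cvg, op_Ap0,
    op_map_continuous): on a polydisc of radius s (|al| + 1)^(1/p), a function
    with growth exp(tau |z|^p) for a small tau satisfies Cauchy's estimate in the
    form

      |d^al f(z)| (|al|!)^(1/p) <= C al! (e/s)^|al| exp(tau' |z|^p),

    where s is as large as we please when tau is small (deriv_bound). Multiplied
    with the bound on the coefficients this gives terms dominated by 4^-|al|
    (term_geom_bounded), with the weights needed for the norm estimates. The sum
    is entire since a sum of entire functions dominated in this way is entire
    (weierstrass).

    Conversely, at the point z all derivatives of the monomial (w - z)^al vanish
    except the one of order al, which is al!. So the coefficients of an operator
    representing F can only be F((w - z)^al)(z) / al!. They satisfy the required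
    bounds by the continuity of F, since (w - z)^al has explicit weighted norms
    (symbol_Dp0); they are entire because the factors w_i - z_i can be pulled out
    of F one at a time (entire_eval_mul_shifts). They represent F because the
    Taylor series of f at z converges to f in the topology of A_{p,0}, so that F
    may be applied to it term by term (symbol_represents).

    This uses the theory of entire functions of several variables, starting from
    differentiability at each point: Goursat's theorem, Cauchy's formula, Taylor
    expansions, termwise differentiation. Integrals are replaced by limits of
    Riemann sums along an ultrafilter (grid_int). These exist for all bounded
    functions, so the coefficients of a Taylor series in several variables can be
    formed in one variable after another, without asking whether the intermediate
    functions are measurable or continuous (cauchy_coef, taylor_partial).
    Contours are boundaries of squares, and constants are not optimised: they are
    absorbed by the constants B in the definition of D_{p,0}. *)

Set Implicit Arguments.
Unset Strict Implicit.
Unset Printing Implicit Defensive.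

Local Open Scope classical_set_scope.
Local Open Scope ring_scope.
Local Open Scope complex_scope.

Local Notation Re := complex.Re.
Local Notation Im := complex.Im.

(** * Moduli of complex numbers *)

Section normc_theory.
Context {R : realType}.
Implicit Types (x y : R[i]) (a b : R).

Lemma normc_ge0 x : 0 <= normc x.
Proof. by case: x => a b; exact: sqrtr_ge0. Qed.

Lemma normc_def_sqr x : normc x ^+ 2 = Re x ^+ 2 + Im x ^+ 2.
Proof. by case: x => a b /=; rewrite sqr_sqrtr// addr_ge0// sqr_ge0. Qed.

Lemma norm_Re x : `|Re x| <= normc x.
Proof.
rewrite -(@ler_pXn2r _ 2) ?nnegrE ?normc_ge0// real_normK ?num_real//.
by rewrite normc_def_sqr lerDl sqr_ge0.
Qed.

Lemma norm_Im x : `|Im x| <= normc x.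
Proof.
rewrite -(@ler_pXn2r _ 2) ?nnegrE ?normc_ge0// real_normK ?num_real//.
by rewrite normc_def_sqr lerDr sqr_ge0.
Qed.

Lemma normc_le_ReIm x : normc x <= `|Re x| + `|Im x|.
Proof.
rewrite -(@ler_pXn2r _ 2) ?nnegrE ?addr_ge0 ?normc_ge0//.
rewrite normc_def_sqr sqrrD !real_normK ?num_real//.
by rewrite lerD2r lerDl mulrn_wge0// mulr_ge0.
Qed.

Lemma normcB x y : normc (x - y) = normc (y - x).
Proof. by rewrite -normcN opprB. Qed.

Lemma normc_real a : normc a%:C = `|a|.
Proof. by rewrite /normc /= expr0n addr0 sqrtr_sqr. Qed.

Lemma normcX x k : normc (x ^+ k) = normc x ^+ k.
Proof. by elim: k => [|k ih]; rewrite ?expr0 ?normc1// !exprS normcM ih. Qed.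

Lemma normci : normc ('i : R[i]) = 1.
Proof. by rewrite /normc /= expr0n expr1n add0r sqrtr1. Qed.

Lemma normc_gt0 x : (0 < normc x) = (x != 0).
Proof.
rewrite lt_def normc_ge0 andbT; congr (~~ _).
by apply/eqP/eqP => [/eq0_normc//|->]; rewrite normc0.
Qed.

Lemma le_normc_sum I (r : seq I) (P : pred I) (F : I -> R[i]) :
  normc (\sum_(j <- r | P j) F j) <= \sum_(j <- r | P j) normc (F j).
Proof.
apply: (big_ind2 (fun x a => normc x <= a)) => //; first by rewrite normc0.
by move=> x a y b xa yb; exact: le_trans (le_normcD _ _) (lerD xa yb).
Qed.

Lemma normc_prod I (r : seq I) (P : pred I) (F : I -> R[i]) :
  normc (\prod_(j <- r | P j) F j) = \prod_(j <- r | P j) normc (F j).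
Proof. exact: (big_morph _ (@normcM R) (@normc1 R)). Qed.

Lemma le_normcB x y : normc (x - y) <= normc x + normc y.
Proof. by rewrite -(normcN y) le_normcD. Qed.

Lemma le_normcBD y x z : normc (x - z) <= normc (x - y) + normc (y - z).
Proof. by apply: le_trans (le_normcD _ _); rewrite addrA subrK. Qed.

Lemma normcD_ge x y : normc x - normc y <= normc (x + y).
Proof. by rewrite lerBlDr -{1}(addrK y x) le_normcB. Qed.

Lemma normc_le_eps x : (forall e, 0 < e -> normc x <= e) -> x = 0.
Proof.
move=> xe; apply: eq0_normc; apply/eqP; rewrite eq_le normc_ge0 andbT.
by apply/ler_addgt0Pr => e e0; rewrite add0r; exact: xe.
Qed.

End normc_theory.

Arguments normc : simpl never.

(** * Limits along an ultrafilter *)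

Section ultralimit.
Context {R : realType}.
Implicit Types (u v : nat -> R) (M N e : R).

Lemma nonprincipal_ultrafilter :
  exists U : set_system nat, UltraFilter U /\ \oo `<=` U.
Proof. exact: ultraFilterLemma. Qed.

Definition nat_ultra : set_system nat := sval (cid nonprincipal_ultrafilter).

Instance nat_ultra_ultrafilter : UltraFilter nat_ultra.
Proof. exact: (svalP (cid nonprincipal_ultrafilter)).1. Qed.

Lemma nat_ultra_near (P : set nat) : (\forall k \near \oo, P k) -> nat_ultra P.
Proof. exact: (svalP (cid nonprincipal_ultrafilter)).2. Qed.

Lemma bounded_ultra_cvg (u : nat -> R) M : (forall k, `|u k| <= M) ->
  cvg (u @ nat_ultra).
Proof.
move=> uM.
have uI : (u @ nat_ultra) [set` `[(- M), M]].
  by rewrite /fmap/=; apply: filterE => k /=; rewrite in_itv/= -ler_norml.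
have [l [_ cl]] := @segment_compact R (- M) M _ _ uI.
apply/cvg_ex; exists l => B Bl.
have [//|UnB] : nat_ultra (u @^-1` B) \/ nat_ultra (~` (u @^-1` B)).
  exact: in_ultra_setVsetC.
by have [x []] := cl (~` B) B UnB Bl.
Qed.

Definition ulim (u : nat -> R) : R := lim (u @ nat_ultra).

Lemma ulimD u v M N : (forall k, `|u k| <= M) -> (forall k, `|v k| <= N) ->
  ulim (fun k => u k + v k) = ulim u + ulim v.
Proof. by move=> /bounded_ultra_cvg uc /bounded_ultra_cvg vc; exact: limD. Qed.

Lemma ulimZ a u M : (forall k, `|u k| <= M) ->
  ulim (fun k => a * u k) = a * ulim u.
Proof.
by move=> /bounded_ultra_cvg uc; apply/cvg_lim => //; exact: cvgMr.
Qed.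

Lemma ulim_le u M e : (forall k, `|u k| <= M) ->
  (\forall k \near \oo, `|u k| <= e) -> `|ulim u| <= e.
Proof.
move=> /bounded_ultra_cvg uc ue; rewrite -lim_norm//.
by apply: limr_le; [exact: is_cvg_norm|exact: nat_ultra_near].
Qed.

Implicit Types (w z : nat -> R[i]).

(** Every bounded sequence has such a limit, and it is linear; it agrees with the
    usual limit where that exists. Real and imaginary parts are treated
    separately, whence the factor 2 in culim_le. *)
Definition culim (w : nat -> R[i]) : R[i] :=
  ulim (fun k => Re (w k)) +i* ulim (fun k => Im (w k)).

Lemma culimD w z M N : (forall k, normc (w k) <= M) ->
  (forall k, normc (z k) <= N) ->
  culim (fun k => w k + z k) = culim w + culim z.
Proof.
move=> uM vN; apply/eqP; rewrite eq_complex /=.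
have -> : (fun k => Re (w k + z k)) = (fun k => Re (w k) + Re (z k)).
  by apply/funext => k; rewrite raddfD.
have -> : (fun k => Im (w k + z k)) = (fun k => Im (w k) + Im (z k)).
  by apply/funext => k; rewrite raddfD.
rewrite (@ulimD _ _ M N) ?(@ulimD _ _ M N) ?eqxx// => k.
- exact: le_trans (norm_Im _) (uM _).
- exact: le_trans (norm_Im _) (vN _).
- exact: le_trans (norm_Re _) (uM _).
- exact: le_trans (norm_Re _) (vN _).
Qed.

Lemma culimZ a w M : (forall k, normc (w k) <= M) ->
  culim (fun k => a * w k) = a * culim w.
Proof.
move=> uM; case: a => a b; apply/eqP; rewrite eq_complex /=.
have uR k : `|Re (w k)| <= M by exact: le_trans (norm_Re _) (uM _).
have uI k : `|Im (w k)| <= M by exact: le_trans (norm_Im _) (uM _).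
have zM c (v : nat -> R) : (forall k, `|v k| <= M) ->
    forall k, `|c * v k| <= `|c| * M.
  by move=> vM k; rewrite normrM ler_wpM2l.
have -> : (fun k => Re ((a +i* b) * w k)) =
    (fun k => a * Re (w k) + (- b) * Im (w k)).
  by apply/funext => k; case: (w k) => x y /=; rewrite mulNr.
have -> : (fun k => Im ((a +i* b) * w k)) =
    (fun k => a * Im (w k) + b * Re (w k)).
  by apply/funext => k; case: (w k) => x y /=; rewrite [b * x]mulrC.
rewrite (ulimD (zM _ _ uR) (zM _ _ uI)) (ulimD (zM _ _ uI) (zM _ _ uR)).
rewrite !(@ulimZ _ (fun k => Re _) M)// !(@ulimZ _ (fun k => Im _) M)//.
by rewrite mulNr eqxx/= [b * _]mulrC.
Qed.

Lemma culim_le w M e : (forall k, normc (w k) <= M) ->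
  (\forall k \near \oo, normc (w k) <= e) -> normc (culim w) <= 2 * e.
Proof.
move=> uM ue; apply: le_trans (normc_le_ReIm _) _ => /=.
rewrite mulr_natl mulr2n lerD//.
- apply: (@ulim_le _ M) => [k|]; first exact: le_trans (norm_Re _) (uM _).
  by apply: filterS ue => k; exact: le_trans (norm_Re _).
- apply: (@ulim_le _ M) => [k|]; first exact: le_trans (norm_Im _) (uM _).
  by apply: filterS ue => k; exact: le_trans (norm_Im _).
Qed.

Lemma culim_cst c : culim (fun=> c) = c.
Proof.
case: c => a b; rewrite /culim /= /ulim.
by rewrite !lim_cst.
Qed.

Lemma culim_eq0 w M : (forall k, normc (w k) <= M) ->
  (forall e, 0 < e -> \forall k \near \oo, normc (w k) <= e) -> culim w = 0.
Proof.
move=> uM ue; apply: normc_le_eps => e e0.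
have e20 : 0 < e / 2 by rewrite divr_gt0.
by have := culim_le uM (ue _ e20); rewrite mulrC divfK.
Qed.

End ultralimit.

Arguments culim : simpl never.

(** * Integration of bounded functions over a grid *)

Section riemann.
Context {R : realType}.
Implicit Types (g h : R -> R[i]) (a b c x M N e : R) (k j : nat).

(** The grid points of ]a, b] are those with grid_idx k a < j <= grid_idx k b. The
    shift by k lets the grid reach any negative number for large k while its
    indices remain natural numbers. *)
Definition grid_idx k x : nat := Num.truncn (k.+1%:R * (x + k%:R)).

Definition grid_pt k j : R := j%:R / k.+1%:R - k%:R.

Lemma grid_pt_itv k a b j : (grid_idx k a < j <= grid_idx k b)%N ->
  a <= grid_pt k j <= b.
Proof.
case: j => [|j]; first by rewrite ltn0.
have k0 : 0 < k.+1%:R :> R by rewrite ltr0n.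
rewrite {2}/grid_idx truncn_gt_nat /grid_pt => /andP[aj jb].
rewrite lerBrDr lerBlDr ler_pdivlMr// ler_pdivrMr//.
rewrite -![_ * k.+1%:R]mulrC jb andbT.
apply/ltW/(lt_le_trans (truncnS_gt _)); rewrite ler_nat.
exact: aj.
Qed.

Lemma grid_idx_le k a b : a <= b -> (grid_idx k a <= grid_idx k b)%N.
Proof. by move=> ab; apply: le_truncn; rewrite ler_wpM2l// lerD2r. Qed.

(** Consecutive grid points are 1/(k+1) apart. *)
Lemma grid_count_le k a b : a <= b ->
  (grid_idx k b - grid_idx k a)%N%:R / k.+1%:R <= (b - a) + k.+1%:R^-1.
Proof.
move=> ab; have k0 : 0 < k.+1%:R :> R by rewrite ltr0n.
rewrite ler_pdivrMr// mulrDl mulVf ?gt_eqF// natrB ?grid_idx_le//.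
have := truncnS_gt (k.+1%:R * (a + k%:R)); rewrite -/(grid_idx k a) -natr1 => ha.
have := grid_idx_le k ab.
case E : (grid_idx k b) => [|j].
  rewrite leqn0 => /eqP ->; rewrite subrr addr_ge0// mulr_ge0 ?subr_ge0//.
have : (j < grid_idx k b)%N by rewrite E.
rewrite {1}/grid_idx truncn_gt_nat => hb _.
by move: ha hb; set K := k.+1%:R; nra.
Qed.

Lemma grid_count_ge k a b : a <= b -> - a <= k%:R ->
  (b - a) - k.+1%:R^-1 <= (grid_idx k b - grid_idx k a)%N%:R / k.+1%:R.
Proof.
move=> ab ak; have k0 : 0 < k.+1%:R :> R by rewrite ltr0n.
rewrite ler_pdivlMr// mulrBl mulVf ?gt_eqF// natrB ?grid_idx_le//.
have := truncnS_gt (k.+1%:R * (b + k%:R)); rewrite -/(grid_idx k b) -natr1 => hb.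
have ha : (grid_idx k a)%:R <= k.+1%:R * (a + k%:R).
  by rewrite /grid_idx truncn_le mulr_ge0//; lra.
by move: ha hb; set K := k.+1%:R; nra.
Qed.

Definition grid_sum k g a b : R[i] :=
  \sum_((grid_idx k a).+1 <= j < (grid_idx k b).+1) g (grid_pt k j) / (k.+1%:R)%:C.

Lemma grid_sum_le k g a b M : a <= b -> 0 <= M ->
  (forall x, a <= x <= b -> normc (g x) <= M) ->
  normc (grid_sum k g a b) <= M * ((b - a) + k.+1%:R^-1).
Proof.
move=> ab M0 gM; apply: le_trans (le_normc_sum _ _ _) _.
apply: (@le_trans _ _ (\sum_((grid_idx k a).+1 <= j < (grid_idx k b).+1) M / k.+1%:R)).
  rewrite !big_nat; apply: ler_sum => j /andP[aj jb].
  rewrite normcM normcV normc_real ger0_norm// ler_wpM2r ?invr_ge0//.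
  by apply/gM/(@grid_pt_itv k); rewrite aj -ltnS.
rewrite sumr_const_nat subSS -[_ *+ _]mulr_natr -mulrA ler_wpM2l//.
by rewrite mulrC grid_count_le.
Qed.

Lemma grid_sum_bounded k g a b M : a <= b -> 0 <= M ->
  (forall x, a <= x <= b -> normc (g x) <= M) ->
  normc (grid_sum k g a b) <= M * ((b - a) + 1).
Proof.
move=> ab M0 gM; apply: le_trans (grid_sum_le k ab M0 gM) _.
rewrite ler_wpM2l// lerD2l invf_le1 ?ler1n ?ltr0n//.
Qed.

(** The limit of Riemann sums over finer and finer grids. It exists for every
    bounded function, and it has what contour integration requires: linearity,
    additivity in the interval, and a bound by length times supremum. For a
    Riemann integrable function it is the integral. *)
Definition grid_int g a b : R[i] := culim (fun k => grid_sum k g a b).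

Definition seg_bounded g a b M := forall x, a <= x <= b -> normc (g x) <= M.

Lemma seg_bounded_ge0 g a b M : a <= b -> seg_bounded g a b M -> 0 <= M.
Proof.
move=> ab gM; apply: le_trans (gM a _); first exact: normc_ge0.
by rewrite lexx.
Qed.

Lemma grid_int_ext g h a b : (forall x, a <= x <= b -> g x = h x) ->
  grid_int g a b = grid_int h a b.
Proof.
move=> gh; congr culim; apply/funext => k; rewrite /grid_sum !big_nat.
apply: eq_bigr => j /andP[aj jb]; congr (_ / _); apply/gh/(@grid_pt_itv k).
by rewrite aj -ltnS.
Qed.

Lemma grid_int_D g h a b M N : a <= b -> seg_bounded g a b M ->
  seg_bounded h a b N ->
  grid_int (fun x => g x + h x) a b = grid_int g a b + grid_int h a b.
Proof.
move=> ab gM hN.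
have M0 := seg_bounded_ge0 ab gM; have N0 := seg_bounded_ge0 ab hN.
rewrite /grid_int -(@culimD _ _ _ (M * ((b - a) + 1)) (N * ((b - a) + 1))).
- congr culim; apply/funext => k; rewrite /grid_sum -big_split/=.
  by apply: eq_bigr => j _; rewrite mulrDl.
- by move=> k; exact: grid_sum_bounded.
- by move=> k; exact: grid_sum_bounded.
Qed.

Lemma grid_int_Z z g a b M : a <= b -> seg_bounded g a b M ->
  grid_int (fun x => z * g x) a b = z * grid_int g a b.
Proof.
move=> ab gM; have M0 := seg_bounded_ge0 ab gM.
rewrite /grid_int -(@culimZ _ _ _ (M * ((b - a) + 1))).
- congr culim; apply/funext => k; rewrite /grid_sum big_distrr/=.
  by apply: eq_bigr => j _; rewrite mulrA.
- by move=> k; exact: grid_sum_bounded.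
Qed.

Lemma near_invS e : 0 < e -> \forall k \near \oo, k.+1%:R^-1 <= e.
Proof.
move=> e0; near=> k.
have ek : e^-1 <= k%:R by near: k; exact: nbhs_infty_ger.
rewrite invf_ple ?posrE ?ltr0n//.
by apply: le_trans ek _; rewrite ler_nat.
Unshelve. all: by end_near. Qed.

Lemma grid_int_le g a b M : a <= b -> seg_bounded g a b M ->
  normc (grid_int g a b) <= 2 * (M * (b - a)).
Proof.
move=> ab gM; have M0 := seg_bounded_ge0 ab gM.
apply/ler_addgt0Pr => e e0.
have e20 : 0 < e / 2 by rewrite divr_gt0.
have -> : 2 * (M * (b - a)) + e = 2 * (M * (b - a) + e / 2).
  by field.
apply: (@culim_le _ _ (M * ((b - a) + 1))).
  by move=> k; exact: grid_sum_bounded.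
have d0 : 0 < (e / 2) / (M + 1) by rewrite divr_gt0// ltr_wpDl.
near=> k.
apply: le_trans (grid_sum_le k ab M0 gM) _; rewrite mulrDr lerD2l.
have : k.+1%:R^-1 <= (e / 2) / (M + 1) by near: k; exact: near_invS.
rewrite ler_pdivlMr ?ltr_wpDl// => h; apply: le_trans h.
by rewrite mulrC ler_wpM2l ?invr_ge0// lerDl.
Unshelve. all: by end_near. Qed.

Lemma grid_int_cst z a b : a <= b -> grid_int (fun=> z) a b = z * (b - a)%:C.
Proof.
move=> ab; have zM : seg_bounded (fun=> 1) a b 1 by move=> x _; rewrite normc1.
have -> : grid_int (fun=> z) a b = z * grid_int (fun=> 1) a b.
  by rewrite -(grid_int_Z _ ab zM); apply: grid_int_ext => x _; rewrite mulr1.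
congr (z * _).
have rE k : grid_sum k (fun=> 1) a b = ((grid_idx k b - grid_idx k a)%N%:R / k.+1%:R)%:C.
  rewrite /grid_sum sumr_const_nat subSS -[LHS]mulr_natl div1r.
  by rewrite rmorphM fmorphV !rmorph_nat.
pose u k := grid_sum k (fun=> 1) a b - (b - a)%:C.
have uM k : normc (u k) <= 1 * (b - a + 1) + normc (b - a)%:C.
  by apply: le_trans (le_normcB _ _) _; rewrite lerD2r; exact: grid_sum_bounded.
have -> : grid_int (fun=> 1) a b = culim u + culim (fun=> (b - a)%:C).
  rewrite -(@culimD _ _ _ (1 * (b - a + 1) + normc (b - a)%:C)
    (normc (b - a)%:C))//.
  by congr culim; apply/funext => k; rewrite /u subrK.
rewrite culim_cst (@culim_eq0 _ _ (1 * (b - a + 1) + normc (b - a)%:C)) ?add0r//.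
move=> e e0; near=> k.
have ak : - a <= k%:R by near: k; exact: nbhs_infty_ger.
have ke : k.+1%:R^-1 <= e by near: k; exact: near_invS.
rewrite /u rE -rmorphB normc_real ler_norml.
have := grid_count_le k ab; have := grid_count_ge ab ak.
set q := _ / _; set d := _^-1 in ke * => h1 h2.
apply/andP; split; lra.
Unshelve. all: by end_near. Qed.

Lemma grid_int_cat g a b c M : a <= b -> b <= c -> seg_bounded g a c M ->
  grid_int g a c = grid_int g a b + grid_int g b c.
Proof.
move=> ab bc gM.
have gab : seg_bounded g a b M.
  by move=> x /andP[ax xb]; apply: gM; rewrite ax (le_trans xb).
have gbc : seg_bounded g b c M.
  by move=> x /andP[bx xc]; apply: gM; rewrite xc (le_trans ab).
have M0 := seg_bounded_ge0 ab gab.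
rewrite /grid_int -(@culimD _ _ _ (M * ((b - a) + 1)) (M * ((c - b) + 1))).
- congr culim; apply/funext => k; rewrite /grid_sum.
  by rewrite -big_cat_nat//= ltnS grid_idx_le.
- by move=> k; exact: grid_sum_bounded.
- by move=> k; exact: grid_sum_bounded.
Qed.

End riemann.

Arguments grid_int : simpl never.

(** * Goursat's theorem for rectangles *)

Section bisection.
Context {R : realType}.
Implicit Types (a b c d x y L H : R).

(** The supremum of the left ends is a common point. *)
Lemma nested_intervals (a l : nat -> R) : (forall k, 0 <= l k) ->
  (forall k, a k <= a k.+1 /\ a k.+1 + l k.+1 <= a k + l k) ->
  exists x, forall k, a k <= x <= a k + l k.
Proof.
move=> l0 al.
have aS i j : a i <= a (j + i)%N.
  by elim: j => [//|j ih]; apply: le_trans ih (al _).1.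
have bS i j : a (j + i)%N + l (j + i)%N <= a i + l i.
  by elim: j => [//|j ih]; apply: le_trans (al _).2 ih.
have ab i j : a i <= a j + l j.
  apply: le_trans (aS i j) _; rewrite addnC.
  by apply: le_trans (bS j i); rewrite lerDl.
have ne : has_sup (range a).
  split; first by exists (a 0%N), 0%N.
  by exists (a 0%N + l 0%N) => _ [i _ <-]; exact: ab.
exists (sup (range a)) => k; apply/andP; split.
  by apply: sup_upper_bound => //; exists k.
by apply: ge_sup; [exists (a 0%N), 0%N|move=> _ [i _ <-]; exact: ab].
Qed.

(** If P failed for the whole rectangle, it would fail for one of its quarters,
    for a quarter of that one, and so on; these shrink to a point, around which P
    holds for all small rectangles. A rectangle is given by its lower left corner
    and by the number k of times that its sides L and H were halved. *)
Lemma bisection L H (P : R * R -> nat -> Prop) (a0 c0 : R) :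
  0 <= L -> 0 <= H ->
  (forall a c k,
     P (a, c) k.+1 -> P (a + L / 2 ^+ k.+1, c) k.+1 ->
     P (a, c + H / 2 ^+ k.+1) k.+1 ->
     P (a + L / 2 ^+ k.+1, c + H / 2 ^+ k.+1) k.+1 -> P (a, c) k) ->
  (forall x y, a0 <= x <= a0 + L -> c0 <= y <= c0 + H ->
     exists2 e, 0 < e & forall a c k, a <= x <= a + L / 2 ^+ k ->
       c <= y <= c + H / 2 ^+ k -> (L + H) / 2 ^+ k < e -> P (a, c) k) ->
  P (a0, c0) 0%N.
Proof.
move=> L0 H0 split4 local; apply: contrapT => nP0.
have step (t : R * R * nat) : exists s : R * R, ~ P t.1 t.2 ->
    [/\ ~ P s t.2.+1, s.1 = t.1.1 \/ s.1 = t.1.1 + L / 2 ^+ t.2.+1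
      & s.2 = t.1.2 \/ s.2 = t.1.2 + H / 2 ^+ t.2.+1].
  case: t => -[a c] k /=; have [Pk|nPk] := pselect (P (a, c) k).
    by exists (a, c) => /(_ Pk).
  apply: contrapT => /forallNP nex; apply: nPk; apply: split4;
    apply: contrapT => nP.
  - by apply: (nex (a, c)) => _; split => //; left.
  - by apply: (nex (a + L / 2 ^+ k.+1, c)) => _; split => //; [right|left].
  - by apply: (nex (a, c + H / 2 ^+ k.+1)) => _; split => //; [left|right].
  - by apply: (nex (a + L / 2 ^+ k.+1, c + H / 2 ^+ k.+1)) => _;
      split => //; right.
have [f fP] := choice step.
pose q := fix q k : R * R := if k is k'.+1 then f (q k', k') else (a0, c0).
have nP k : ~ P (q k) k.
  by elim: k => // k ih; have [] := fP (q k, k) ih.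
have half M k : M / 2 ^+ k = M / 2 ^+ k.+1 + M / 2 ^+ k.+1 :> R.
  by rewrite exprS; field; rewrite expf_neq0.
have ge0 M k : 0 <= M -> 0 <= M / 2 ^+ k :> R by move=> ?; rewrite divr_ge0// exprn_ge0.
have [||x xP] := @nested_intervals (fun k => (q k).1) (fun k => L / 2 ^+ k).
- by move=> k; exact: ge0.
- move=> k; have [_ qk _] := fP (q k, k) (nP k).
  have := half L k; have := ge0 L k.+1 L0.
  by move: qk => /= [] ->; set u := L / 2 ^+ k.+1 => u0 ->; split; lra.
have [||y yP] := @nested_intervals (fun k => (q k).2) (fun k => H / 2 ^+ k).
- by move=> k; exact: ge0.
- move=> k; have [_ _ qk] := fP (q k, k) (nP k).
  have := half H k; have := ge0 H k.+1 H0.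
  by move: qk => /= [] ->; set u := H / 2 ^+ k.+1 => u0 ->; split; lra.
have := xP 0%N; have := yP 0%N; rewrite !divr1/= => y0 x0.
have [e e0 eP] := local x y x0 y0.
near \oo => k.
apply: (nP k); have := eP (q k).1 (q k).2 k (xP k) (yP k).
rewrite -surjective_pairing; apply.
have ek : (L + H) / e < k%:R by near: k; exact: nbhs_infty_gtr.
rewrite ltr_pdivrMr ?exprn_gt0// -ltr_pdivrMl// mulrC.
apply: lt_trans ek _; rewrite -natrX ltr_nat; exact: ltn_expl.
Unshelve. all: by end_near. Qed.

End bisection.

Section rectangle.
Context {R : realType}.
Implicit Types (h g : R[i] -> R[i]) (a b c d x y M N e : R) (z w : R[i]).

Lemma itv_dist a b x y : a <= x <= b -> a <= y <= b -> `|y - x| <= b - a.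
Proof.
move=> /andP[ax xb] /andP[ay yb]; rewrite ler_norml.
by apply/andP; split; lra.
Qed.

(** The integral of h(z) dz over the boundary, counterclockwise. *)
Definition rect_int h a b c d : R[i] :=
  grid_int (fun x => h (x +i* c)) a b - grid_int (fun x => h (x +i* d)) a b
  + 'i * (grid_int (fun y => h (b +i* y)) c d - grid_int (fun y => h (a +i* y)) c d).

Arguments rect_int : simpl never.

Definition rect_bounded h a b c d M :=
  forall x y, a <= x <= b -> c <= y <= d -> normc (h (x +i* y)) <= M.

Definition sides_bounded h a b c d M :=
  forall x y, a <= x <= b -> c <= y <= d ->
  [|| x == a, x == b, y == c | y == d] -> normc (h (x +i* y)) <= M.

Lemma rect_sides_bounded h a b c d M : rect_bounded h a b c d M ->
  sides_bounded h a b c d M.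
Proof. by move=> hM x y xi yi _; exact: hM. Qed.

Lemma sides_bounded_segs h a b c d M : a <= b -> c <= d ->
  sides_bounded h a b c d M ->
  [/\ seg_bounded (fun x => h (x +i* c)) a b M, seg_bounded (fun x => h (x +i* d)) a b M,
      seg_bounded (fun y => h (a +i* y)) c d M & seg_bounded (fun y => h (b +i* y)) c d M].
Proof.
by move=> ab cd hM; split=> x xi; apply: hM; rewrite ?eqxx ?orbT ?lexx ?ab ?cd.
Qed.

Lemma rect_int_ext h g a b c d : a <= b -> c <= d ->
  (forall x y, a <= x <= b -> c <= y <= d ->
     [|| x == a, x == b, y == c | y == d] -> h (x +i* y) = g (x +i* y)) ->
  rect_int h a b c d = rect_int g a b c d.
Proof.
move=> ab cd hg; rewrite /rect_int; congr (_ - _ + _ * (_ - _));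
  by apply: grid_int_ext => x xi; apply: hg; rewrite ?eqxx ?orbT ?lexx ?ab ?cd.
Qed.

Lemma rect_int_D h g a b c d M N : a <= b -> c <= d ->
  sides_bounded h a b c d M -> sides_bounded g a b c d N ->
  rect_int (fun z => h z + g z) a b c d = rect_int h a b c d + rect_int g a b c d.
Proof.
move=> ab cd /(sides_bounded_segs ab cd)[h1 h2 h3 h4] /(sides_bounded_segs ab cd)[g1 g2 g3 g4].
rewrite /rect_int (grid_int_D ab h1 g1) (grid_int_D ab h2 g2) (grid_int_D cd h3 g3)
  (grid_int_D cd h4 g4).
by ring.
Qed.

Lemma rect_int_Z z h a b c d M : a <= b -> c <= d ->
  sides_bounded h a b c d M ->
  rect_int (fun w => z * h w) a b c d = z * rect_int h a b c d.
Proof.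
move=> ab cd /(sides_bounded_segs ab cd)[h1 h2 h3 h4].
rewrite /rect_int (grid_int_Z _ ab h1) (grid_int_Z _ ab h2) (grid_int_Z _ cd h3)
  (grid_int_Z _ cd h4).
by ring.
Qed.

Lemma rect_int_le h a b c d M : a <= b -> c <= d -> sides_bounded h a b c d M ->
  normc (rect_int h a b c d) <= 4 * M * ((b - a) + (d - c)).
Proof.
move=> ab cd /(sides_bounded_segs ab cd)[h1 h2 h3 h4].
rewrite /rect_int; apply: le_trans (le_normcD _ _) _.
rewrite normcM normci mul1r.
have := le_normcB (grid_int (fun x => h (x +i* c)) a b)
  (grid_int (fun x => h (x +i* d)) a b).
have := le_normcB (grid_int (fun y => h (b +i* y)) c d)
  (grid_int (fun y => h (a +i* y)) c d).
have := grid_int_le ab h1; have := grid_int_le ab h2; have := grid_int_le cd h3;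
  have := grid_int_le cd h4.
by lra.
Qed.

Lemma rect_int_catx h a m b c d M : a <= m -> m <= b ->
  seg_bounded (fun x => h (x +i* c)) a b M -> seg_bounded (fun x => h (x +i* d)) a b M ->
  rect_int h a b c d = rect_int h a m c d + rect_int h m b c d.
Proof.
by move=> am mb h1 h2; rewrite /rect_int (grid_int_cat am mb h1) (grid_int_cat am mb h2);
  ring.
Qed.

Lemma rect_int_caty h a b c m d M : c <= m -> m <= d ->
  seg_bounded (fun y => h (a +i* y)) c d M -> seg_bounded (fun y => h (b +i* y)) c d M ->
  rect_int h a b c d = rect_int h a b c m + rect_int h a b m d.
Proof.
by move=> am mb h1 h2; rewrite /rect_int (grid_int_cat am mb h1) (grid_int_cat am mb h2);
  ring.
Qed.

(** The values of an affine function on two opposite sides differ by a constant,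
    so that only integrals of constants remain, and these cancel. *)
Lemma rect_int_affine z w a b c d : a <= b -> c <= d ->
  rect_int (fun u => z + w * u) a b c d = 0.
Proof.
move=> ab cd.
have affB p q : a <= b -> normc (z + w * (p +i* q)) <=
    normc z + normc w * (`|p| + `|q|) :> R.
  move=> _; apply: le_trans (le_normcD _ _) _; rewrite lerD2l normcM.
  by rewrite ler_wpM2l ?normc_ge0//; exact: le_trans (normc_le_ReIm _) _.
have JB (g1 g2 : R -> R[i]) (a' b' M N : R) z' : a' <= b' -> seg_bounded g1 a' b' M ->
    seg_bounded g2 a' b' N ->
    (forall x, g1 x = g2 x + z') ->
    grid_int g1 a' b' - grid_int g2 a' b' = z' * (b' - a')%:C.
  move=> ab' g1M g2N g12.
  have -> : grid_int g1 a' b' = grid_int (fun x => g2 x + z') a' b' by apply: grid_int_ext.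
  rewrite (@grid_int_D _ _ (fun=> z') _ _ N (normc z') ab')//.
  by rewrite grid_int_cst// addrAC subrr add0r.
have absM p q x : p <= x <= q -> `|x| <= `|p| + `|q| :> R.
  move=> /andP[px xq]; rewrite ler_norml.
  have := ler_norm q; have := ler_norm (- p); rewrite normrN.
  by have := normr_ge0 p; have := normr_ge0 q => *; apply/andP; split; lra.
have bx y : seg_bounded (fun x => z + w * (x +i* y)) a b
    (normc z + normc w * ((`|a| + `|b|) + `|y|)).
  move=> x xi; apply: le_trans (affB _ _ ab) _; rewrite lerD2l.
  by rewrite ler_wpM2l ?normc_ge0// lerD2r absM.
have by_ x : seg_bounded (fun y => z + w * (x +i* y)) c d
    (normc z + normc w * (`|x| + (`|c| + `|d|))).
  move=> y yi; apply: le_trans (affB _ _ ab) _; rewrite lerD2l.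
  by rewrite ler_wpM2l ?normc_ge0// lerD2l absM.
rewrite /rect_int (JB _ _ _ _ _ _ (w * ('i * (c - d)%:C)) ab (bx c) (bx d)); last first.
  move=> x; rewrite -addrA; congr (_ + _); rewrite -mulrDr; congr (_ * _).
  by apply/eqP; rewrite eq_complex /=; apply/andP; split; apply/eqP; ring.
rewrite (JB _ _ _ _ _ _ (w * (b - a)%:C) cd (by_ b) (by_ a)); last first.
  move=> x; rewrite -addrA; congr (_ + _); rewrite -mulrDr; congr (_ * _).
  by apply/eqP; rewrite eq_complex /=; apply/andP; split; apply/eqP; ring.
by rewrite !rmorphB /=; ring.
Qed.

Definition cdifferentiable h z := exists D : R[i], forall e, 0 < e ->
  exists2 r, 0 < r & forall w, normc (w - z) <= r ->
    normc (h w - h z - D * (w - z)) <= e * normc (w - z).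

(** Up to its affine part at z, whose integral vanishes, h is bounded by e times
    the diameter of the rectangle. *)
Lemma rect_int_local h D z a b c d e : a <= Re z <= b -> c <= Im z <= d ->
  0 <= e ->
  (forall x y, a <= x <= b -> c <= y <= d ->
     normc (h (x +i* y) - h z - D * (x +i* y - z)) <= e * normc (x +i* y - z)) ->
  normc (rect_int h a b c d) <= 4 * e * ((b - a) + (d - c)) ^+ 2.
Proof.
move=> /andP[az zb] /andP[cz zd] e0 hz.
have ab := le_trans az zb; have cd := le_trans cz zd.
pose A u := (h z - D * z) + D * u.
pose T u := h u - h z - D * (u - z).
set l := (b - a) + (d - c).
have TM : rect_bounded T a b c d (e * l).
  move=> x y xi yi; apply: le_trans (hz x y xi yi) _.
  rewrite ler_wpM2l//; apply: le_trans (normc_le_ReIm _) _.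
  by rewrite !raddfB /=; apply: lerD; apply: itv_dist; rewrite ?az ?cz.
have AM : rect_bounded A a b c d (normc (h z - D * z) + normc D * (`|a| + `|b| + `|c| +
  `|d|)).
  move=> x y /andP[ax xb] /andP[cy yd]; apply: le_trans (le_normcD _ _) _.
  rewrite lerD2l normcM ler_wpM2l ?normc_ge0//.
  apply: le_trans (normc_le_ReIm _) _ => /=; rewrite -addrA lerD//.
    rewrite ler_norml; have := ler_norm b; have := ler_norm (- a); rewrite normrN.
    by have := normr_ge0 a; have := normr_ge0 b => *; apply/andP; split; lra.
  rewrite ler_norml; have := ler_norm d; have := ler_norm (- c); rewrite normrN.
  by have := normr_ge0 c; have := normr_ge0 d => *; apply/andP; split; lra.
have -> : rect_int h a b c d = rect_int (fun u => A u + T u) a b c d.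
  by apply: rect_int_ext => // x y _ _ _; rewrite /A /T; ring.
rewrite (rect_int_D ab cd (rect_sides_bounded AM)
  (rect_sides_bounded TM)) rect_int_affine// add0r.
apply: le_trans (rect_int_le ab cd (rect_sides_bounded TM)) _.
by rewrite le_eqVlt; apply/orP; left; apply/eqP; rewrite -/l; ring.
Qed.

(** By rect_int_local, around each point the integral over a small rectangle is at
    most e' times the square of its perimeter. Halving the sides divides that
    square by 4, so the estimate is inherited from the four quarters by the
    rectangle, and bisection yields it for the whole rectangle with any e. *)
Lemma goursat h a b c d M : a <= b -> c <= d -> rect_bounded h a b c d M ->
  (forall x y, a <= x <= b -> c <= y <= d -> cdifferentiable h (x +i* y)) ->
  rect_int h a b c d = 0.
Proof.
move=> ab cd hM hd; apply: normc_le_eps => e e0.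
set L := b - a; set H := d - c.
have L0 : 0 <= L by rewrite subr_ge0.
have H0 : 0 <= H by rewrite subr_ge0.
have LH0 : 0 <= L + H by rewrite addr_ge0.
pose P (t : R * R) k := a <= t.1 -> t.1 + L / 2 ^+ k <= b ->
  c <= t.2 -> t.2 + H / 2 ^+ k <= d ->
  normc (rect_int h t.1 (t.1 + L / 2 ^+ k) t.2 (t.2 + H / 2 ^+ k)) <= e / 4 ^+ k.
have half N k : N / 2 ^+ k = N / 2 ^+ k.+1 + N / 2 ^+ k.+1 :> R.
  by rewrite exprS; field; rewrite expf_neq0.
have pos N k : 0 <= N -> 0 <= N / 2 ^+ k :> R.
  by move=> ?; rewrite divr_ge0// exprn_ge0.
have aL : a + L = b by rewrite /L addrC subrK.
have cH : c + H = d by rewrite /H addrC subrK.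
suff : P (a, c) 0%N.
  by rewrite /P/= !expr0 !divr1 aL cH; apply.
apply: (@bisection _ L H) => //.
- move=> a' c' k; rewrite /P/=; rewrite !(half L k) !(half H k).
  set l := L / 2 ^+ k.+1; set m := H / 2 ^+ k.+1.
  have l0 : 0 <= l by exact: pos.
  have m0 : 0 <= m by exact: pos.
  move=> P1 P2 P3 P4 aa ab' cc cd'; rewrite !addrA in ab' cd' *.
  have hM' : rect_bounded h a' (a' + l + l) c' (c' + m + m) M.
    move=> x y /andP[ax xb] /andP[cy yd]; apply: hM.
      by rewrite (le_trans aa)//= (le_trans xb)//.
    by rewrite (le_trans cc)//= (le_trans yd)//.
  have l1 : a' <= a' + l by rewrite lerDl.
  have l2 : a' + l <= a' + l + l by rewrite lerDl.
  have m1 : c' <= c' + m by rewrite lerDl.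
  have m2 : c' + m <= c' + m + m by rewrite lerDl.
  have bx y' : c' <= y' <= c' + m + m ->
      seg_bounded (fun x => h (x +i* y')) a' (a' + l + l) M.
    by move=> yi x xi; apply: hM'.
  have by_ x' : a' <= x' <= a' + l + l ->
      seg_bounded (fun y => h (x' +i* y)) c' (c' + m + m) M.
    by move=> xi y yi; apply: hM'.
  rewrite (rect_int_catx l1 l2 (bx _ _) (bx _ _)) ?lexx ?(le_trans m1)//.
  rewrite (rect_int_caty m1 m2 (by_ _ _) (by_ _ _)) ?lexx ?l1 ?l2 ?(le_trans l1)//.
  rewrite (rect_int_caty m1 m2 (by_ _ _) (by_ _ _)) ?lexx ?l1 ?l2 ?(le_trans l1)//.
  have -> : e / 4 ^+ k = e / 4 ^+ k.+1 + e / 4 ^+ k.+1 + (e / 4 ^+ k.+1 + e / 4 ^+ k.+1).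
    by rewrite exprS; field; rewrite expf_neq0.
  apply: le_trans (le_normcD _ _) _; apply: lerD.
    by apply: le_trans (le_normcD _ _) _; apply: lerD;
      [apply: P1|apply: P3]; rewrite //= ?(le_trans l2) ?(le_trans m2) ?(le_trans cc).
  by apply: le_trans (le_normcD _ _) _; apply: lerD;
      [apply: P2|apply: P4]; rewrite //= ?(le_trans aa) ?(le_trans m2) ?(le_trans cc).
- move=> x y; rewrite aL cH => xi yi.
  have [D hD] := hd x y xi yi.
  pose e' := e / (4 * (L + H + 1) ^+ 2).
  have e'0 : 0 < e' by rewrite divr_gt0// mulr_gt0// exprn_gt0// ltr_wpDl.
  have [r r0 rP] := hD e' e'0.
  exists r => // a' c' k xa yc LHr; rewrite /P/= => aa ab' cc cd'.
  apply: le_trans (@rect_int_local h D (x +i* y) _ _ _ _ e' xa yc (ltW e'0) _) _.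
    move=> x' y' x'i y'i; apply: rP; apply: le_trans (normc_le_ReIm _) _ => /=.
    apply: le_trans _ (ltW LHr); rewrite mulrDl.
    apply: lerD; first by rewrite (le_trans (itv_dist xa x'i))// addrAC subrr add0r.
    by rewrite (le_trans (itv_dist yc y'i))// addrAC subrr add0r.
  have addK (u v : R) : u + v - u = v by rewrite addrAC subrr add0r.
  rewrite !addK -mulrDl exprMn exprVn -exprM mulnC exprM.
  have -> : 2 ^+ 2 = 4 :> R by rewrite expr2; ring.
  rewrite mulrA ler_wpM2r ?invr_ge0 ?exprn_ge0//.
  have -> : 4 * e' = e / (L + H + 1) ^+ 2.
    by rewrite /e'; field; rewrite gt_eqF// ltr_wpDl.
  rewrite -mulrA ger_pMr// mulrC ler_pdivrMr ?exprn_gt0 ?ltr_wpDl// mul1r.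
  by rewrite ler_pXn2r ?nnegrE ?LH0 ?(addr_ge0 LH0)// lerDl.
Qed.

End rectangle.

(** * Complex derivatives with error bounds *)

Section complex_derivative.
Context {R : realType}.
Implicit Types (e r : R) (w z l : R[i]).

Lemma normC_normc z : `|z| = (normc z)%:C.
Proof. by []. Qed.

Lemma posC e : (0 < e%:C :> R[i]) = (0 < e).
Proof. by rewrite ltcR. Qed.

Lemma posC_real (x : R[i]) : 0 < x -> exists2 e, 0 < e & x = e%:C.
Proof.
case: x => a b; rewrite ltcE/= => /andP[/eqP ba a0]; exists a => //.
by rewrite ba.
Qed.

(** The real-valued form of a directional derivative, in which derivatives enter
    and leave the contour estimates. *)
Lemma derive_cvgP (V : normedModType R[i]) (f : V -> R[i]) (x v : V) l :
  (fun h => h^-1 *: (f (h *: v + x) - f x)) @ 0^' --> l <->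
  (forall e, 0 < e -> exists2 r, 0 < r & forall h, normc h <= r ->
     normc (f (h *: v + x) - f x - l * h) <= e * normc h).
Proof.
split=> [/cvgr_dist_le fl e e0|fe].
  have := fl _ (etrans (posC e) e0).
  move=> /nbhs_ballP[x0 /= /posC_real[r r0 ->] rP].
  exists (r / 2) => [|h hr]; first by rewrite divr_gt0.
  have [->|h0] := eqVneq h 0.
    by rewrite scale0r add0r subrr mulr0 subrr normc0 mulr0.
  have := rP h; rewrite -ball_normE/= sub0r normrN !normC_normc ltcR lecR => /(_ _ h0) He.
  have hlt : normc h < r by apply: le_lt_trans hr _; lra.
  have -> : f (h *: v + x) - f x - l * h =
      - h * (l - h^-1 *: (f (h *: v + x) - f x)).
    by rewrite /GRing.scale/=; field.
  by rewrite normcM normcN mulrC ler_wpM2r ?normc_ge0// He.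
apply/cvgrPdist_le => _ /posC_real[e e0 ->].
have [r r0 rP] := fe e e0.
apply/nbhs_ballP; exists r%:C => /=; first by rewrite posC.
move=> h; rewrite -ball_normE/= sub0r normrN !normC_normc ltcR lecR => hr h0.
have := rP h (ltW hr).
have -> : f (h *: v + x) - f x - l * h =
    - h * (l - h^-1 *: (f (h *: v + x) - f x)).
  by rewrite /GRing.scale/=; field.
by rewrite normcM normcN mulrC ler_pM2r// normc_gt0.
Qed.

Lemma derive_val_eps (V : normedModType R[i]) (f : V -> R[i]) (x v : V) l :
  (forall e, 0 < e -> exists2 r, 0 < r & forall h, normc h <= r ->
     normc (f (h *: v + x) - f x - l * h) <= e * normc h) -> 'D_v f x = l.
Proof. by move=> /derive_cvgP fl; exact: cvg_lim fl. Qed.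

Lemma derivable_eps (V : normedModType R[i]) (f : V -> R[i]) (x v : V) :
  derivable f x v <->
  exists l, forall e, 0 < e -> exists2 r, 0 < r & forall h, normc h <= r ->
     normc (f (h *: v + x) - f x - l * h) <= e * normc h.
Proof.
split=> [/cvg_ex[l /derive_cvgP fl]|[l /derive_cvgP fl]]; first by exists l.
by apply/cvg_ex; exists l.
Qed.

Lemma cdifferentiableP (h : R[i] -> R[i]) z :
  cdifferentiable h z <-> derivable h z 1.
Proof.
rewrite derivable_eps; split=> -[l lP]; exists l => e /lP[r r0 rP]; exists r => //.
  move=> w wr; have := rP (w + z); rewrite addrK => /(_ wr).
  by rewrite /GRing.scale/= mulr1.
move=> w wr; have := rP (w - z) wr.
by rewrite /GRing.scale/= mulr1 subrK.
Qed.

End complex_derivative.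

(** * Cauchy's formula in one variable *)

Section cauchy1.
Context {R : realType}.
Implicit Types (h g : R[i] -> R[i]) (a b c d x y M N e r : R) (z w : R[i]).

(** The region between the two boundaries is the union of four rectangles to
    which Goursat's theorem applies: two strips at the sides, and one rectangle
    below and one above the inner one. *)
Lemma rect_int_annulus h a b c d a' b' c' d' M :
  a <= a' -> a' <= b' -> b' <= b -> c <= c' -> c' <= d' -> d' <= d ->
  (forall x y, a <= x <= b -> c <= y <= d ->
     ~~ [&& a' < x, x < b', c' < y & y < d'] ->
     normc (h (x +i* y)) <= M /\ cdifferentiable h (x +i* y)) ->
  rect_int h a b c d = rect_int h a' b' c' d'.
Proof.
move=> aa ab bb cc cd dd hann.
have goursat0 a1 b1 c1 d1 : a <= a1 -> a1 <= b1 -> b1 <= b -> c <= c1 ->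
    c1 <= d1 -> d1 <= d -> [|| b1 <= a', b' <= a1, d1 <= c' | d' <= c1] ->
    rect_int h a1 b1 c1 d1 = 0.
  move=> aa1 ab1 bb1 cc1 cd1 dd1 out.
  have hP x y : a1 <= x <= b1 -> c1 <= y <= d1 ->
      normc (h (x +i* y)) <= M /\ cdifferentiable h (x +i* y).
    move=> /andP[ax xb] /andP[cy yd]; apply: hann.
    - by rewrite (le_trans aa1)//= (le_trans xb).
    - by rewrite (le_trans cc1)//= (le_trans yd).
    apply: contraL out => /and4P[ax' xb' cy' yd']; rewrite !negb_or -!ltNge.
    by rewrite (lt_le_trans ax')// (le_lt_trans ax)// (lt_le_trans cy')// (le_lt_trans cy).
  by apply: (@goursat _ _ _ _ _ _ M) => // x y xi yi; have [] := hP x y xi yi.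
have yout y x : a <= x <= b -> c <= y <= d -> [|| x <= a', b' <= x, y <= c' | d' <= y] ->
    normc (h (x +i* y)) <= M.
  move=> xi yi out; apply: (hann x y xi yi _).1.
  by apply: contraL out => /and4P[? ? ? ?]; rewrite !negb_or -!ltNge; apply/and4P.
have c'd : c' <= d := le_trans cd dd.
have cd' : c <= d' := le_trans cc cd.
have cd0 : c <= d := le_trans cc c'd.
have a'b : a' <= b := le_trans ab bb.
have ab' : a <= b' := le_trans aa ab.
rewrite (@rect_int_catx _ h a a' b c d M)//; first last.
- by move=> x xi; apply: yout; rewrite ?lexx ?cd0 ?dd ?orbT.
- by move=> x xi; apply: yout; rewrite ?lexx ?cd0 ?cc ?orbT.
rewrite goursat0 ?lexx// add0r.
rewrite (@rect_int_catx _ h a' b' b c d M)//; first last.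
- by move=> x /andP[ax xb]; apply: yout; rewrite ?lexx ?cd0 ?dd ?orbT// xb (le_trans aa).
- by move=> x /andP[ax xb]; apply: yout; rewrite ?lexx ?cd0 ?cc ?orbT// xb (le_trans aa).
rewrite [rect_int h b' b c d]goursat0 ?lexx ?orbT// addr0.
rewrite (@rect_int_caty _ h a' b' c c' d M)//; first last.
- by move=> y yi; apply: yout; rewrite ?lexx ?ab' ?orbT.
- by move=> y yi; apply: yout; rewrite ?lexx ?aa ?a'b.
rewrite [rect_int h a' b' c c']goursat0 ?lexx ?orbT// add0r.
rewrite (@rect_int_caty _ h a' b' c' d' d M)//; first last.
- by move=> y /andP[cy yd]; apply: yout; rewrite ?lexx ?ab' ?orbT// yd (le_trans cc).
- by move=> y /andP[cy yd]; apply: yout; rewrite ?lexx ?aa ?a'b// yd (le_trans cc).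
by rewrite [rect_int h a' b' d' d]goursat0 ?lexx ?orbT// addr0.
Qed.

Definition square_int r h := rect_int h (- r) r (- r) r.

Definition square_bounded r h M := sides_bounded h (- r) r (- r) r M.

Lemma side_ge r x y : - r <= x <= r -> - r <= y <= r ->
  [|| x == - r, x == r, y == - r | y == r] -> r <= normc (x +i* y).
Proof.
move=> /andP[x1 x2] /andP[y1 y2] side.
have r0 : 0 <= r by lra.
case/or4P: side => /eqP E.
- by apply: le_trans (norm_Re _); rewrite /= E normrN ger0_norm.
- by apply: le_trans (norm_Re _); rewrite /= E ger0_norm.
- by apply: le_trans (norm_Im _); rewrite /= E normrN ger0_norm.
- by apply: le_trans (norm_Im _); rewrite /= E ger0_norm.
Qed.

Lemma sq_le r x y : - r <= x <= r -> - r <= y <= r -> normc (x +i* y) <= 2 * r.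
Proof.
move=> x1 y1; apply: le_trans (normc_le_ReIm _) _ => /=.
by rewrite -!ler_norml in x1 y1; lra.
Qed.

Lemma le_square_int r h M : 0 <= r -> square_bounded r h M ->
  normc (square_int r h) <= 16 * M * r.
Proof.
move=> r0 hM; have rr : - r <= r by lra.
by apply: le_trans (rect_int_le rr rr hM) _; lra.
Qed.

Lemma cdifferentiable_inv w z : z != w ->
  cdifferentiable (fun u => (u - w)^-1) z.
Proof.
move=> zw; apply/cdifferentiableP; apply: (@derivableV _ _ (fun u => u - w)).
  by rewrite subr_eq0.
by apply: derivableB => //; exact: derivable_cst.
Qed.

(** The number 2 i pi, for all r > 0. *)
Definition winding r : R[i] := square_int r (fun z => z^-1).

(** The difference of the integrands is w / (z (z - w)). Its integral over the
    square of half side q does not depend on q >= r, and is O(1/q). *)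
Lemma square_int_inv r w : 0 < r -> normc w < r ->
  square_int r (fun z => (z - w)^-1) = winding r.
Proof.
move=> r0 wr.
pose psi z := (z - w)^-1 - z^-1.
have inv_le q z0 x y : normc z0 < q -> - q <= x <= q -> - q <= y <= q ->
    [|| x == - q, x == q, y == - q | y == q] ->
    normc (x +i* y - z0)^-1 <= (q - normc z0)^-1.
  move=> z0q xi yi side.
  have lb : q - normc z0 <= normc (x +i* y - z0).
    by have := normcD_ge (x +i* y) (- z0); rewrite normcN;
      have := side_ge xi yi side; lra.
  rewrite normcV lef_pV2 ?posrE ?subr_gt0//.
  by apply: lt_le_trans lb; rewrite subr_gt0.
have rr : - r <= r by lra.
have b1 : square_bounded r (fun z => (z - w)^-1) (r - normc w)^-1.
  by move=> x y; exact: inv_le.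
have b2 : square_bounded r (fun z => z^-1) r^-1.
  move=> x y xi yi side; have := inv_le r 0 x y; rewrite normc0 !subr0; exact.
suff psi0 : square_int r psi = 0.
  have : square_int r (fun z => psi z + z^-1) = square_int r psi + winding r.
    apply: (@rect_int_D _ _ _ _ _ _ _ ((r - normc w)^-1 + r^-1) r^-1) => //.
    move=> x y xi yi side; apply: le_trans (le_normcB _ _) _.
    by apply: lerD; [exact: b1|exact: b2].
  rewrite psi0 add0r => <-; congr (square_int r _); apply/funext => z.
  by rewrite /psi subrK.
have const q : r <= q -> square_int q psi = square_int r psi.
  move=> rq.
  have q0 : 0 < q := lt_le_trans r0 rq.
  apply: (@rect_int_annulus _ _ _ _ _ _ _ _ _ ((r - normc w)^-1 + r^-1)); rewrite ?lerN2//.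
  move=> x y xi yi out.
  have rn : r <= normc (x +i* y).
    rewrite leNgt; apply: contra out => n.
    have := le_lt_trans (norm_Re _) n; have := le_lt_trans (norm_Im _) n.
    by rewrite /= !ltr_norml => /andP[-> ->] /andP[-> ->].
  have lb : r - normc w <= normc (x +i* y - w).
    by have := normcD_ge (x +i* y) (- w); rewrite normcN; lra.
  split.
    apply: le_trans (le_normcB _ _) _; rewrite !normcV lerD//.
      rewrite lef_pV2 ?posrE ?subr_gt0//.
      by apply: lt_le_trans lb; rewrite subr_gt0.
    by rewrite lef_pV2 ?posrE// (lt_le_trans r0).
  have zw : x +i* y != w.
    by apply: contraTneq rn => ->; rewrite -ltNge.
  have z0 : x +i* y != 0.
    by apply: contraTneq rn => ->; rewrite -ltNge normc0.
  apply/cdifferentiableP; apply: derivableB; apply/cdifferentiableP;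
    first exact: cdifferentiable_inv.
  by have := cdifferentiable_inv z0; under eq_fun do rewrite subr0.
apply: normc_le_eps => e e0.
(* On the square of half side q >= 2 |w| the difference is at most
   2 |w| / q ^ 2, and the integral at most 32 |w| / q. *)
pose q := 2 * r + 32 * normc w / e.
have w0 := normc_ge0 w.
have q1 : 2 * r <= q by rewrite lerDl divr_ge0 ?mulr_ge0// ltW.
have q2 : 32 * normc w / e <= q by rewrite lerDr; lra.
have rq : r <= q by lra.
have q0 : 0 < q by lra.
rewrite -(const q)//.
have pb : square_bounded q psi (2 * normc w / q ^+ 2).
  move=> x y xi yi side; have nq := side_ge xi yi side.
  have lb : q / 2 <= normc (x +i* y - w).
    by have := normcD_ge (x +i* y) (- w); rewrite normcN; lra.
  have n0 : 0 < normc (x +i* y) by lra.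
  have n1 : 0 < normc (x +i* y - w) by lra.
  have z0 : x +i* y != 0 by rewrite -normc_gt0.
  have zw : x +i* y - w != 0 by rewrite -normc_gt0.
  have -> : psi (x +i* y) = w * ((x +i* y - w)^-1 * (x +i* y)^-1).
    by rewrite /psi; field; rewrite z0 zw.
  rewrite normcM [2 * _]mulrC -mulrA ler_wpM2l// normcM !normcV.
  have -> : 2 / q ^+ 2 = (q / 2)^-1 * q^-1 by field; lra.
  rewrite ler_pM ?invr_ge0 ?normc_ge0// lef_pV2 ?posrE//; lra.
apply: le_trans (le_square_int (ltW q0) pb) _.
have -> : 16 * (2 * normc w / q ^+ 2) * q = 32 * normc w / q by field; lra.
rewrite ler_pdivrMr//.
by move: q2; rewrite ler_pdivrMr// [q * e]mulrC.
Qed.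

(** The contributions of opposite sides add up to 2 i times the integral over
    [-r, r] of k x = 2 r / (x ^ 2 + r ^ 2). The values of k lie between 1/r and
    2/r, so within 1/(2 r) of their mean, and the integral of k is within 2 of 3. *)
Lemma winding_ge r : 0 < r -> 2 <= normc (winding r).
Proof.
move=> r0; have rr : - r <= r by lra.
pose k x : R[i] := (2 * r / (x ^+ 2 + r ^+ 2))%:C.
have den x : r ^+ 2 <= x ^+ 2 + r ^+ 2 by rewrite lerDr sqr_ge0.
have den0 x : 0 < x ^+ 2 + r ^+ 2 by apply: lt_le_trans (den x); rewrite exprn_gt0.
have invE x y : (x +i* y)^-1 = (x / (x ^+ 2 + y ^+ 2)) +i* (- y / (x ^+ 2 + y ^+ 2)).
  by rewrite mulNr.
have kM : seg_bounded k (- r) r (2 / r).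
  move=> x _; rewrite /k normc_real ger0_norm; last first.
    by rewrite divr_ge0 ?mulr_ge0// ltW.
  rewrite ler_pdivrMr// mulrAC ler_pdivlMr//; have := den x; lra.
have bh y : y ^+ 2 = r ^+ 2 -> seg_bounded (fun x => (x +i* y)^-1) (- r) r r^-1.
  move=> yr x _; rewrite normcV lef_pV2 ?posrE//.
    rewrite -(@ler_pXn2r _ 2) ?nnegrE ?normc_ge0 ?(ltW r0)//.
    by rewrite normc_def_sqr/= yr.
  rewrite normc_gt0; apply: contraTneq (den0 x) => -[-> y0].
  by rewrite -yr y0 expr0n addr0 ltxx.
have bv x : x ^+ 2 = r ^+ 2 -> seg_bounded (fun y => (x +i* y)^-1) (- r) r r^-1.
  move=> xr y _; rewrite normcV lef_pV2 ?posrE//.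
    rewrite -(@ler_pXn2r _ 2) ?nnegrE ?normc_ge0 ?(ltW r0)//.
    by rewrite normc_def_sqr/= xr lerDl sqr_ge0.
  rewrite normc_gt0; apply: contraTneq (den0 y) => -[x0 ->].
  by rewrite -xr x0 expr0n addr0 ltxx.
have sq : (- r) ^+ 2 = r ^+ 2 by rewrite sqrrN.
have JB (g1 g2 : R -> R[i]) z : seg_bounded g1 (- r) r r^-1 ->
  seg_bounded g2 (- r) r r^-1 ->
    (forall x, g1 x = z * k x + g2 x) ->
    grid_int g1 (- r) r - grid_int g2 (- r) r = z * grid_int k (- r) r.
  move=> g1b g2b g12.
  have zk : seg_bounded (fun x => z * k x) (- r) r (normc z * (2 / r)).
    by move=> x xi; rewrite normcM ler_wpM2l ?normc_ge0// kM.
  have -> : grid_int g1 (- r) r =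
    grid_int (fun x => z * k x + g2 x) (- r) r by exact: grid_int_ext.
  by rewrite (grid_int_D rr zk g2b) (grid_int_Z _ rr kM) addrK.
have PhiE : winding r = (2 * 'i) * grid_int k (- r) r.
  rewrite /winding /square_int /rect_int.
  rewrite (JB _ _ 'i%R (bh _ sq) (bh _ erefl)); last first.
    move=> x; rewrite !invE /k sq; apply/eqP; rewrite eq_complex/=.
    by apply/andP; split; apply/eqP; field; rewrite gt_eqF.
  rewrite (JB _ _ 1 (bv _ erefl) (bv _ sq)); last first.
    move=> y; rewrite !invE /k sq; apply/eqP; rewrite eq_complex/=.
    by rewrite [r ^+ 2 + _]addrC; apply/andP; split; apply/eqP; field; rewrite gt_eqF.
  by ring.
have Jk : 1 <= normc (grid_int k (- r) r).
  (* the midpoint of 1/r and 2/r *)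
  pose m : R[i] := (3 / (2 * r))%:C.
  have eb : seg_bounded (fun x => k x - m) (- r) r (1 / (2 * r)).
    move=> x xi; rewrite /k /m -rmorphB normc_real.
    have xr : x ^+ 2 <= r ^+ 2.
      by rewrite -ler_norml in xi;
        rewrite -(real_normK (num_real x)) ler_pXn2r ?nnegrE ?(ltW r0).
    have hi : 2 * r / (x ^+ 2 + r ^+ 2) <= 2 / r.
      by rewrite ler_pdivrMr// mulrAC ler_pdivlMr//; have := den x; lra.
    have lo : 1 / r <= 2 * r / (x ^+ 2 + r ^+ 2).
      by rewrite ler_pdivlMr// mulrAC ler_pdivrMr// mul1r; lra.
    have E1 : 3 / (2 * r) - 1 / (2 * r) = 1 / r by field; lra.
    have E2 : 3 / (2 * r) + 1 / (2 * r) = 2 / r by field; lra.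
    rewrite ler_norml; apply/andP; split; lra.
  have mb : seg_bounded (fun=> m) (- r) r (normc m) by move=> x _.
  have JkE : grid_int k (- r) r = grid_int (fun x => k x - m) (- r) r + 3.
    rewrite -[3](_ : grid_int (fun=> m) (- r) r = 3); last first.
      rewrite grid_int_cst// /m -rmorphM/=.
      have -> : 3 / (2 * r) * (r - - r) = 3 :> R by field; lra.
      by rewrite rmorph_nat.
    by rewrite -(grid_int_D rr eb mb); apply: grid_int_ext => x _; rewrite subrK.
  have := grid_int_le rr eb.
  have -> : 2 * (1 / (2 * r) * (r - - r)) = 2 by field; lra.
  move=> E2; have := normcD_ge 3 (grid_int (fun x => k x - m) (- r) r).
  rewrite [3 + _]addrC -JkE.
  have -> : normc (3 : R[i]) = 3 :> R.
    by rewrite -(rmorph_nat (real_complex R)) normc_real ger0_norm.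
  by lra.
rewrite PhiE normcM normcM normci mulr1.
have -> : normc (2 : R[i]) = 2 :> R.
  by rewrite -(rmorph_nat (real_complex R)) normc_real ger0_norm.
by lra.
Qed.

End cauchy1.

Section cauchy_functional.
Context {R : realType}.
Implicit Types (h g : R[i] -> R[i]) (x y M N e r : R) (z w : R[i]) (k : nat).

(** The quotient (g z - g w) / (z - w) is bounded, and differentiable except at w.
    Hence its integral equals that over any small square around w, which tends
    to 0 with the size of the square. *)
Lemma cauchy_formula r g M w : normc w < r -> (forall z, cdifferentiable g z) ->
  rect_bounded g (- r) r (- r) r M ->
  square_int r (fun z => g z * (z - w)^-1) = g w * winding r.
Proof.
move=> wr gd gM; have r0 : 0 < r := le_lt_trans (normc_ge0 w) wr.
have rr : - r <= r by lra.
have gM0 : 0 <= M.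
  by apply: le_trans (normc_ge0 _) (gM r r _ _); rewrite rr lexx.
pose q z := (g z - g w) * (z - w)^-1.
have [D gD] := gd w; have [d d0 dP] := gD 1 ltr01.
(* The first two summands bound the quotient near w, the last one away from
   w. *)
pose B := normc D + 1 + (M + normc (g w)) / d.
have D0 := normc_ge0 D.
have B1 : normc D + 1 <= B by rewrite lerDl divr_ge0 ?addr_ge0 ?normc_ge0 ?(ltW d0).
have B2 : (M + normc (g w)) / d <= B by rewrite lerDr addr_ge0.
have qB : rect_bounded q (- r) r (- r) r B.
  move=> x y xi yi; set z := x +i* y.
  have [->|zw] := eqVneq z w.
    by rewrite /q !subrr mul0r normc0; apply: le_trans B1; rewrite addr_ge0.
  have n0 : 0 < normc (z - w) by rewrite normc_gt0 subr_eq0.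
  rewrite normcM normcV.
  have [zd|zd] := leP (normc (z - w)) d.
    apply: le_trans B1; rewrite ler_pdivrMr// mulrDl.
    rewrite -(subrK (D * (z - w)) (g z - g w)) addrC.
    apply: le_trans (le_normcD _ _) _; rewrite normcM lerD2l.
    exact: dP.
  apply: le_trans B2; apply: ler_pM; rewrite ?normc_ge0 ?invr_ge0 ?normc_ge0//.
    by apply: le_trans (le_normcB _ _) _; rewrite lerD2r gM.
  by rewrite lef_pV2 ?posrE// ltW.
have side_ne x y : - r <= x <= r -> - r <= y <= r ->
    [|| x == - r, x == r, y == - r | y == r] -> r - normc w <= normc (x +i* y - w).
  move=> xi yi s; have := side_ge xi yi s.
  by have := normcD_ge (x +i* y) (- w); rewrite normcN; lra.
have q0 : square_int r q = 0.
  apply: normc_le_eps => e e0.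
  have B0 : 0 < B by lra.
  (* a square that fits into the large one and has a small perimeter *)
  pose t := Num.min ((r - normc w) / 2) (e / (16 * B)).
  have t0 : 0 < t by rewrite lt_min !divr_gt0 ?mulr_gt0// subr_gt0.
  have t1 : t < r - normc w.
    have : t <= (r - normc w) / 2 by rewrite ge_min lexx.
    by lra.
  have t2 : t <= e / (16 * B) by rewrite ge_min lexx orbT.
  have := norm_Re w; have := norm_Im w; rewrite !ler_norml.
  move=> /andP[i1 i2] /andP[r1 r2].
  have := @rect_int_annulus _ q (- r) r (- r) r (Re w - t) (Re w + t)
    (Im w - t) (Im w + t) B.
  rewrite /square_int => ->; try lra; last first.
    move=> x y xi yi out; split; first exact: qB.
    have zw : x +i* y != w.
      by apply: contraNneq out => <- /=; rewrite !ltrBlDr !ltrDl !t0.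
    apply/cdifferentiableP;
      apply: (@derivableM _ _ (fun z => g z - g w) (fun z => (z - w)^-1)).
      by apply: derivableB; [apply/cdifferentiableP|exact: derivable_cst].
    by apply/cdifferentiableP; exact: cdifferentiable_inv.
  apply: le_trans (@rect_int_le _ _ _ _ _ _ B _ _ _) _; try lra.
    by move=> x y xi yi _; apply: qB; apply/andP; split; lra.
  move: t2; rewrite ler_pdivlMr ?mulr_gt0//; lra.
have vb : square_bounded r (fun z => g w * (z - w)^-1) (normc (g w) / (r - normc w)).
  move=> x y xi yi s; rewrite normcM ler_wpM2l ?normc_ge0// normcV.
  have h := side_ne x y xi yi s.
  by rewrite lef_pV2 ?posrE ?subr_gt0 ?(lt_le_trans _ h) ?subr_gt0.
have := rect_int_D rr rr (rect_sides_bounded qB) vb;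
  rewrite -/(square_int r _) -/(square_int r q) q0 add0r.
have vb1 : square_bounded r (fun z => (z - w)^-1) (r - normc w)^-1.
  move=> x y xi yi s; rewrite normcV.
  have h := side_ne x y xi yi s.
  by rewrite lef_pV2 ?posrE ?subr_gt0 ?(lt_le_trans _ h) ?subr_gt0.
rewrite (rect_int_Z _ rr rr vb1) -/(square_int r _) square_int_inv// => <-.
congr (square_int r _); apply/funext => z.
by rewrite /q -mulrDl subrK.
Qed.

(** For entire g, the k-th Taylor coefficient at 0. As a functional it is linear and
    bounded on all functions that are bounded on a disc, analytic or not; this
    lets it act on one variable after another, without any regularity of the
    intermediate functions. *)
Definition cauchy_coef r k g : R[i] :=
  (winding r)^-1 * square_int r (fun z => g z * z ^- k.+1).

Definition disc_bounded r g M := forall z, normc z <= 2 * r -> normc (g z) <= M.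

Lemma cauchy_coef_integrand_bounded r k g M : 0 < r -> disc_bounded r g M ->
  square_bounded r (fun z => g z * z ^- k.+1) (M / r ^+ k.+1).
Proof.
move=> r0 gM x y xi yi s; rewrite normcM normcV normcX.
have h := side_ge xi yi s.
apply: ler_pM; rewrite ?normc_ge0 ?invr_ge0 ?exprn_ge0 ?normc_ge0//.
  by apply: gM; exact: sq_le.
rewrite lef_pV2 ?posrE ?exprn_gt0 ?(lt_le_trans r0)//.
by rewrite ler_pXn2r// nnegrE ?normc_ge0 ?ltW.
Qed.

Lemma cauchy_coef_D r k g h M N : 0 < r -> disc_bounded r g M ->
  disc_bounded r h N ->
  cauchy_coef r k (fun z => g z + h z) = cauchy_coef r k g + cauchy_coef r k h.
Proof.
move=> r0 gM hN; have rr : - r <= r by lra.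
rewrite /cauchy_coef -mulrDr; congr (_ * _).
rewrite /square_int -(rect_int_D rr rr (cauchy_coef_integrand_bounded k r0 gM)
  (cauchy_coef_integrand_bounded k r0 hN)).
by apply: rect_int_ext => // x y _ _ _; exact: mulrDl.
Qed.

Lemma cauchy_coef_Z r k w g M : 0 < r -> disc_bounded r g M ->
  cauchy_coef r k (fun z => w * g z) = w * cauchy_coef r k g.
Proof.
move=> r0 gM; have rr : - r <= r by lra.
rewrite /cauchy_coef mulrCA; congr (_ * _).
rewrite /square_int -(rect_int_Z _ rr rr (cauchy_coef_integrand_bounded k r0 gM)).
by apply: rect_int_ext => // x y _ _ _; rewrite mulrA.
Qed.

Lemma winding_neq0 r : 0 < r -> winding r != 0 :> R[i].
Proof. by move=> r0; rewrite -normc_gt0; apply: lt_le_trans (winding_ge r0). Qed.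

Lemma cauchy_coef_le r k g M : 0 < r -> disc_bounded r g M ->
  normc (cauchy_coef r k g) <= 8 * M / r ^+ k.
Proof.
move=> r0 gM; rewrite normcM normcV.
have P2 := winding_ge r0; have P0 : 0 < normc (winding r) by apply: lt_le_trans P2.
have M0 : 0 <= M.
  by apply: le_trans (normc_ge0 _) (gM 0 _); rewrite normc0 mulr_ge0 ?ltW.
rewrite mulrC ler_pdivrMr//.
apply: le_trans (le_square_int (ltW r0) (cauchy_coef_integrand_bounded k r0 gM)) _.
have -> : 16 * (M / r ^+ k.+1) * r = 8 * M / r ^+ k * 2.
  by rewrite exprS; field; rewrite expf_neq0 gt_eqF.
by rewrite ler_wpM2l// divr_ge0 ?exprn_ge0 ?mulr_ge0// ltW.
Qed.

(** In Cauchy's formula, 1 / (z - w) is a partial sum of the geometric series in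
    w / z plus the remainder (w / z) ^ n / (z - w), and |w / z| <= 1/4 on the
    square. *)
Lemma cauchy_coef_taylor r g M w n : 0 < r ->
  (forall z, cdifferentiable g z) -> disc_bounded r g M ->
  normc w <= r / 4 ->
  normc (g w - \sum_(k < n) cauchy_coef r k g * w ^+ k) <= 16 * M / 4 ^+ n.
Proof.
move=> r0 gd gM wr; have rr : - r <= r by lra.
have wr' : normc w < r by lra.
have M0 : 0 <= M.
  by apply: le_trans (normc_ge0 _) (gM 0 _); rewrite normc0 mulr_ge0 ?ltW.
have P0 := winding_neq0 r0.
have side_ne x y : - r <= x <= r -> - r <= y <= r ->
    [|| x == - r, x == r, y == - r | y == r] -> 3 / 4 * r <= normc (x +i* y - w).
  move=> xi yi s; have := side_ge xi yi s.
  by have := normcD_ge (x +i* y) (- w); rewrite normcN; lra.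
pose rem m z := g z * ((w / z) ^+ m * (z - w)^-1).
have rb m : square_bounded r (rem m) (M * (4 ^- m * (3 / 4 * r)^-1)).
  move=> x y xi yi s; have h := side_ge xi yi s; have h' := side_ne x y xi yi s.
  have z0 : 0 < normc (x +i* y) by apply: lt_le_trans h.
  rewrite normcM; apply: ler_pM; rewrite ?normc_ge0//; first by apply: gM; exact: sq_le.
  rewrite normcM normcX normcM !normcV; apply: ler_pM.
  - by rewrite exprn_ge0// divr_ge0 ?normc_ge0.
  - by rewrite invr_ge0 normc_ge0.
  - rewrite -exprVn; apply: lerXn2r; rewrite ?nnegrE ?divr_ge0 ?normc_ge0 ?invr_ge0//.
    by rewrite ler_pdivrMr//; lra.
  - by rewrite lef_pV2 ?posrE//; lra.
have key m : g w * winding r = \sum_(k < m) w ^+ k * square_int r (fun z => g z * z ^- k.+1)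
    + square_int r (rem m).
  elim: m => [|m ih].
    rewrite big_ord0 add0r -(@cauchy_formula _ _ M)//.
      by congr (square_int r _); apply/funext => z; rewrite /rem expr0 mul1r.
    by move=> x y xi yi; apply: gM; exact: sq_le.
  rewrite ih big_ord_recr/= -addrA; congr (_ + _).
  rewrite /square_int -(rect_int_Z _ rr rr (cauchy_coef_integrand_bounded m r0 gM)).
  have wpow_b : square_bounded r (fun z => w ^+ m * (g z * z ^- m.+1)) (normc (w ^+ m) *
    (M / r ^+ m.+1)).
    move=> x y xi yi s; rewrite normcM ler_wpM2l ?normc_ge0//.
    exact: (cauchy_coef_integrand_bounded m r0 gM).
  rewrite -(rect_int_D rr rr wpow_b (rb m.+1)); apply: rect_int_ext => // x y xi yi s.
  have h := side_ge xi yi s; have h' := side_ne x y xi yi s.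
  have z0 : x +i* y != 0 by rewrite -normc_gt0; apply: lt_le_trans h.
  have zw : x +i* y - w != 0 by rewrite -normc_gt0; lra.
  rewrite /rem; set z := x +i* y in z0 zw *.
  rewrite !expr_div_n !exprS; field.
  by rewrite z0 zw expf_neq0.
have -> : g w - \sum_(k < n) cauchy_coef r k g * w ^+ k =
  (winding r)^-1 * square_int r (rem n).
  have -> : \sum_(k < n) cauchy_coef r k g * w ^+ k =
      (winding r)^-1 * \sum_(k < n) w ^+ k * square_int r (fun z => g z * z ^- k.+1).
    by rewrite big_distrr/=; apply: eq_bigr => k _; rewrite /cauchy_coef; ring.
  have := key n; set S := \sum_(k < n) _ => E.
  have -> : g w = (winding r)^-1 * (g w * winding r) by field.
  by rewrite E; ring.
rewrite normcM normcV mulrC.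
have P2 := winding_ge r0; have P3 : 0 < normc (winding r) by apply: lt_le_trans P2.
rewrite ler_pdivrMr//; apply: le_trans (le_square_int (ltW r0) (rb n)) _.
have -> : 16 * (M * (4 ^- n * (3 / 4 * r)^-1)) * r = 16 * M / 4 ^+ n * (4 / 3).
  by field; rewrite ?expf_neq0 ?gt_eqF.
by rewrite ler_wpM2l ?divr_ge0 ?mulr_ge0 ?exprn_ge0//; lra.
Qed.

End cauchy_functional.

(** * Unordered sums over multi-indices *)

Section finite_sums.
Context {R : realType} {n : nat}.
Implicit Types (al be : mindex n) (A B : {fset mindex n}) (N : nat).

Definition ord_mindex N (a : {ffun 'I_n -> 'I_N}) : mindex n :=
  [ffun i => a i : nat].

Lemma ord_mindex_inj N : injective (@ord_mindex N).
Proof.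
move=> a b /ffunP ab; apply/ffunP => i; apply: val_inj.
by have := ab i; rewrite !ffunE.
Qed.

Definition box N : {fset mindex n} :=
  [fset ord_mindex a | a in [set: {ffun 'I_n -> 'I_N}]%SET]%fset.

Lemma in_box N al : (al \in box N) = [forall i, al i < N]%N.
Proof.
apply/imfsetP/forallP => [[a _ ->] i|aN]; first by rewrite ffunE.
exists [ffun i => Ordinal (aN i)]; first by rewrite inE.
by apply/ffunP => i; rewrite !ffunE.
Qed.

Lemma sum_box (V : zmodType) N (F : mindex n -> V) :
  \sum_(al <- box N) F al = \sum_(a : {ffun 'I_n -> 'I_N}) F (ord_mindex a).
Proof.
rewrite big_imfset/=; last by move=> a b _ _; exact: ord_mindex_inj.
by rewrite big_enum/=; apply: eq_bigl => a; rewrite inE.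
Qed.

Lemma sub_box A : exists N, forall M, (N <= M)%N -> (A `<=` box M)%fset.
Proof.
exists (\max_(al <- A) \max_(i < n) al i).+1 => M NM.
apply/fsubsetP => al alA; rewrite in_box; apply/forallP => i.
apply: leq_trans NM; rewrite ltnS.
apply: (@leq_trans (\max_(i < n) al i)); first exact: leq_bigmax.
by apply: (@leq_bigmax_seq _ _ _ (fun al : mindex n => \max_(i < n) al i)).
Qed.

Lemma sub_box_le N M : (N <= M)%N -> (box N `<=` box M)%fset.
Proof.
move=> NM; apply/fsubsetP => al; rewrite !in_box => /forallP aN.
by apply/forallP => i; apply: leq_trans (aN i) NM.
Qed.

Lemma le_mdeg al i : (al i <= mdeg al)%N.
Proof. by rewrite /mdeg (bigD1 i)//= leq_addr. Qed.

Lemma notin_box N al : al \notin box N -> (N <= mdeg al)%N.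
Proof.
rewrite in_box negb_forall => /existsP[j]; rewrite -leqNgt => Nj.
exact: leq_trans Nj (le_mdeg _ _).
Qed.

Lemma sum_fsetD (V : zmodType) A B (F : mindex n -> V) : (A `<=` B)%fset ->
  \sum_(al <- B) F al = \sum_(al <- A) F al + \sum_(al <- (B `\` A)%fset) F al.
Proof.
move=> AB; rewrite (big_fsetID _ (mem A))/=; congr (_ + _); apply: eq_fbigl => al.
  rewrite !inE/=; apply/andP/idP => [[]//|aA]; split=> //; exact: (fsubsetP AB).
by rewrite !inE/= andbC.
Qed.

(** The sum over a box is a product of n sums over its edges. *)
Lemma sum_pow_box N (q : R) :
  \sum_(al <- box N) q ^+ mdeg al = (\sum_(k < N) q ^+ k) ^+ n.
Proof.
rewrite sum_box -[X in _ ^+ X]card_ord -prodr_const.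
rewrite (bigA_distr_bigA (fun (i : 'I_n) (k : 'I_N) => q ^+ k)).
apply: eq_bigr => a _; rewrite /mdeg expr_sum.
by apply: eq_bigr => i _; rewrite ffunE.
Qed.

Lemma geom_half N : \sum_(k < N) (2^-1 : R) ^+ k <= 2.
Proof.
suff -> : \sum_(k < N) (2^-1 : R) ^+ k = 2 - 2 * 2^-1 ^+ N.
  by rewrite gerBl mulr_ge0// exprn_ge0.
elim: N => [|N ih]; first by rewrite big_ord0 expr0; ring.
by rewrite big_ord_recr/= ih exprS; field.
Qed.

Lemma sum_half A : \sum_(al <- A) (2^-1 : R) ^+ mdeg al <= 2 ^+ n.
Proof.
have [N /(_ N (leqnn N)) AN] := sub_box A.
apply: (@le_trans _ _ (\sum_(al <- box N) (2^-1 : R) ^+ mdeg al)).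
  by rewrite (sum_fsetD _ AN) lerDl sumr_ge0// => al _; rewrite exprn_ge0.
rewrite sum_pow_box lerXn2r ?nnegrE ?geom_half//.
by rewrite sumr_ge0// => k _; rewrite exprn_ge0.
Qed.

(** One factor 2^-|al| of 4^-|al| is at most 2^-N outside the box, the other one is
    summable. *)
Lemma sum_quarter_out N A : (forall al, al \in A -> al \notin box N) ->
  \sum_(al <- A) (4^-1 : R) ^+ mdeg al <= 2 ^+ n * 2^-1 ^+ N.
Proof.
move=> AN; apply: (@le_trans _ _ (\sum_(al <- A) 2^-1 ^+ N * 2^-1 ^+ mdeg al)).
  rewrite big_seq [leRHS]big_seq; apply: ler_sum => al alA.
  have -> : 4^-1 = 2^-1 * 2^-1 :> R by field.
  rewrite exprMn ler_wpM2r ?exprn_ge0//.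
  by rewrite ler_wiXn2l ?invr_ge0 ?invf_le1 ?ler1n// notin_box// AN.
by rewrite -big_distrr/= mulrC ler_wpM2r ?exprn_ge0// sum_half.
Qed.

End finite_sums.
Arguments box : clear implicits.

Section unordered_sums.
Context {R : realType} {n : nat}.
Implicit Types (al be : mindex n) (A B : {fset mindex n}) (N : nat).
Implicit Types (t u : mindex n -> R[i]) (l m : R[i]) (K M e : R).

Definition fsum t A := \sum_(al <- A) t al.

Definition has_usum t l := forall e, 0 < e ->
  exists A, forall B, (A `<=` B)%fset -> normc (fsum t B - l) <= e.

Definition usum t : R[i] := summability.sum t.

Lemma has_usumE t l : has_usum t l -> usum t = l.
Proof.
move=> tl.
have FF : ProperFilter (@summability.totally (mindex n)) by exact: summability.totally_filter.
apply: cvg_lim => //.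
apply/cvgrPdist_le => _ /posC_real[e e0 ->].
have [A AP] := tl e e0.
exists A => // B /= AB; rewrite /summability.partial_sum.
have -> : \sum_(i : B) t (val i) = fsum t B by rewrite /fsum big_seq_fsetE.
by rewrite normC_normc lecR normcB; exact: AP.
Qed.

Lemma has_usum_D t u l m : has_usum t l -> has_usum u m ->
  has_usum (fun al => t al + u al) (l + m).
Proof.
move=> tl um e e0; have e20 : 0 < e / 2 by rewrite divr_gt0.
have [A AP] := tl _ e20; have [B BP] := um _ e20.
exists (A `|` B)%fset => C ABC.
have /andP[AC BC] : (A `<=` C)%fset && (B `<=` C)%fset by rewrite -fsubUset.
rewrite /fsum big_split/=.
have -> : \sum_(i <- C) t i + \sum_(i <- C) u i - (l + m) =
  (fsum t C - l) + (fsum u C - m) by rewrite /fsum; ring.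
apply: le_trans (le_normcD _ _) _.
by have := AP _ AC; have := BP _ BC; lra.
Qed.

Lemma has_usum_Z c t l : has_usum t l -> has_usum (fun al => c * t al) (c * l).
Proof.
move=> tl e e0; have d0 : 0 < e / (normc c + 1).
  by rewrite divr_gt0// ltr_wpDl// normc_ge0.
have [A AP] := tl _ d0; exists A => B AB.
rewrite /fsum -big_distrr/= -mulrBr normcM.
have := AP B AB; rewrite ler_pdivlMr ?ltr_wpDl ?normc_ge0// => h.
apply: le_trans h; rewrite mulrC ler_wpM2l ?normc_ge0// lerDl//.
Qed.

Lemma has_usum_fin t A : (forall al, al \notin A -> t al = 0) ->
  has_usum t (fsum t A).
Proof.
move=> tA e e0; exists A => B AB; rewrite /fsum (sum_fsetD _ AB) addrAC subrr add0r.
rewrite big_seq_cond big1 ?normc0 ?ltW// => al; rewrite !inE andbT => /andP[alA _].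
exact: tA.
Qed.

(** All infinite sums below are dominated by 4^-|al|. This is summable with bound
    2 ^ n, and it leaves a factor 2^-N for the tail outside a box. *)
Definition geom_bounded K t := forall al, normc (t al) <= K * 4^-1 ^+ mdeg al.

Lemma geom_bounded_ge0 K t : geom_bounded K t -> 0 <= K.
Proof.
move=> /(_ [ffun=> 0%N]); rewrite /mdeg big1 => [|i _]; last by rewrite ffunE.
by rewrite expr0 mulr1; apply: le_trans; exact: normc_ge0.
Qed.

Lemma quarter_le_half k : (4^-1 : R) ^+ k <= 2^-1 ^+ k.
Proof.
by apply: lerXn2r; rewrite ?nnegrE ?invr_ge0// lef_pV2 ?posrE// ler_nat.
Qed.

Lemma fsum_le K t A : geom_bounded K t -> normc (fsum t A) <= K * 2 ^+ n.
Proof.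
move=> tK; apply: le_trans (le_normc_sum _ _ _) _.
apply: (@le_trans _ _ (\sum_(al <- A) K * 2^-1 ^+ mdeg al)).
  apply: ler_sum => al _; apply: le_trans (tK al) _.
  by rewrite ler_wpM2l ?(geom_bounded_ge0 tK)// quarter_le_half.
by rewrite -big_distrr/= ler_wpM2l ?(geom_bounded_ge0 tK)// sum_half.
Qed.

Lemma fsum_tail K t A N : geom_bounded K t -> (box n N `<=` A)%fset ->
  normc (fsum t A - fsum t (box n N)) <= K * 2 ^+ n * 2^-1 ^+ N.
Proof.
move=> tK NA; rewrite /fsum (sum_fsetD _ NA) addrAC subrr add0r.
apply: le_trans (le_normc_sum _ _ _) _.
apply: (@le_trans _ _ (\sum_(al <- (A `\` box n N)%fset) K * 4^-1 ^+ mdeg al)).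
  by apply: ler_sum => al _; exact: tK.
rewrite -big_distrr/= -mulrA ler_wpM2l ?(geom_bounded_ge0 tK)//.
by apply: sum_quarter_out => al; rewrite !inE => /andP[].
Qed.

Lemma half_small M e : 0 < e -> exists N, M * 2^-1 ^+ N <= e.
Proof.
move=> e0; near \oo => N; exists N.
have [M0|M0] := leP M 0.
  by apply: (@le_trans _ _ 0); rewrite ?(ltW e0)// mulr_le0_ge0// exprn_ge0.
have eN : M / e <= N%:R by near: N; exact: nbhs_infty_ger.
rewrite exprVn ler_pdivrMr ?exprn_gt0// mulrC -ler_pdivrMr//.
apply: le_trans eN _; rewrite -natrX ler_nat; exact/ltnW/ltn_expl.
Unshelve. all: by end_near. Qed.

(** The sums over boxes are bounded, so culim provides a candidate for the value;
    the uniform tail estimate shows that it is the unordered sum. *)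
Lemma geom_bounded_usum_tail K t A N : geom_bounded K t ->
  (box n N `<=` A)%fset ->
  normc (fsum t A - usum t) <= 4 * K * 2 ^+ n * 2^-1 ^+ N.
Proof.
move=> tK NA; have K0 := geom_bounded_ge0 tK.
pose l := culim (fun N => fsum t (box n N)).
have lP B (M : nat) : (box n M `<=` B)%fset ->
    normc (fsum t B - l) <= 4 * K * 2 ^+ n * 2^-1 ^+ M.
  move=> MB.
  pose w N' := fsum t B - fsum t (box n N').
  have wE : fsum t B - l = culim w.
    rewrite /w (@culimD _ (fun=> fsum t B) (fun N' => - fsum t (box n N')) (K * 2 ^+ n)
      (K * 2 ^+ n)).
    - rewrite culim_cst; congr (_ + _); rewrite -mulN1r /l.
      rewrite -(@culimZ _ _ _ (K * 2 ^+ n)); last by move=> k; exact: fsum_le.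
      by congr culim; apply/funext => k; rewrite mulN1r.
    - by move=> k; exact: fsum_le.
    - by move=> k; rewrite normcN; exact: fsum_le.
  have -> : 4 * K * 2 ^+ n * 2^-1 ^+ M = 2 * (2 * (K * 2 ^+ n * 2^-1 ^+ M)) by ring.
  rewrite wE; apply: (@culim_le _ _ (2 * (K * 2 ^+ n))).
    move=> k; rewrite mulr_natl mulr2n; apply: le_trans (le_normcB _ _) _.
    by apply: lerD; exact: fsum_le.
  exists M => // k /= Mk.
  rewrite mulr_natl mulr2n; apply: le_trans (le_normcBD (fsum t (box n M)) _ _) _.
  apply: lerD; first exact: fsum_tail.
  by rewrite normcB; apply: fsum_tail => //; exact: sub_box_le.
have tl : has_usum t l.
  move=> e /(half_small (4 * K * 2 ^+ n))[M Me]; exists (box n M) => B MB.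
  exact: le_trans (lP _ _ MB) Me.
by rewrite (has_usumE tl); exact: lP.
Qed.

Lemma geom_bounded_has_usum K t : geom_bounded K t -> has_usum t (usum t).
Proof.
move=> tK e /(half_small (4 * K * 2 ^+ n))[M Me]; exists (box n M) => B MB.
exact: le_trans (geom_bounded_usum_tail tK MB) Me.
Qed.

Lemma usum_le K t : geom_bounded K t -> normc (usum t) <= K * 2 ^+ n.
Proof.
move=> tK; apply/ler_addgt0Pr => e e0.
have [A AP] := geom_bounded_has_usum tK e0; have := AP A (fsubset_refl _).
have := normcD_ge (usum t) (fsum t A - usum t); rewrite [usum t + _]addrC subrK.
by have := fsum_le A tK; lra.
Qed.

Lemma usum_ext t u : (forall al, t al = u al) -> usum t = usum u.
Proof. by move=> tu; congr usum; apply/funext. Qed.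

Lemma geom_bounded_Z K c t : geom_bounded K t ->
  geom_bounded (normc c * K) (fun al => c * t al).
Proof. by move=> tK al; rewrite normcM -mulrA ler_wpM2l ?normc_ge0. Qed.

Lemma usum_D K M t u : geom_bounded K t -> geom_bounded M u ->
  usum (fun al => t al + u al) = usum t + usum u.
Proof. by move=> tK uM; apply/has_usumE/has_usum_D; apply: geom_bounded_has_usum;
  eassumption. Qed.

Lemma usum_Z K c t : geom_bounded K t -> usum (fun al => c * t al) = c * usum t.
Proof. by move=> tK; apply/has_usumE/has_usum_Z; apply: geom_bounded_has_usum;
  eassumption. Qed.

Lemma usum_box K t l M : geom_bounded K t ->
  (forall N, normc (fsum t (box n N) - l) <= M * 2^-1 ^+ N) -> usum t = l.
Proof.
move=> tK tl; apply/eqP; rewrite -subr_eq0; apply/eqP.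
apply: normc_le_eps => e /(half_small (4 * K * 2 ^+ n + M))[N Ne].
apply: le_trans Ne; rewrite mulrDl.
apply: le_trans (le_normcBD (fsum t (box n N)) _ _) _; apply: lerD => //.
by rewrite normcB; apply: geom_bounded_usum_tail.
Qed.

Lemma geom_bounded_summable K t : geom_bounded K t ->
  esum.summable [set: mindex n] (fun al => (normc (t al))%:E).
Proof.
move=> tK; rewrite /esum.summable.
apply: (@le_lt_trans _ _ (K * 2 ^+ n)%:E); last by rewrite ltry.
apply: ge_ereal_sup => _ [X [Xf _] <-].
rewrite fsbig_finite//= sumEFin lee_fin.
apply: (@le_trans _ _ (\sum_(al <- fset_set X) K * 2^-1 ^+ mdeg al)).
  apply: ler_sum => al _; rewrite ger0_norm ?normc_ge0//.
  apply: le_trans (tK al) _.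
  by rewrite ler_wpM2l ?(geom_bounded_ge0 tK)// quarter_le_half.
by rewrite -big_distrr/= ler_wpM2l ?(geom_bounded_ge0 tK)// sum_half.
Qed.

End unordered_sums.

(** * Taylor expansion in several variables *)

Section coordinates.
Context {R : realType} {n : nat}.
Implicit Types (al be : mindex n) (i j : 'I_n) (s : seq 'I_n) (N k : nat).
Implicit Types (z w : 'rV[R[i]]_n) (t : R[i]) (r M E : R).
Implicit Types (f g : 'rV[R[i]]_n -> R[i]).

Definition set_coord z i t : 'rV[R[i]]_n :=
  \row_j (if j == i then t else z 0 j).

Definition set_entry al i k : mindex n :=
  [ffun j => if j == i then k else al j].

Definition polydisc r z := forall i, normc (z 0 i) <= r.

Lemma polydisc_set_coord r z i t : polydisc r z -> normc t <= r ->
  polydisc r (set_coord z i t).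
Proof. by move=> zr tr j; rewrite mxE; case: eqP. Qed.

Lemma set_coord_id z i : set_coord z i (z 0 i) = z.
Proof. by apply/rowP => j; rewrite mxE; case: eqP => [->|]. Qed.

Definition polydisc_bounded r f M :=
  forall z, polydisc (2 * r) z -> normc (f z) <= M.

Definition zpow z al : R[i] := \prod_i z 0 i ^+ al i.

(** cauchy_coef applied in the variables of s, one after the other, the remaining
    variables being kept at their values in z. *)
Fixpoint iter_coef r s al f z : R[i] := if s is i :: s'
  then cauchy_coef r (al i) (fun t => iter_coef r s' al f (set_coord z i t)) else f z.

Lemma iter_coef_le r s al f z M : 0 < r -> polydisc_bounded r f M ->
  polydisc (2 * r) z ->
  normc (iter_coef r s al f z) <= 8 ^+ size s * M * r^-1 ^+ (\sum_(i <- s) al i).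
Proof.
move=> r0 fM; elim: s z => [|i s ih] z zr /=.
  by rewrite big_nil !expr0 mulr1 mul1r fM.
apply: le_trans (cauchy_coef_le (al i) r0 (M :=
  8 ^+ size s * M * r^-1 ^+ (\sum_(i <- s) al i)) _) _.
  by move=> t tr; apply: ih; exact: polydisc_set_coord.
by rewrite big_cons exprD -exprVn [8 ^+ _.+1]exprS le_eqVlt; apply/orP; left; apply/eqP;
  ring.
Qed.

Lemma iter_coef_disc_bounded r s al f z i M : 0 < r ->
  polydisc_bounded r f M -> polydisc (2 * r) z ->
  disc_bounded r (fun t => iter_coef r s al f (set_coord z i t)) (8 ^+ size s * M *
    r^-1 ^+ (\sum_(i <- s) al i)).
Proof. by move=> r0 fM zr t tr; apply: iter_coef_le => //; exact: polydisc_set_coord. Qed.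

Lemma iter_coef_indep r s al f z w : (forall j, j \notin s -> z 0 j = w 0 j) ->
  iter_coef r s al f z = iter_coef r s al f w.
Proof.
elim: s z w => [|i s ih] z w zw /=.
  by congr f; apply/rowP => j; exact: zw.
congr cauchy_coef; apply/funext => t; apply: ih => j js; rewrite !mxE.
by case: eqP => // /eqP ji; apply: zw; rewrite inE negb_or ji.
Qed.

(** The exponents of the Taylor polynomials in the variables of s: equal to al
    outside s, below N in s. *)
Fixpoint box_seq s N al : seq (mindex n) := if s is i :: s'
  then [seq be | k <- iota 0 N, be <- box_seq s' N (set_entry al i k)] else [:: al].

Lemma mem_box_seq s N al be : uniq s -> (be \in box_seq s N al) =
  [forall j, if j \in s then (be j < N)%N else be j == al j].
Proof.
elim: s al be => [|i s ih] al be /=.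
  move=> _; rewrite inE; apply/eqP/forallP => [-> j//|h].
  by apply/ffunP => j; exact/eqP/(h j).
move=> /andP[iNs us]; apply/allpairsPdep/forallP => [[k [be' []]]|h].
  rewrite mem_iota/= ih// => kN /forallP h -> j; have := h j.
  rewrite inE ffunE; case: (eqVneq j i) => [->|ji]/=; last by [].
  by rewrite (negbTE iNs) => /eqP ->.
have := h i; rewrite mem_head => beiN.
exists (be i), be; split=> //; first by rewrite mem_iota.
rewrite ih//; apply/forallP => j; have := h j; rewrite inE ffunE.
by case: (eqVneq j i) => [->|]//=; rewrite (negbTE iNs).
Qed.

Lemma box_seq_uniq s N al : uniq s -> uniq (box_seq s N al).
Proof.
elim: s al => [//|i s ih] al /= /andP[iNs us].
apply: allpairs_uniq_dep => [|k _|]; first exact: iota_uniq.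
  exact: ih.
move=> u v /allpairsPdep[k [be [_ kbe ->]]] /allpairsPdep[k' [be' [_ kbe' ->]]] /= bb.
have ki m b : b \in box_seq s N (set_entry al i m) -> b i = m.
  by rewrite mem_box_seq// => /forallP/(_ i); rewrite (negbTE iNs) ffunE eqxx => /eqP.
by rewrite -bb in kbe' *; rewrite -(ki _ _ kbe) -(ki _ _ kbe').
Qed.

Lemma box_seq_box (V : zmodType) N (F : mindex n -> V) :
  \sum_(al <- box_seq (enum 'I_n) N [ffun=> 0%N]) F al = \sum_(al <- box n N) F al.
Proof.
apply: perm_big; apply: uniq_perm; first exact/box_seq_uniq/enum_uniq.
  exact: fset_uniq.
move=> be; rewrite mem_box_seq ?enum_uniq// in_box.
by apply: eq_forallb => j; rewrite mem_enum.
Qed.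

Lemma cauchy_coef_sum r k (I : eqType) (q : seq I) (F : I -> R[i] -> R[i]) (B : I -> R) : 0 < r ->
  (forall x, disc_bounded r (F x) (B x)) ->
  cauchy_coef r k (fun t => \sum_(x <- q) F x t) = \sum_(x <- q) cauchy_coef r k (F x).
Proof.
move=> r0 FB.
have sB p : disc_bounded r (fun t => \sum_(x <- p) F x t) (\sum_(x <- p) B x).
  move=> t tr; apply: le_trans (le_normc_sum _ _ _) _.
  by apply: ler_sum => x _; exact: FB.
elim: q => [|x q ih].
  rewrite big_nil.
  have -> : (fun t => \sum_(x <- [::]) F x t) = (fun t => 0 * (0 : R[i])).
    by apply/funext => t; rewrite big_nil mul0r.
  by rewrite (@cauchy_coef_Z _ _ _ 0 (fun=> 0) 0)// ?mul0r// => t _; rewrite normc0.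
rewrite big_cons -ih -(cauchy_coef_D k r0 (FB x) (sB q)).
by congr cauchy_coef; apply/funext => t; rewrite big_cons.
Qed.

(** Induction on the list of variables. In the one-variable expansion with respect
    to the first variable, replacing f by its Taylor polynomial in the remaining
    ones changes the k-th coefficient by at most a constant times r^-k times the
    error of that polynomial, because cauchy_coef is linear and bounded; the
    factors |z_i| ^ k <= (r/4) ^ k make these changes summable. *)
Lemma taylor_partial s : uniq s -> exists2 E, 0 <= E &
  forall r f M N z al, 0 < r ->
    (forall z i t, cdifferentiable (fun t => f (set_coord z i t)) t) ->
    polydisc_bounded r f M -> polydisc (2 * r) z -> (forall i, i \in s ->
      normc (z 0 i) <= r / 4) ->
    normc (f z - \sum_(be <- box_seq s N al) iter_coef r s be f z *
      \prod_(i <- s) z 0 i ^+ be i)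
      <= E * M * 4^-1 ^+ N.
Proof.
elim: s => [_|i s ih /= /andP[iNs us]].
  exists 0 => // r f M N z al r0 fd fM zr _.
  by rewrite big_seq1/= big_nil mulr1 subrr normc0 !mul0r.
have [E E0 EP] := ih us.
exists (16 + 16 * E); first by rewrite addr_ge0 ?mulr_ge0.
move=> r f M N z al r0 fd fM zr zs.
have M0 : 0 <= M by apply: le_trans (normc_ge0 _) (fM z zr).
have zir : normc (z 0 i) <= r / 4 by apply: zs; rewrite mem_head.
pose S k t := \sum_(be <- box_seq s N (set_entry al i k))
  iter_coef r s be f (set_coord z i t) * \prod_(j <- s) z 0 j ^+ be j.
have updj t j : j \in s -> set_coord z i t 0 j = z 0 j.
  by move=> js; rewrite mxE; case: eqP => // ji; rewrite -ji js in iNs.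
have SE k t : normc t <= 2 * r -> normc (f (set_coord z i t) - S k t) <= E * M * 4^-1 ^+ N.
  move=> tr; have := EP r f M N (set_coord z i t) (set_entry al i k) r0 fd fM.
  move=> /(_ (polydisc_set_coord i zr tr))/=.
  have -> : S k t = \sum_(be <- box_seq s N (set_entry al i k))
      iter_coef r s be f (set_coord z i t) * \prod_(i0 <- s) set_coord z i t 0 i0 ^+ be i0.
    apply: eq_bigr => be _; congr (_ * _).
    by rewrite !big_seq; apply: eq_bigr => j js; rewrite updj.
  by apply=> j js; rewrite updj//; apply: zs; rewrite inE js orbT.
have sumE : \sum_(be <- box_seq (i :: s) N al) iter_coef r (i :: s) be f z *
    \prod_(j <- i :: s) z 0 j ^+ be j = \sum_(k < N) cauchy_coef r k (S k) * z 0 i ^+ k.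
  rewrite /= big_allpairs_dep/= -[X in iota 0 X]subn0 -/(index_iota 0 N) big_mkord.
  apply: eq_bigr => k _.
  rewrite (@cauchy_coef_sum _ _ _ _ (fun be t => iter_coef r s be f (set_coord z i t) *
    \prod_(j <- s) z 0 j ^+ be j)
    (fun be => normc (\prod_(j <- s) z 0 j ^+ be j) *
      (8 ^+ size s * M * r^-1 ^+ (\sum_(i <- s) be i))))//; last first.
    move=> be t tr; rewrite normcM mulrC ler_wpM2l ?normc_ge0//.
    by apply: iter_coef_le => //; exact: polydisc_set_coord.
  rewrite big_distrl/= big_seq [RHS]big_seq; apply: eq_bigr => be.
  rewrite mem_box_seq// => /forallP/(_ i); rewrite (negbTE iNs) ffunE eqxx => /eqP bek.
  rewrite big_cons bek.
  have -> : cauchy_coef r k (fun t => iter_coef r s be f (set_coord z i t) *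
    \prod_(j <- s) z 0 j ^+ be j) =
     \prod_(j <- s) z 0 j ^+ be j *
       cauchy_coef r k (fun t => iter_coef r s be f (set_coord z i t)).
    rewrite -(cauchy_coef_Z k _ r0 (iter_coef_disc_bounded s be i r0 fM zr)).
    by congr cauchy_coef; apply/funext => t; rewrite mulrC.
  by ring.
rewrite sumE.
have fb : disc_bounded r (fun t => f (set_coord z i t)) M.
  by move=> t tr; apply: fM; exact: polydisc_set_coord.
have T := cauchy_coef_taylor N r0 (fd z i) fb zir; rewrite set_coord_id in T.
apply: le_trans (le_normcBD (\sum_(k < N) cauchy_coef r k (fun t =>
  f (set_coord z i t)) * z 0 i ^+ k) _ _) _.
have -> : (16 + 16 * E) * M * 4^-1 ^+ N = 16 * M / 4 ^+ N + 16 * (E * M * 4^-1 ^+ N).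
  by rewrite exprVn; ring.
apply: lerD => //; rewrite -sumrB.
apply: le_trans (le_normc_sum _ _ _) _.
set Z := E * M * 4^-1 ^+ N.
have Z0 : 0 <= Z by rewrite !mulr_ge0// exprn_ge0.
apply: (@le_trans _ _ (\sum_(k < N) 8 * Z * 2^-1 ^+ k)); last first.
  have -> : 16 * Z = 8 * Z * 2 by ring.
  by rewrite -big_distrr/= ler_wpM2l ?mulr_ge0// geom_half.
apply: ler_sum => k _; rewrite -mulrBl normcM normcX.
have db : disc_bounded r (fun t => f (set_coord z i t) - S k t) Z by move=> t; exact: SE.
have Sb : disc_bounded r (S k) (M + Z).
  move=> t tr; have := normcD_ge (S k t) (f (set_coord z i t) - S k t).
  rewrite [S k t + _]addrC subrK => h; have := fb t tr; have := SE k t tr.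
  by rewrite -/Z; lra.
have <- : cauchy_coef r k (fun t => f (set_coord z i t) - S k t) =
  cauchy_coef r k (fun t => f (set_coord z i t)) - cauchy_coef r k (S k).
  apply/eqP; rewrite eq_sym subr_eq; apply/eqP.
  rewrite -(cauchy_coef_D k r0 db Sb); congr cauchy_coef; apply/funext => t.
  by rewrite subrK.
apply: (@le_trans _ _ ((8 * Z / r ^+ k) * (r / 4) ^+ k)).
  apply: ler_pM; rewrite ?normc_ge0 ?exprn_ge0 ?normc_ge0//; first exact: cauchy_coef_le.
  by apply: lerXn2r; rewrite ?nnegrE ?normc_ge0 ?divr_ge0 ?(ltW r0).
have -> : (8 * Z / r ^+ k) * (r / 4) ^+ k = 8 * Z * 4^-1 ^+ k.
  by rewrite expr_div_n exprVn; field; rewrite !expf_neq0// gt_eqF.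
by rewrite ler_wpM2l ?mulr_ge0// quarter_le_half.
Qed.

(** The radius r/4 makes the terms dominated by 4^-|al|. *)
Definition power_series r K f (c : mindex n -> R[i]) :=
  (forall al, normc (c al) <= K * r^-1 ^+ mdeg al) /\
  forall z, polydisc (r / 4) z -> f z = usum (fun al => c al * zpow z al).

Lemma zpow_le r z al : polydisc r z -> normc (zpow z al) <= r ^+ mdeg al.
Proof.
move=> zr; rewrite /zpow normc_prod /mdeg expr_sum.
apply: ler_prod => i _; rewrite normc_ge0 normcX.
by apply: lerXn2r; rewrite ?nnegrE ?normc_ge0// (le_trans (normc_ge0 _) (zr i)).
Qed.

Lemma power_series_geom_bounded r K (c : mindex n -> R[i]) z : 0 < r ->
  (forall al, normc (c al) <= K * r^-1 ^+ mdeg al) -> polydisc (r / 4) z ->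
  geom_bounded K (fun al => c al * zpow z al).
Proof.
move=> r0 cK zr al; rewrite normcM.
apply: le_trans (ler_pM (normc_ge0 _) (normc_ge0 _) (cK al) (zpow_le al zr)) _.
rewrite -mulrA -exprMn.
have -> : r^-1 * (r / 4) = 4^-1 by field; rewrite gt_eqF.
by [].
Qed.

Lemma power_series_exists r f M : 0 < r ->
  (forall z i t, cdifferentiable (fun t => f (set_coord z i t)) t) ->
  polydisc_bounded r f M -> exists c, power_series r (8 ^+ n * M) f c.
Proof.
move=> r0 fd fM.
exists (fun al => iter_coef r (enum 'I_n) al f 0).
have p0 : polydisc (2 * r) (0 : 'rV[R[i]]_n).
  by move=> i; rewrite mxE normc0 mulr_ge0 ?ltW.
have cb al : normc (iter_coef r (enum 'I_n) al f 0) <= 8 ^+ n * M * r^-1 ^+ mdeg al.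
  have := iter_coef_le (enum 'I_n) al r0 fM p0.
  by rewrite size_enum_ord big_enum/=.
split=> // z zr.
have [E E0 EP] := taylor_partial (enum_uniq 'I_n).
apply/esym/(@usum_box _ _ _ _ _ (E * M)) => [|N].
  exact: (power_series_geom_bounded r0 cb zr).
have zr2 : polydisc (2 * r) z by move=> i; apply: le_trans (zr i) _; lra.
have M0 : 0 <= M by apply: le_trans (normc_ge0 _) (fM z zr2).
have := EP r f M N z [ffun=> 0%N] r0 fd fM zr2 (fun i _ => zr i).
rewrite box_seq_box normcB => h.
apply: le_trans (_ : _ <= E * M * 4^-1 ^+ N) _; last first.
  by rewrite ler_wpM2l ?mulr_ge0// quarter_le_half.
apply: le_trans h; rewrite le_eqVlt; apply/orP; left; apply/eqP.
congr (normc (_ - _)); apply: eq_bigr => al _; rewrite /zpow; congr (_ * _).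
  by apply: iter_coef_indep => j; rewrite mem_enum.
by rewrite big_enum.
Qed.

End coordinates.

(** * Power series and their derivatives *)

Section differentiability.
Context {R : realType} {n : nat}.
Implicit Types (z w h : 'rV[R[i]]_n) (f g : 'rV[R[i]]_n -> R[i]) (i j : 'I_n).

Lemma coord_le_norm h i : `|h 0 i| <= `|h|.
Proof.
rewrite {2}/Num.norm/= mx_normE -[leLHS]nngE num_le.
exact: (@le_bigmax _ _ _ _ (fun ij => `|h ij.1 ij.2|%:nng) (0, i)).
Qed.

Lemma differentiable_quad0 f z (K r : R) : 0 < r ->
  (forall e h, e <= r -> polydisc e h -> normc (f (z + h) - f z) <= K * e ^+ 2) ->
  differentiable f z.
Proof.
move=> r0 fK.
pose d0 : {linear 'rV[R[i]]_n -> R[i]} := \0.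
have d0c : continuous d0 by move=> x; exact: (@cst_continuous _ _ (0 : R[i])).

have key (e' : R[i]) : 0 < e' ->
    \forall h \near nbhs (0 : 'rV[R[i]]_n), `|f (h + z) - (f z + 0)| <= e' * `|h|.
  move=> /posC_real[e e0 ->].
  have K0 : 0 <= K.
    have := fK r 0 (lexx r).
    rewrite addr0 subrr normc0 => /(_ _); rewrite pmulr_lge0 ?exprn_gt0//; apply.
    by move=> i; rewrite mxE normc0 ltW.
  have m0 : 0 < Num.min r (e / (K + 1)).
    by rewrite lt_min r0 divr_gt0// ltr_wpDl.
  apply/nbhs_ballP; exists (Num.min r (e / (K + 1)))%:C => /=; first by rewrite posC.
  move=> h; rewrite -ball_normE/= sub0r normrN => hm.
  have hr : `|h| = (complex.Re `|h|)%:C.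
    by have := normr_ge0 h; case: `|h| => a b; rewrite lecE/= => /andP[/eqP -> _].
  set t := complex.Re `|h| in hr.
  have t0 : 0 <= t by rewrite -lecR -hr normr_ge0.
  rewrite hr ltcR lt_min in hm; move/andP : hm => [tr te].
  rewrite addr0 [h + z]addrC.
  rewrite hr normC_normc -rmorphM lecR.
  apply: le_trans (fK t h (ltW tr) _) _.
    move=> i; rewrite -lecR -hr -normC_normc; exact: coord_le_norm.
  rewrite expr2 mulrA ler_wpM2r//.
  move: te; rewrite ltr_pdivlMr ?ltr_wpDl// => te; apply: le_trans (ltW te).
  by rewrite mulrC ler_wpM2l// lerDl.
have dE : 'd f z = d0 :> (_ -> _).
  by apply: (diff_unique d0c); apply/eqaddoP => e /key.
apply/diff_locallyP; rewrite dE; split=> //.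
by apply/eqaddoP => e /key.
Qed.

Lemma differentiable_linform (d : 'I_n -> R[i]) z :
  differentiable (fun w => \sum_i w 0 i * d i) z.
Proof.
have -> : (fun w : 'rV[R[i]]_n => \sum_i w 0 i * d i) =
    \sum_i ((fun w : 'rV[R[i]]_n => w 0 i) * cst (d i)).
  by apply/funext => w; rewrite fct_sumE.
apply: differentiable_sum => i; apply: differentiableM.
  exact: differentiable_coord.
exact: differentiable_cst.
Qed.

(** e bounds the coordinates of the increment h; any norm would do. *)
Lemma differentiable_quad f z (d : 'I_n -> R[i]) (K r : R) : 0 < r ->
  (forall e h, e <= r -> polydisc e h ->
     normc (f (z + h) - f z - \sum_i h 0 i * d i) <= K * e ^+ 2) ->
  differentiable f z.
Proof.
move=> r0 fK; pose L w := \sum_i w 0 i * d i : R[i].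
have -> : f = (f - L) + L by apply/funext => w; rewrite !fctE subrK.
apply: differentiableD; last exact: differentiable_linform.
apply: (@differentiable_quad0 _ _ K r) => // e h er hh.
have -> : (f - L) (z + h) - (f - L) z = f (z + h) - f z - \sum_i h 0 i * d i.
  have -> : \sum_i h 0 i * d i = L (z + h) - L z.
    rewrite /L -sumrB; apply: eq_bigr => i _; rewrite mxE; ring.
  by rewrite !fctE; ring.
exact: fK.
Qed.

Lemma entire_cdifferentiable f z i t : entire f ->
  cdifferentiable (fun t => f (set_coord z i t)) t.
Proof.
move=> fe; have /derivable_eps[l lP] :=
  @diff_derivable _ _ _ f (set_coord z i t) (delta_mx 0 i) (fe _).
exists l => e /lP[r r0 rP]; exists r => // w wr.
have := rP _ wr; congr (normc (f _ - _ - _) <= _); apply/rowP => j.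
rewrite !mxE eqxx/=; case: eqP => [_|_].
  by rewrite mulr1 subrK.
by rewrite mulr0 add0r.
Qed.

End differentiability.

Section more_sums.
Context {R : realType} {n : nat}.
Implicit Types (al be : mindex n) (i j : 'I_n).
Implicit Types (t u : mindex n -> R[i]) (l m : R[i]) (K M e : R).

Lemma has_usum_fset1 t al : (forall be, be != al -> t be = 0) ->
  has_usum t (t al).
Proof.
move=> t0.
have -> : t al = fsum t [fset al]%fset by rewrite /fsum big_seq_fset1.
by apply: has_usum_fin => be; rewrite inE => /t0.
Qed.

Lemma has_usum0 : has_usum (fun _ : mindex n => 0 : R[i]) 0.
Proof.
move=> e e0; exists fset0 => B _; rewrite /fsum big1// subrr normc0 ltW//.
Qed.

Lemma has_usum_sum (I : finType) (t : I -> mindex n -> R[i]) (l : I -> R[i]) :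
  (forall x, has_usum (t x) (l x)) -> has_usum (fun al => \sum_x t x al) (\sum_x l x).
Proof.
move=> tl; rewrite -(big_enum _ _ predT)/=.
under eq_fun do rewrite -(big_enum _ _ predT)/=.
elim: (enum I) => [|x s ih].
  by rewrite big_nil; under eq_fun do rewrite big_nil; exact: has_usum0.
rewrite big_cons; under eq_fun do rewrite big_cons.
exact: has_usum_D.
Qed.

Definition addm al be : mindex n := [ffun j => (al j + be j)%N].
Definition unitm i : mindex n := [ffun j => (j == i) : nat].
Definition zerom : mindex n := [ffun=> 0%N].

Lemma mdeg_addm al be : mdeg (addm al be) = (mdeg al + mdeg be)%N.
Proof. by rewrite /mdeg -big_split/=; apply: eq_bigr => i _; rewrite ffunE. Qed.

Lemma mdeg_unitm i : mdeg (unitm i) = 1%N.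
Proof.
rewrite /mdeg (bigD1 i)//= ffunE eqxx big1 ?addn0// => j ji.
by rewrite ffunE (negbTE ji).
Qed.

Lemma mdeg_zerom : mdeg zerom = 0%N.
Proof. by rewrite /mdeg big1// => i _; rewrite ffunE. Qed.

Lemma mdeg_eq0 al : mdeg al = 0%N -> al = zerom.
Proof.
move=> al0; apply/ffunP => i; rewrite ffunE; apply/eqP.
by rewrite -leqn0 -al0 le_mdeg.
Qed.

Lemma mdeg_eq1 al : mdeg al = 1%N -> exists i, al = unitm i.
Proof.
move=> al1.
have [/existsP[i ai]|/existsPn al0] := boolP [exists i, al i != 0%N].
  exists i; apply/ffunP => j; rewrite ffunE.
  have : (al i + \sum_(j < n | j != i) al j = 1)%N.
    by rewrite -al1 /mdeg [in RHS](bigD1 i).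
  move: ai; rewrite -lt0n; case: (al i) => [//|[|//]] _.
  move=> /(congr1 predn) /= S0.
  case: eqP => [->|/eqP ji]; last first.
    apply/eqP; rewrite -leqn0 -S0 add0n.
    by rewrite (bigD1 j)//= leq_addr.
  move: (al1); rewrite /mdeg (bigD1 i)//=.
  by rewrite add0n in S0; rewrite S0 addn0.
by move: al1; rewrite /mdeg big1// => i _; apply/eqP; have := al0 i; rewrite negbK.
Qed.

(** The reindexing al |-> al + e_i that turns the termwise derivative of a power
    series into a power series. *)
Lemma has_usum_shift i t u l : (forall be, u (addm be (unitm i)) = t be) ->
  (forall al, al i = 0%N -> u al = 0) -> has_usum t l -> has_usum u l.
Proof.
move=> ut u0 tl e /tl[A AP].
(* the inverse of the shift, on multi-indices with a positive i-th entry *)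
pose p al : mindex n := [ffun j => (al j - (j == i))%N].
have pK be : p (addm be (unitm i)) = be.
  by apply/ffunP => j; rewrite !ffunE addnK.
have Kp al : al i != 0%N -> addm (p al) (unitm i) = al.
  move=> ai; apply/ffunP => j; rewrite !ffunE subnK//.
  by case: eqP => // ->; rewrite lt0n.
exists [fset addm be (unitm i) | be in A]%fset => B AB.
pose B' := [fset p al | al in B & al i != 0%N]%fset.
have -> : fsum u B = fsum t B'.
  rewrite /fsum [RHS]big_imfset/=; last first.
    move=> al be /andP[_ ai] /andP[_ bi] /= pp.
    by rewrite -(Kp _ ai) -(Kp _ bi) pp.
  rewrite big_filter (bigID (fun al : mindex n => al i != 0%N))/=.
  rewrite [X in _ + X]big1 ?addr0; last by move=> al; rewrite negbK => /eqP/u0.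
  by apply: eq_bigr => al ai; rewrite -ut Kp.
apply: AP; apply/fsubsetP => be beA; apply/imfsetP => /=.
exists (addm be (unitm i)); last by rewrite pK.
rewrite inE; apply/andP; split; last by rewrite !ffunE eqxx addn1.
by apply: (fsubsetP AB); apply/imfsetP; exists be.
Qed.

End more_sums.

Section power_series_theory.
Context {R : realType} {n : nat}.
Implicit Types (al be : mindex n) (i j : 'I_n) (k : nat).
Implicit Types (z w h : 'rV[R[i]]_n) (f g : 'rV[R[i]]_n -> R[i]).
Implicit Types (b c : mindex n -> R[i]) (r K M e : R).

Lemma zpow_zerom z : zpow z (zerom : mindex n) = 1.
Proof. by rewrite /zpow big1// => i _; rewrite ffunE. Qed.

Lemma zpow_unitm z i : zpow z (unitm i) = z 0 i.
Proof.
rewrite /zpow (bigD1 i)//= ffunE eqxx expr1 big1 ?mulr1// => j ji.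
by rewrite ffunE (negbTE ji).
Qed.

Lemma zpow0 al : al != zerom -> zpow (0 : 'rV[R[i]]_n) al = 0.
Proof.
move=> a0; have [i ai] : exists i, al i != 0%N.
  apply/existsP; apply: contraNT a0 => /existsPn h.
  by apply/eqP/ffunP => i; rewrite ffunE; apply/eqP; have := h i; rewrite negbK.
by rewrite /zpow (bigD1 i)//= mxE expr0n (negbTE ai) mul0r.
Qed.

Lemma power_series_at0 r K f c : 0 < r -> power_series r K f c -> f 0 = c zerom.
Proof.
move=> r0 [_ /(_ 0)] -> => [|i]; last by rewrite mxE normc0 divr_ge0 ?ltW.
have := @has_usum_fset1 _ _ (fun al => c al * zpow (0 : 'rV[R[i]]_n) al) zerom.
move=> /(_ _)/has_usumE -> => [|be be0]; last by rewrite zpow0// mulr0.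
by rewrite zpow_zerom mulr1.
Qed.

(** The terms of degree at least 2 are smaller by the factor (4 e / r) ^ 2 than
    their bounds at radius r/4. *)
Lemma power_series_quad r K f c e h : 0 < r -> power_series r K f c ->
  e <= r / 4 -> polydisc e h ->
  normc (f h - f 0 - \sum_i h 0 i * c (unitm i)) <= (16 * K * 2 ^+ n / r ^+ 2) * e ^+ 2.
Proof.
move=> r0 fc er he; have [cK fE] := fc.
have K0 : 0 <= K.
  by have := cK zerom; rewrite mdeg_zerom expr0 mulr1; apply: le_trans; exact: normc_ge0.
have hr : polydisc (r / 4) h by move=> i; apply: le_trans (he i) er.
pose t al := c al * zpow h al.
have tK : geom_bounded K t := power_series_geom_bounded r0 cK hr.
pose t0 al := if al == zerom then c zerom else 0.
pose tu i al := if al == unitm i then h 0 i * c (unitm i) else 0.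
have ht0 : has_usum t0 (c zerom).
  have := @has_usum_fset1 _ _ t0 zerom; rewrite /t0 eqxx; apply.
  by move=> be /negbTE ->.
have htu i : has_usum (tu i) (h 0 i * c (unitm i)).
  have := @has_usum_fset1 _ _ (tu i) (unitm i); rewrite /tu eqxx; apply.
  by move=> be /negbTE ->.
pose t1 al := t al + (-1) * (t0 al + \sum_i tu i al).
have ht1 : has_usum t1 (usum t + (-1) * (c zerom + \sum_i h 0 i * c (unitm i))).
  apply: has_usum_D; first exact: geom_bounded_has_usum tK.
  by apply: has_usum_Z; apply: has_usum_D => //; exact: has_usum_sum.
have -> : f h - f 0 - \sum_i h 0 i * c (unitm i) = usum t1.
  rewrite (has_usumE ht1) fE// (power_series_at0 r0 fc) -/t.
  by move: (\sum_i _) => S; ring.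
have K'0 : 0 <= 16 * K / r ^+ 2 * e ^+ 2.
  by apply: mulr_ge0; [apply: divr_ge0; [exact: mulr_ge0|exact: sqr_ge0]|exact: sqr_ge0].
have -> : 16 * K * 2 ^+ n / r ^+ 2 * e ^+ 2 = 16 * K / r ^+ 2 * e ^+ 2 * 2 ^+ n by ring.
apply: usum_le => al.
case E : (mdeg al) => [|[|m]].
- have {E} -> := mdeg_eq0 E.
  have -> : t1 zerom = 0.
    rewrite /t1 /t0 eqxx /t zpow_zerom mulr1 big1 ?addr0 => [|i _]; first by ring.
    rewrite /tu; case: eqP => // /(congr1 (@mdeg n)); rewrite mdeg_zerom mdeg_unitm//.
  by rewrite normc0 mulr_ge0.
- have {E} [i ->] := mdeg_eq1 E.
  have -> : t1 (unitm i) = 0.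
    rewrite /t1 /t0; case: eqP => [/(congr1 (@mdeg n))|_];
      first by rewrite mdeg_zerom mdeg_unitm.
    rewrite (bigD1 i)//= {1}/tu eqxx big1 => [|j ji]; first by rewrite /t zpow_unitm; ring.
    rewrite /tu; case: eqP => // /ffunP/(_ j); rewrite !ffunE eqxx (negbTE ji)//.
  by rewrite normc0 mulr_ge0// exprn_ge0.
- have -> : t1 al = t al.
    rewrite /t1 /t0; case: eqP => [al0|_]; first by rewrite al0 mdeg_zerom in E.
    rewrite big1 => [|i _]; first by ring.
    by rewrite /tu; case: eqP => // ali; rewrite ali mdeg_unitm in E.
  have e0 : 0 <= e.
    case: (posnP n) => [n0|n0].
      by move: E; rewrite /mdeg big1// => i; move: (ltn_ord i); rewrite {2}n0.
    by apply: le_trans (normc_ge0 _) (he (Ordinal n0)).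
  rewrite /t normcM.
  apply: le_trans (ler_pM (normc_ge0 _) (normc_ge0 _) (cK al) (zpow_le al he)) _.
  rewrite E.
  apply: (@le_trans _ _ (K * r^-1 ^+ m.+2 * (e ^+ 2 * (r / 4) ^+ m))).
    apply: ler_wpM2l; first by apply: mulr_ge0 => //; rewrite exprn_ge0// invr_ge0 ltW.
    rewrite -[m.+2]addn2 exprD mulrC ler_wpM2l ?sqr_ge0//.
    by apply: lerXn2r; rewrite ?nnegrE// divr_ge0 ?(ltW r0).
  rewrite le_eqVlt; apply/orP; left; apply/eqP.
  rewrite !exprS !exprVn expr_div_n; field.
  by rewrite !expf_neq0// gt_eqF.
Qed.

Lemma power_series_differentiable r K f c z : 0 < r ->
  power_series r K (fun w => f (z + w)) c ->
  differentiable f z.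
Proof.
move=> r0 fc.
apply: (@differentiable_quad _ _ f z (fun i => c (unitm i)) (16 * K * 2 ^+ n / r ^+ 2)
  (r / 4)).
  by rewrite divr_gt0.
move=> e h er he; have := power_series_quad r0 fc er he; by rewrite addr0.
Qed.

Definition mfact al : R[i] := \prod_i ((al i)`!)%:R.

Lemma mfact_gt0 al : 0 < \prod_i ((al i)`!)%:R :> R.
Proof. by apply: prodr_gt0 => i _; rewrite ltr0n fact_gt0. Qed.

Lemma mfactE al : mfact al = (\prod_i ((al i)`!)%:R)%:C.
Proof. by rewrite rmorph_prod; apply: eq_bigr => i _; rewrite rmorph_nat. Qed.

Lemma normc_mfact al : normc (mfact al) = \prod_i ((al i)`!)%:R.
Proof. by rewrite mfactE normc_real gtr0_norm// mfact_gt0. Qed.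

Lemma mfact_neq0 al : mfact al != 0.
Proof. by rewrite -normc_gt0 normc_mfact mfact_gt0. Qed.

Lemma mfact_addu al i : mfact (addm al (unitm i)) = (al i).+1%:R * mfact al.
Proof.
rewrite /mfact (bigD1 i)//= [in RHS](bigD1 i)//= !ffunE eqxx addn1 factS natrM -mulrA.
congr (_ * (_ * _)); apply: eq_bigr => j ji.
by rewrite !ffunE (negbTE ji) addn0.
Qed.

Lemma mfact_zerom : mfact zerom = 1.
Proof. by rewrite /mfact big1// => i _; rewrite ffunE. Qed.

(** The remainder E k satisfies E (k + 1) = (a + x) E k + k a ^ (k - 1) x ^ 2. *)
Lemma pow_remainder (a x : R[i]) (s : R) k : 0 < s -> normc a + normc x <= s ->
  normc ((a + x) ^+ k - a ^+ k - k%:R * a ^+ k.-1 * x) <=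
    2 ^+ k * s ^+ k / s ^+ 2 * normc x ^+ 2.
Proof.
move=> s0 axs.
have as_ : normc a <= s by apply: le_trans axs; rewrite lerDl normc_ge0.
elim: k => [|k ih].
  rewrite !expr0 mul0r mul0r !subr0 subrr normc0.
  by rewrite mulr_ge0 ?sqr_ge0// divr_ge0 ?sqr_ge0 ?mulr_ge0.
set E := _ - _ in ih.
have -> : (a + x) ^+ k.+1 - a ^+ k.+1 - k.+1%:R * a ^+ k.+1.-1 * x =
    (a + x) * E + k%:R * a ^+ k.-1 * x ^+ 2.
  rewrite /E; case: (k) => [|m] /=; first by rewrite !expr0 !expr1; ring.
  by rewrite -[m.+2%:R]natr1 !exprS; ring.
have -> : 2 ^+ k.+1 * s ^+ k.+1 / s ^+ 2 * normc x ^+ 2 =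
    s * (2 ^+ k * s ^+ k / s ^+ 2 * normc x ^+ 2) +
    2 ^+ k * s ^+ k / s * normc x ^+ 2.
  by rewrite !exprS; field; rewrite gt_eqF.
apply: le_trans (le_normcD _ _) _; apply: lerD.
  rewrite normcM; apply: ler_pM; rewrite ?normc_ge0//.
  exact: le_trans (le_normcD _ _) axs.
rewrite !normcM !normcX ler_wpM2r ?sqr_ge0//.
case: k {ih E} => [|k] /=.
  by rewrite mulr0n normc0 mul0r !expr0 !mul1r invr_ge0 ltW.
have -> : 2 ^+ k.+1 * s ^+ k.+1 / s = 2 ^+ k.+1 * s ^+ k.
  by rewrite [s ^+ _]exprS; field; rewrite gt_eqF.
apply: ler_pM; rewrite ?normc_ge0 ?exprn_ge0 ?normc_ge0//.
  rewrite -(rmorph_nat (real_complex R)) normc_real ger0_norm// -natrX ler_nat.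
  exact/ltnW/ltn_expl.
by apply: lerXn2r; rewrite ?nnegrE ?normc_ge0// ltW.
Qed.

(** Differentiate term by term: by pow_remainder with s = r/8, the remainders of
    the terms are dominated by 4^-|al| |x| ^ 2. Division by mfact turns the
    differentiation of the series into a shift of b. *)
Lemma power_series_pderiv r K f b i : 0 < r ->
  power_series r K f (fun be => b be / mfact be) ->
  power_series (r / 4) (K / r) (pderiv i f) (fun be => b (addm be (unitm i)) / mfact be).
Proof.
move=> r0 [cK fE].
pose c be := b be / mfact be.
have K0 : 0 <= K.
  by have := cK zerom; rewrite mdeg_zerom expr0 mulr1; apply: le_trans; exact: normc_ge0.
have shiftE be : b (addm be (unitm i)) / mfact be = (be i).+1%:R * c (addm be (unitm i)).
  by rewrite /c mfact_addu; field; rewrite mfact_neq0 nat1r pnatr_eq0.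
have c'K be : normc (b (addm be (unitm i)) / mfact be) <= K / r * (r / 4)^-1 ^+ mdeg be.
  rewrite shiftE normcM.
  have nn : normc ((be i).+1%:R : R[i]) <= 4 ^+ mdeg be.
    rewrite -(rmorph_nat (real_complex R)) normc_real ger0_norm// -natrX ler_nat.
    by apply: (leq_trans (ltn_expl (be i) (isT : 1 < 4)%N)); rewrite leq_exp2l// le_mdeg.
  apply: le_trans (ler_pM (normc_ge0 _) (normc_ge0 _) nn (cK _)) _.
  rewrite mdeg_addm mdeg_unitm addn1 exprS invf_div exprMn le_eqVlt; apply/orP; left.
  by apply/eqP; ring.
split=> // z zr.
set s := r / 8.
have s0 : 0 < s by rewrite divr_gt0.
pose v be := b (addm be (unitm i)) / mfact be * zpow z be.
pose rest al := \prod_(j < n | j != i) z 0 j ^+ al j.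
pose u al := c al * ((al i)%:R * z 0 i ^+ (al i).-1 * rest al).
have r40 : 0 < r / 4 by rewrite divr_gt0.
have vgeo := power_series_geom_bounded r40 c'K zr.
have gsu : has_usum u (usum v).
  apply: (@has_usum_shift _ _ i v); last exact: geom_bounded_has_usum vgeo.
    move=> be; rewrite /u /v shiftE /rest !ffunE eqxx addn1/=.
    rewrite /zpow [in RHS](bigD1 i)//=.
    have -> : \prod_(j < n | j != i) z 0 j ^+ addm be (unitm i) j =
              \prod_(j < n | j != i) z 0 j ^+ be j.
      by apply: eq_bigr => j ji; rewrite !ffunE (negbTE ji) addn0.
    by ring.
  by move=> al ai; rewrite /u ai !mul0r mulr0.
apply: derive_val_eps => e e0.
pose Q := K / s ^+ 2 * 2 ^+ n.
have Q0 : 0 <= Q by rewrite mulr_ge0// divr_ge0// sqr_ge0.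
exists (Num.min (r / 16) (e / (Q + 1))).
  by rewrite lt_min !divr_gt0// ltr_wpDl.
move=> x; rewrite le_min => /andP[xr xe].
have zx : polydisc (r / 4) (x *: delta_mx 0 i + z).
  move=> j; rewrite !mxE eqxx/=; apply: le_trans (le_normcD _ _) _.
  have h1 : normc (x * (j == i)%:R) <= r / 16.
    by case: eqP => _; rewrite ?mulr1 ?mulr0 ?normc0// divr_ge0// ltW.
  by have := zr j; have := r0; lra.
have zr4 : polydisc (r / 4) z by move=> j; have := zr j; have := r0; lra.
pose t1 al := c al * zpow (x *: delta_mx 0 i + z) al.
pose t0 al := c al * zpow z al.
(* the remainder of the term of order al *)
pose D al := t1 al + (-1) * (t0 al + x * u al).
have hD : has_usum D (usum t1 + (-1) * (usum t0 + x * usum v)).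
  apply: has_usum_D; first exact: geom_bounded_has_usum (power_series_geom_bounded r0 cK zx).
  apply: has_usum_Z; apply: has_usum_D;
    first exact: geom_bounded_has_usum (power_series_geom_bounded r0 cK zr4).
  exact: has_usum_Z.
have -> : f (x *: delta_mx 0 i + z) - f z - usum v * x = usum D.
  rewrite (has_usumE hD) !fE// -/t1 -/t0.
  by move: (usum t1) (usum t0) (usum v) => A B C; ring.
have Dgeo : geom_bounded (K / s ^+ 2 * normc x ^+ 2) D.
  move=> al.
  have zpowx : zpow (x *: delta_mx 0 i + z) al = (z 0 i + x) ^+ al i * rest al.
    rewrite /zpow (bigD1 i)//= !mxE !eqxx mulr1 [x + _]addrC; congr (_ * _).
    by apply: eq_bigr => j ji; rewrite !mxE (negbTE ji) andbF mulr0 add0r.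
  have zpowz : zpow z al = z 0 i ^+ al i * rest al by rewrite /zpow (bigD1 i).
  have -> : D al = c al * (((z 0 i + x) ^+ al i - z 0 i ^+ al i -
      (al i)%:R * z 0 i ^+ (al i).-1 * x) * rest al).
    by rewrite /D /t1 /t0 /u zpowx zpowz; ring.
  have degE : mdeg al = (al i + \sum_(j < n | j != i) al j)%N by rewrite /mdeg (bigD1 i).
  have restle : normc (rest al) <= s ^+ (\sum_(j < n | j != i) al j).
    rewrite normc_prod expr_sum; apply: ler_prod => j _; rewrite normc_ge0 normcX.
    apply: lerXn2r; rewrite ?nnegrE ?normc_ge0 ?(ltW s0)//.
    by have := zr j; rewrite /s; have := r0; lra.
  have axs : normc (z 0 i) + normc x <= s.
    by have := zr i; rewrite /s; have := r0; lra.
  have P := pow_remainder (al i) s0 axs.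
  rewrite (normcM (c al)) [X in _ * X <= _]normcM.
  have PR := ler_pM (normc_ge0 _) (normc_ge0 _) P restle.
  have cPR := ler_pM (normc_ge0 (c al)) (mulr_ge0 (normc_ge0 _) (normc_ge0 _)) (cK al) PR.
  apply: le_trans cPR _.
  have p2 : 2 ^+ al i <= 2 ^+ mdeg al :> R by rewrite ler_weXn2l ?ler1n// le_mdeg.
  have -> : K * r^-1 ^+ mdeg al * (2 ^+ al i * s ^+ al i / s ^+ 2 * normc x ^+ 2 *
      s ^+ (\sum_(j < n | j != i) al j)) =
      K * r^-1 ^+ mdeg al * s ^+ mdeg al / s ^+ 2 * normc x ^+ 2 * 2 ^+ al i.
    have -> : s ^+ mdeg al = s ^+ al i * s ^+ (\sum_(j < n | j != i) al j).
      by rewrite -exprD -degE.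
    by ring.
  have -> : K / s ^+ 2 * normc x ^+ 2 * 4^-1 ^+ mdeg al =
      K * r^-1 ^+ mdeg al * s ^+ mdeg al / s ^+ 2 * normc x ^+ 2 * 2 ^+ mdeg al.
    have -> : 4^-1 = r^-1 * s * 2 by rewrite /s; field; rewrite gt_eqF.
    by rewrite !exprMn; ring.
  have s2 : 0 <= (s ^+ 2)^-1 by rewrite invr_ge0 sqr_ge0.
  have rd : 0 <= r^-1 ^+ mdeg al by rewrite exprn_ge0// invr_ge0 ltW.
  have sd : 0 <= s ^+ mdeg al by rewrite exprn_ge0// ltW.
  have xx := sqr_ge0 (normc x).
  apply: ler_wpM2l => //; apply: mulr_ge0 => //; apply: mulr_ge0 => //.
  by apply: mulr_ge0 => //; apply: mulr_ge0.
apply: le_trans (usum_le Dgeo) _.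
have -> : K / s ^+ 2 * normc x ^+ 2 * 2 ^+ n = Q * normc x * normc x by rewrite /Q; ring.
rewrite ler_wpM2r ?normc_ge0//.
move: xe; rewrite ler_pdivlMr ?ltr_wpDl// => xe; apply: le_trans xe.
by rewrite mulrC ler_wpM2l ?normc_ge0// lerDl.
Qed.

(** Here b al is the derivative of order al at 0, by mderiv0. *)
Definition taylor_series f b :=
  exists r K, 0 < r /\ power_series r K f (fun be => b be / mfact be).

Lemma taylor_series_iter f b i k : taylor_series f b ->
  taylor_series (iter k (pderiv i) f) (fun be => b (addm be [ffun j => (k * (j == i))%N])).
Proof.
move=> fb; elim: k => [|k [r [K [r0 ih]]]].
  rewrite /=; congr (taylor_series f _) : fb; apply/funext => be; congr b.
  by apply/ffunP => j; rewrite !ffunE mul0n addn0.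
exists (r / 4), (K / r); split; first by rewrite divr_gt0.
have := power_series_pderiv i r0 ih; rewrite /=; congr (power_series _ _ _ _).
apply/funext => be; congr (b _ / _); apply/ffunP => j; rewrite !ffunE.
by rewrite -addnA mulSn.
Qed.

Lemma taylor_series_mderiv f b al : taylor_series f b ->
  taylor_series (mderiv al f) (fun be => b (addm be al)).
Proof.
move=> fb.
have H s : taylor_series (foldr (fun i g => iter (al i) (pderiv i) g) f s)
    (fun be => b (addm be [ffun j => (al j * count_mem j s)%N])).
  elim: s => [|i s ih] /=.
    congr (taylor_series f _) : fb; apply/funext => be; congr b.
    by apply/ffunP => j; rewrite !ffunE muln0 addn0.
  have := taylor_series_iter i (al i) ih; congr (taylor_series _ _).
  apply/funext => be; congr b; apply/ffunP => j; rewrite !ffunE mulnDr addnA.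
  by rewrite eq_sym; case: eqP => [->|_] //=; rewrite !muln0.
have := H (enum 'I_n); congr (taylor_series _ _); apply/funext => be; congr b.
apply/ffunP => j; rewrite !ffunE count_uniq_mem ?enum_uniq// mem_enum.
by rewrite muln1.
Qed.

Lemma mderiv0 f b al : taylor_series f b -> mderiv al f 0 = b al.
Proof.
move=> /(taylor_series_mderiv al)[r [K [r0 fb]]]; rewrite (power_series_at0 r0 fb).
rewrite mfact_zerom divr1; congr b.
by apply/ffunP => j; rewrite !ffunE.
Qed.

Lemma mderiv_shift f al w :
  mderiv al (fun z => f (w + z)) = fun z => mderiv al f (w + z).
Proof.
have pS g i : pderiv i (fun z => g (w + z)) = fun z => pderiv i g (w + z).
  apply/funext => z; rewrite /pderiv /derive.
  suff -> : (fun h : R[i] => h^-1 *: (((fun z => g (w + z)) \o shift z)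
      (h *: delta_mx 0 i) - g (w + z))) =
    (fun h : R[i] => h^-1 *: ((g \o shift (w + z)) (h *: delta_mx 0 i) - g (w + z))) by [].
  by apply/funext => h /=; rewrite addrCA.
have iS g i k : iter k (pderiv i) (fun z => g (w + z)) =
    fun z => iter k (pderiv i) g (w + z).
  elim: k => [|k ih]; first by [].
  by rewrite iterS ih; exact: pS.
rewrite /mderiv; elim: (enum 'I_n) => [|i s ih]; first by [].
rewrite [LHS]/= ih; exact: iS.
Qed.

(** Some power series represents f (z + w), and mderiv0 identifies its
    coefficients. *)
Lemma taylor_power_series r f z M : 0 < r -> entire f ->
  (forall w, polydisc (2 * r) w -> normc (f (z + w)) <= M) ->
  power_series r (8 ^+ n * M) (fun w => f (z + w)) (fun al => mderiv al f z / mfact al).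
Proof.
move=> r0 fe fM.
have fe' : entire (fun w => f (z + w)).
  move=> w.
  have dz : differentiable (cst z + id : 'rV[R[i]]_n -> 'rV[R[i]]_n) w.
    by apply: differentiableD; [exact: differentiable_cst|exact: ex_diff].
  exact: (differentiable_comp dz (fe _)).
have [c fc] := power_series_exists r0 (fun x i t =>
  @entire_cdifferentiable _ _ _ x i t fe') fM.
have PSb : taylor_series (fun w => f (z + w)) (fun al => mfact al * c al).
  exists r, (8 ^+ n * M); split=> //; congr (power_series _ _ _ _) : fc.
  by apply/funext => al; rewrite mulrAC divff ?mul1r// mfact_neq0.
congr (power_series _ _ _ _) : fc; apply/funext => al.
have := mderiv0 al PSb; rewrite mderiv_shift addr0 => ->.
by rewrite mulrAC divff ?mul1r// mfact_neq0.
Qed.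

Lemma cauchy_estimate r f z M al : 0 < r -> entire f ->
  (forall w, polydisc (2 * r) w -> normc (f (z + w)) <= M) ->
  normc (mderiv al f z) <= 8 ^+ n * M * normc (mfact al) * r^-1 ^+ mdeg al.
Proof.
move=> r0 fe fM; have [/(_ al)] := taylor_power_series r0 fe fM.
rewrite normcM normcV ler_pdivrMr ?normc_gt0 ?mfact_neq0// => h _.
by rewrite mulrAC.
Qed.

Definition locally_bounded f := forall z, exists r M, 0 < r /\
  forall w, polydisc (2 * r) w -> normc (f (z + w)) <= M.

Lemma entire_mderiv f al : entire f -> locally_bounded f ->
  entire (mderiv al f).
Proof.
move=> fe fl z; have [r [M [r0 fM]]] := fl z.
have P : taylor_series (fun w => f (z + w)) (fun al => mderiv al f z).
  by exists r, (8 ^+ n * M); split=> //; exact: taylor_power_series.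
have [r' [K' [r'0]]] := taylor_series_mderiv al P; rewrite mderiv_shift.
exact: power_series_differentiable.
Qed.

(** By power_series_quad the terms have first order expansions at z whose errors
    are dominated by 4^-|al| e ^ 2, and such expansions can be summed. *)
Lemma weierstrass (T : mindex n -> 'rV[R[i]]_n -> R[i]) z r K : 0 < r ->
  (forall al, entire (T al)) ->
  (forall al w, polydisc (2 * r) w -> normc (T al (z + w)) <= K * 4^-1 ^+ mdeg al) ->
  differentiable (fun w => usum (fun al => T al w)) z.
Proof.
move=> r0 Te TK.
pose l al i := mderiv (unitm i) (T al) z / mfact (unitm i).
pose Q := 8 ^+ n * K.
have P al := taylor_power_series r0 (Te al) (TK al).
have lgeo i : geom_bounded (Q * r^-1) (fun al => l al i).
  move=> al; have [/(_ (unitm i)) h _] := P al.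
  by apply: le_trans h _; rewrite mdeg_unitm expr1 /Q le_eqVlt; apply/orP; left;
    apply/eqP; ring.
apply: (@differentiable_quad _ _ _ z (fun i => usum (fun al => l al i))
  (16 * Q * 2 ^+ n / r ^+ 2 * 2 ^+ n) (r / 4)); first by rewrite divr_gt0.
move=> e h er he.
have h2 : polydisc (2 * r) h by move=> i; have := he i; have := r0; lra.
have h0 : polydisc (2 * r) (0 : 'rV[R[i]]_n).
  by move=> i; rewrite mxE normc0; have := r0; lra.
have T1geo : geom_bounded K (fun al => T al (z + h)) by move=> al; exact: TK.
have T0geo : geom_bounded K (fun al => T al z) by move=> al; have := TK al 0 h0;
  rewrite addr0.
pose D al := T al (z + h) + (-1) * (T al z + \sum_i h 0 i * l al i).
have hD : has_usum D (usum (fun al => T al (z + h)) + (-1) * (usum (fun al => T al z) +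
     \sum_i h 0 i * usum (fun al => l al i))).
  apply: has_usum_D; first exact: geom_bounded_has_usum T1geo.
  apply: has_usum_Z; apply: has_usum_D; first exact: geom_bounded_has_usum T0geo.
  by apply: has_usum_sum => i; apply: has_usum_Z; exact: geom_bounded_has_usum (lgeo i).
have -> : usum (fun al => T al (z + h)) - usum (fun al => T al z) -
    \sum_i h 0 i * usum (fun al => l al i) = usum D.
  by rewrite (has_usumE hD); move: (\sum_i _) => S; ring.
rewrite -mulrA [2 ^+ n * _]mulrC mulrA.
apply: usum_le => al.
have := power_series_quad r0 (P al) er he; rewrite addr0 => h3.
have -> : D al = T al (z + h) - T al z - \sum_i h 0 i * (mderiv (unitm i)
  (T al) z / mfact (unitm i)).
  by rewrite /D /l; move: (\sum_i _) => S; ring.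
apply: le_trans h3 _; rewrite /Q le_eqVlt; apply/orP; left; apply/eqP.
by ring.
Qed.

End power_series_theory.

(** * Factorials and exponential weights *)

Section factorials.
Context {R : realType} {n : nat}.
Implicit Types (al : mindex n) (m k : nat).

Lemma fact_addn_ge a b : (a`! * b`! <= (a + b)`!)%N.
Proof. by rewrite -(bin_fact (leq_addr b a)) addKn leq_pmull// bin_gt0 leq_addr. Qed.

Lemma bin_le_exp2 m k : ('C(m, k) <= 2 ^ m)%N.
Proof.
elim: m k => [|m ih] [|k]; rewrite ?bin0 ?expn_gt0// binS expnS mul2n -addnn.
by rewrite leq_add.
Qed.

Lemma fact_addn_le a b : ((a + b)`! <= 2 ^ (a + b) * (a`! * b`!))%N.
Proof. by rewrite -{1}(bin_fact (leq_addr b a)) addKn leq_mul// bin_le_exp2. Qed.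

Lemma prod_fact_le al : (\prod_i (al i)`! <= (mdeg al)`!)%N.
Proof.
rewrite /mdeg; apply: (big_ind2 (fun x y => x <= y`!)%N) => // a b c d ab cd.
exact: leq_trans (leq_mul ab cd) (fact_addn_ge _ _).
Qed.

(** Each of the n coordinates is split off by (a + b)! <= 2 ^ (a + b) a! b!. *)
Lemma fact_le_prod al : ((mdeg al)`! <= (2 ^ n) ^ mdeg al * \prod_i (al i)`!)%N.
Proof.
rewrite -expnM.
have H (s : seq 'I_n) : ((\sum_(i <- s) al i)`! <=
    2 ^ (size s * \sum_(i <- s) al i) * \prod_(i <- s) (al i)`!)%N.
  elim: s => [|i s ih]; first by rewrite !big_nil.
  rewrite !big_cons; apply: leq_trans (fact_addn_le _ _) _.
  set S := (\sum_(j <- s) al j)%N in ih *.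
  apply: (@leq_trans (2 ^ (al i + S) * ((al i)`! * (2 ^ (size s * S) * \prod_(j <- s)
    (al j)`!)))%N).
    by rewrite !leq_mul2l ih !orbT.
  rewrite [X in (2 ^ _ * X)%N]mulnCA mulnA -expnD leq_mul2r; apply/orP; right.
  rewrite leq_exp2l//= mulSn leq_add2l leq_mul2l leq_addl orbT//.
have := H (enum 'I_n); rewrite size_enum_ord !big_enum/=.
exact.
Qed.

Lemma normc_mfact_nat al : normc (mfact al : R[i]) = (\prod_i (al i)`!)%N%:R.
Proof. by rewrite normc_mfact natr_prod. Qed.

Lemma mfact_le al : normc (mfact al : R[i]) <= (mdeg al)`!%:R.
Proof. by rewrite normc_mfact_nat ler_nat prod_fact_le. Qed.

Lemma le_mfact al : (mdeg al)`!%:R <=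
  (2 ^+ n) ^+ mdeg al * normc (mfact al : R[i]).
Proof. by rewrite normc_mfact_nat -!natrX -natrM ler_nat fact_le_prod. Qed.

Lemma fact_le_exp m : (m`! <= m.+1 ^ m)%N.
Proof.
elim: m => // m ih; rewrite factS [(_.+1 ^ _)%N]expnS leq_mul//.
by apply: leq_trans ih _; case: m => // m; rewrite leq_exp2r.
Qed.

End factorials.

Section weights.
Context {R : realType} {n : nat} (p : R) (p0 : 0 < p).
Implicit Types (al : mindex n) (m k : nat) (a b x y s t tau M : R).
Implicit Types (z w h : 'rV[R[i]]_n) (f g : 'rV[R[i]]_n -> R[i]).

Let pN0 : p != 0. Proof. by rewrite gt_eqF. Qed.

Lemma powR_le x y : 0 <= x -> x <= y -> x `^ p <= y `^ p.
Proof.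
move=> x0 xy; apply: ge0_ler_powR => //; rewrite ?nnegrE ?(ltW p0)//.
exact: le_trans xy.
Qed.

Lemma powR_invK x : 0 <= x -> (x `^ p^-1) `^ p = x.
Proof. by move=> x0; rewrite -powRrM mulVf// powRr1. Qed.

Lemma powR_Kinv x : 0 <= x -> (x `^ p) `^ p^-1 = x.
Proof. by move=> x0; rewrite -powRrM mulfV// powRr1. Qed.

Lemma powR_add_le x y : 0 <= x -> 0 <= y ->
  (x + y) `^ p <= 2 `^ p * (x `^ p + y `^ p).
Proof.
wlog xy : x y / x <= y.
  move=> H x0 y0; case: (leP x y) => [xy|/ltW yx]; first exact: H.
  by rewrite addrC [x `^ p + _]addrC; exact: H.
move=> x0 y0; apply: (@le_trans _ _ ((2 * y) `^ p)).
  by apply: powR_le; [exact: addr_ge0|lra].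
by rewrite powRM// ler_wpM2l ?powR_ge0// lerDr powR_ge0.
Qed.

(** By fact_powR, the bounds in the definition of the symbol class have the factor
    root_fact m / m!. *)
Definition root_fact m : R := (m`!%:R) `^ p^-1.

Lemma root_fact_gt0 m : 0 < root_fact m.
Proof. by rewrite powR_gt0// ltr0n fact_gt0. Qed.

Lemma fact_powR m : (m`!%:R : R) `^ (1 - p^-1) = m`!%:R / root_fact m.
Proof.
have f0 : (0 : R) < m`!%:R by rewrite ltr0n fact_gt0.
by rewrite powRB ?(gt_eqF f0) ?implybT// powRr1// ltW.
Qed.

(** For y = tau p x ^ p one has y ^ m / m! <= exp y; take p-th roots. *)
Lemma pow_le_expR tau : 0 < tau -> exists2 A, 0 < A & forall x m, 0 <= x ->
  x ^+ m <= A ^+ m * root_fact m * expR (tau * x `^ p).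
Proof.
move=> t0; pose d := tau * p; have d0 : 0 < d by rewrite mulr_gt0.
exists ((d^-1) `^ p^-1) => [|x m x0]; first by rewrite powR_gt0// invr_gt0.
set y := d * x `^ p.
have y0 : 0 <= y by rewrite mulr_ge0 ?powR_ge0// ltW.
have ym : y ^+ m <= m`!%:R * expR y.
  have f0 : (0 : R) < m`!%:R by rewrite ltr0n fact_gt0.
  rewrite mulrC -ler_pdivrMr//; case: m f0 => [|m] f0.
    by rewrite expr0 fact0 divr1; have := expR_ge1Dx y; lra.
  by have := expR_ge1Dxn m y0; lra.
have -> : x ^+ m = (d^-1) `^ p^-1 ^+ m * (y ^+ m) `^ p^-1.
  have -> : (y ^+ m) `^ p^-1 = (y `^ p^-1) ^+ m.
    by rewrite -(powR_mulrn m y0) powRAC powR_mulrn ?powR_ge0.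
  rewrite -exprMn -powRM ?invr_ge0 ?(ltW d0)// /y mulKf ?gt_eqF//.
  by rewrite powR_Kinv.
rewrite -mulrA ler_wpM2l ?exprn_ge0 ?powR_ge0//.
apply: (@le_trans _ _ ((m`!%:R * expR y) `^ p^-1)).
  apply: ge0_ler_powR; rewrite ?nnegrE ?invr_ge0 ?(ltW p0)//; first exact: exprn_ge0.
rewrite powRM ?expR_ge0// ler_wpM2l ?powR_ge0//.
rewrite -expRM le_eqVlt; apply/orP; left; apply/eqP.
by rewrite /y /d; congr expR; field.
Qed.

Lemma enorm_ge0 z : 0 <= enorm z.
Proof. exact: sqrtr_ge0. Qed.

Lemma coord_le_enorm z i : normc (z 0 i) <= enorm z.
Proof.
rewrite -(@ler_pXn2r _ 2) ?nnegrE ?normc_ge0 ?enorm_ge0// sqr_sqrtr.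
  by rewrite (bigD1 i)//= lerDl sumr_ge0// => j _; rewrite sqr_ge0.
by rewrite sumr_ge0// => j _; rewrite sqr_ge0.
Qed.

Lemma enorm_le_sum z : enorm z <= \sum_i normc (z 0 i).
Proof.
rewrite -(@ler_pXn2r _ 2) ?nnegrE ?enorm_ge0//; last first.
  by rewrite sumr_ge0// => j _; rewrite normc_ge0.
rewrite sqr_sqrtr; last by rewrite sumr_ge0// => j _; rewrite sqr_ge0.
suff : \sum_i normc (z 0 i) ^+ 2 <= (\sum_i normc (z 0 i)) ^+ 2 /\
  0 <= \sum_i normc (z 0 i) by case.
apply: (big_ind2 (fun x y => x <= y ^+ 2 /\ 0 <= y)).
- by rewrite expr0n.
- move=> x1 x2 y1 y2 [x12 x20] [y12 y20]; split; last exact: addr_ge0.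
  by have := mulr_ge0 x20 y20; rewrite sqrrD; lra.
- by move=> i _; rewrite normc_ge0.
Qed.

(** The loss in the exponent when the argument is shifted. Its size is
    immaterial, because exponents can be chosen small; so enorm is simply
    compared with the sum of the moduli of the coordinates. *)
Definition shift_cst : R := 2 `^ p * n.+1%:R `^ p.

Lemma shift_cst_gt0 : 0 < shift_cst.
Proof. by rewrite mulr_gt0// powR_gt0. Qed.

Lemma enorm_shift_le z w x : 0 <= x -> polydisc x w ->
  enorm (z + w) `^ p <= shift_cst * (enorm z `^ p + x `^ p).
Proof.
move=> x0 wx; have z0 := enorm_ge0 z.
apply: (@le_trans _ _ ((n.+1%:R * enorm z + n.+1%:R * x) `^ p)).
  apply: powR_le; first exact: enorm_ge0.
  apply: le_trans (enorm_le_sum _) _; rewrite -mulrDr.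
  apply: (@le_trans _ _ (\sum_(i < n) (enorm z + x))).
    apply: ler_sum => i _; rewrite mxE; apply: le_trans (le_normcD _ _) _.
    by rewrite lerD// coord_le_enorm.
  by rewrite sumr_const card_ord -[leLHS]mulr_natl ler_wpM2r ?addr_ge0// ler_nat.
apply: le_trans (powR_add_le _ _) _; rewrite ?mulr_ge0//.
by rewrite !powRM// -mulrDr /shift_cst mulrA.
Qed.

Definition weight_bounded tau f M :=
  forall z, normc (f z) <= M * expR (tau * enorm z `^ p).

Lemma weight_bounded_ge0 tau f M : weight_bounded tau f M -> 0 <= M.
Proof.
move=> /(_ 0) h; have : 0 <= M * expR (tau * enorm (0 : 'rV[R[i]]_n) `^ p).
  by apply: le_trans h; exact: normc_ge0.
by rewrite pmulr_lge0// expR_gt0.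
Qed.

Lemma weight_bounded_le tau t f M : tau <= t -> weight_bounded tau f M ->
  weight_bounded t f M.
Proof.
move=> tt fM z; apply: le_trans (fM z) _; rewrite ler_wpM2l ?(weight_bounded_ge0 fM)//.
by rewrite ler_expR ler_wpM2r ?powR_ge0.
Qed.

Lemma weight_bounded_shift tau f M z w x : 0 <= tau -> 0 <= x ->
  weight_bounded tau f M -> polydisc x w ->
  normc (f (z + w)) <= M * expR (tau * shift_cst * (enorm z `^ p + x `^ p)).
Proof.
move=> t0 x0 fM wx; apply: le_trans (fM _) _; rewrite ler_wpM2l ?(weight_bounded_ge0 fM)//.
by rewrite ler_expR -mulrA ler_wpM2l// enorm_shift_le.
Qed.

Lemma weight_bounded_lbounded tau f M : 0 <= tau ->
  weight_bounded tau f M -> locally_bounded f.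
Proof.
move=> t0 fM z; exists 1, (M * expR (tau * shift_cst * (enorm z `^ p + 2 `^ p))).
by split=> // w; rewrite mulr1 => wx; apply: weight_bounded_shift.
Qed.

(** Cauchy's estimate on a polydisc of radius r = s (m + 1) ^ (1/p), m = |al|. The
    weight on it costs a factor exp (m + 1), and r ^ m pays for the p-th root of
    m!. Large s are allowed when tau is small. *)
Lemma deriv_bound tau f M s z al : 0 < tau -> 0 < s -> entire f ->
  weight_bounded tau f M ->
  tau * shift_cst * (2 * s) `^ p <= 1 ->
  normc (mderiv al f z) * root_fact (mdeg al) <=
    8 ^+ n * M * expR 1 * expR (tau * shift_cst * enorm z `^ p) *
    normc (mfact al : R[i]) * (expR 1 / s) ^+ mdeg al.
Proof.
move=> t0 s0 fe fM ts; set m := mdeg al.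
have M0 := weight_bounded_ge0 fM.
(* m + 1 rather than m keeps the radius positive for m = 0 *)
pose q : R := m.+1%:R `^ p^-1.
have q0 : 0 < q by rewrite powR_gt0// ltr0n.
pose r := s * q.
have r0 : 0 < r by rewrite mulr_gt0.
have fle w : polydisc (2 * r) w -> normc (f (z + w)) <=
    M * (expR (tau * shift_cst * enorm z `^ p) * (expR 1 * expR 1 ^+ m)).
  move=> wr; have r20 : 0 <= 2 * r by rewrite mulr_ge0// ltW.
  apply: le_trans (weight_bounded_shift z (ltW t0) r20 fM wr) _.
  rewrite ler_wpM2l// mulrDr expRD ler_wpM2l ?expR_ge0//.
  rewrite -exprS -expRM_natl ler_expR mulr1 /r mulrA powRM ?mulr_ge0 ?(ltW s0) ?(ltW q0)//.
  by rewrite powR_invK// mulrA -[leRHS]mul1r ler_wpM2r.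
have ce := cauchy_estimate al r0 fe fle.
have fq : root_fact m <= q ^+ m.
  rewrite -powR_mulrn ?(ltW q0)// /q powRAC powR_mulrn//.
  apply: ge0_ler_powR; rewrite ?nnegrE ?invr_ge0 ?(ltW p0)//.
  by rewrite -natrX ler_nat fact_le_exp.
apply: le_trans (ler_wpM2r (ltW (root_fact_gt0 m)) ce) _.
have -> : 8 ^+ n * M * expR 1 * expR (tau * shift_cst * enorm z `^ p) *
    normc (mfact al : R[i]) * (expR 1 / s) ^+ m =
    8 ^+ n * (M * (expR (tau * shift_cst * enorm z `^ p) * (expR 1 * expR 1 ^+ m))) *
    normc (mfact al : R[i]) * r^-1 ^+ mdeg al * q ^+ m.
  rewrite -/m /r invfM !exprMn !exprVn; field.
  by rewrite !expf_neq0// gt_eqF.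
rewrite ler_wpM2l//.
apply: mulr_ge0; last by rewrite exprn_ge0// invr_ge0 ltW.
apply: mulr_ge0; last exact: normc_ge0.
apply: mulr_ge0; first by rewrite exprn_ge0.
by rewrite mulr_ge0// mulr_ge0 ?expR_ge0// mulr_ge0 ?exprn_ge0 ?expR_ge0.
Qed.

End weights.

(** * Continuity and norm estimates *)

Section Ap0_topology.
Context {R : realType} {n : nat} (p : R).
Local Notation A := (Ap0_space n p).
Implicit Types (f g x y : A) (tau M N d e : R) (h : 'rV[R[i]]_n -> R[i]).

Lemma weight_boundedP tau h M :
  weight_bounded p tau h M <-> (expnorm p tau h <= M%:E)%E.
Proof.
split=> [hM|hM z].
  apply: ge_ereal_sup => _ [z _ <-]; rewrite lee_fin mulNr expRN.
  by rewrite ler_pdivrMr ?expR_gt0.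
have : ((normc (h z) * expR (- tau * enorm z `^ p))%:E <= M%:E)%E.
  by apply: le_trans hM; apply: ereal_sup_ubound; exists z.
by rewrite lee_fin mulNr expRN ler_pdivrMr ?expR_gt0.
Qed.

Lemma weight_bounded_weaken tau t h M N : tau <= t -> M <= N ->
  weight_bounded p tau h M -> weight_bounded p t h N.
Proof.
move=> tt MN /(weight_bounded_le tt) hM z; apply: le_trans (hM z) _.
by rewrite ler_wpM2r ?expR_ge0.
Qed.

Lemma Ap0P h : (h \in Ap0 R n p) <->
  (entire h /\ forall tau, 0 < tau -> exists M, weight_bounded p tau h M).
Proof.
rewrite inE; split=> [hA|[he hw] tau /= t0].
  split=> [|tau t0]; first by have [] := hA 1 ltr01.
  have [_ /expnorm_ltyP[M hM]] := hA tau t0; exists M => z.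
  by have := hM z; rewrite mulNr expRN ler_pdivrMr ?expR_gt0.
split=> //; have [M hM] := hw tau t0.
by apply: le_lt_trans (_ : _ <= M%:E)%E _; [exact/weight_boundedP|rewrite ltry].
Qed.

Lemma Ap0_valP f : (f : 'rV[R[i]]_n -> R[i]) \in Ap0 R n p.
Proof. by case: f. Qed.

Definition Ap0_mk h (hA : h \in Ap0 R n p) : A := @MkAp0 R n p h hA.

Lemma Ap0_ext f g : (forall z, f z = g z) -> f = g.
Proof. by move=> fg; apply: val_inj; apply/funext. Qed.

Lemma Ap0_entire f : entire f.
Proof. by have /Ap0P[] := Ap0_valP f. Qed.

Lemma Ap0_weight_bounded f tau : 0 < tau -> exists M, weight_bounded p tau f M.
Proof. by have /Ap0P[_] := Ap0_valP f; apply. Qed.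

Lemma Ap0_valD f g z : (f + g) z = f z + g z :> R[i].
Proof. by rewrite -[LHS]/((val (f + g)) z) raddfD. Qed.

Lemma Ap0_valZ c f z : (c *: f) z = c * f z :> R[i].
Proof. by []. Qed.

Lemma Ap0_valN f z : (- f) z = - f z :> R[i].
Proof. by rewrite -[LHS]/((val (- f)) z) raddfN. Qed.

Lemma Ap0_valB f g z : (f - g) z = f z - g z :> R[i].
Proof. by rewrite Ap0_valD Ap0_valN. Qed.

Lemma Ap0_val0 z : (0 : A) z = 0 :> R[i].
Proof. by rewrite -[LHS]/((val (0 : A)) z) raddf0. Qed.

Lemma Ap0_val_sum (I : Type) (s : seq I) (F : I -> A) z :
  (\sum_(x <- s) F x) z = \sum_(x <- s) F x z :> R[i].
Proof.
elim: s => [|x s ih]; first by rewrite !big_nil Ap0_val0.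
by rewrite !big_cons Ap0_valD ih.
Qed.

Lemma expnorm_fin f tau : 0 < tau -> exists N, expnorm p tau f = N%:E.
Proof.
move=> t0; have [M /weight_boundedP fM] := Ap0_weight_bounded f t0.
have f0 : (0%:E <= expnorm p tau f)%E.
  apply: (@le_trans _ _ (normc (f 0) * expR (- tau * enorm (0 : 'rV[R[i]]_n) `^ p))%:E).
    by rewrite lee_fin mulr_ge0 ?normc_ge0 ?expR_ge0.
  by apply: ereal_sup_ubound; exists 0.
exists (fine (expnorm p tau f)); rewrite fineK// ge0_fin_numE//.
by apply: le_lt_trans fM _; rewrite ltry.
Qed.

Lemma in_ball g tau d f N : 0 < tau -> weight_bounded p tau (f - g) N ->
  N < d ->
  Ap0_ball (g, (tau, d)) f.
Proof. by move=> t0 /weight_boundedP fg Nd; rewrite /Ap0_ball/=; apply: le_lt_trans fg _;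
  rewrite lte_fin. Qed.

(** The triangle inequality for the norm with exponent tau. *)
Lemma ball_slack g tau d f : 0 < tau -> Ap0_ball (g, (tau, d)) f ->
  exists2 e, 0 < e & forall y, weight_bounded p tau (y - f) e -> Ap0_ball (g, (tau, d)) y.
Proof.
move=> t0; rewrite /Ap0_ball/=; have [N NE] := expnorm_fin (f - g) t0.
rewrite NE lte_fin => Nd; exists ((d - N) / 2); first by rewrite divr_gt0 ?subr_gt0.
move=> y yf; apply: (@in_ball g tau d y ((d - N) / 2 + N)) => //; last by lra.
move=> z; have -> : y - g = (y - f) + (f - g) :> A by rewrite addrA GRing.subrK.
rewrite Ap0_valD mulrDl.
apply: le_trans (le_normcD _ _) _; apply: lerD; first exact: yf.
by have /weight_boundedP : (expnorm p tau (f - g)%R <= N%:E)%E by rewrite NE.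
Qed.

Lemma ball_open b : 0 < b.2.1 -> 0 < b.2.2 -> open (@Ap0_ball R n p b).
Proof.
move=> b1 b2.
exists [set Ap0_ball b]; last by rewrite bigcup_set1.
move=> _ ->; apply: finI_from1; by split.
Qed.

(** A neighbourhood contains a finite intersection of balls of the subbase. *)
Lemma nbhs_balls f (B : set A) : nbhs f B ->
  exists2 s : seq (A * (R * R)), (forall b, b \in s ->
    [/\ 0 < b.2.1, 0 < b.2.2 & Ap0_ball b f]) &
    forall y, (forall b, b \in s -> Ap0_ball b y) -> B y.
Proof.
rewrite nbhsE => -[U [[D sD <-] [I DI If]] UB].
have [E sE IE] := sD I DI.
exists (enum_fset E) => [b bE|y yE].
  have /= := sE b bE; rewrite inE => -[b1 b2]; split=> //.
  by move: If; rewrite -IE; apply.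
by apply: UB; exists I => //; rewrite -IE; exact: yE.
Qed.

(** The preimage of a unit ball contains a finite intersection of balls around 0,
    hence, as the norms decrease in the exponent, one ball for the smallest
    exponent; homogeneity turns this into an estimate. *)
Lemma continuous_bound (F : {linear A -> A}) : continuous (F : A -> A) ->
  forall tau, 0 < tau -> exists C tau', [/\ 0 < C, 0 < tau' &
    forall f M, 0 < M -> weight_bounded p tau' f M -> weight_bounded p tau (F f) (C * M)].
Proof.
move=> Fc tau t0.
have B1 : nbhs (F 0) (Ap0_ball ((0 : A), (tau, 1))).
  apply: open_nbhs_nbhs; split; first exact: ball_open.
  apply: (@in_ball _ _ _ _ 0) => // z.
  by rewrite linear0 subrr Ap0_val0 normc0 mul0r.
have [s sP sF] := nbhs_balls (Fc 0 _ B1).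
have [t [d [t'0 d0 td]]] : exists t d, [/\ 0 < t, 0 < d &
    forall y, weight_bounded p t y d -> forall b, b \in s -> Ap0_ball b y].
  elim: s {sF} sP => [|b s ih] sP; first by exists 1, 1.
  have [|t [d [t'0 d0 td]]] := ih; first by move=> b' b's; apply: sP; rewrite inE b's orbT.
  have [b1 b2 b0] := sP b (mem_head _ _).
  case: b b1 b2 b0 sP => g [tb db] /= b1 b2 b0 sP.
  have [e e0 eP] := ball_slack b1 b0.
  exists (Num.min t tb), (Num.min d e); split; rewrite ?lt_min ?t'0 ?d0//.
  move=> y yw b'; rewrite inE => /predU1P[->|]; last first.
    by apply: td; apply: weight_bounded_weaken yw; rewrite ge_min lexx.
  by apply: eP; rewrite subr0; apply: weight_bounded_weaken yw; rewrite ge_min lexx orbT.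
exists d^-1, t; split; rewrite ?invr_gt0// => f M M0 fM z.
pose c : R[i] := (d / M)%:C.
have cn0 : normc c = d / M by rewrite normc_real ger0_norm// divr_ge0// ltW.
have : Ap0_ball ((0 : A), (tau, 1)) (F (c *: f)).
  apply: sF; apply: td => w; rewrite Ap0_valZ normcM cn0.
  rewrite mulrAC ler_pdivrMr// -mulrA ler_wpM2l ?(ltW d0)// mulrC.
  exact: fM.
rewrite /Ap0_ball/= subr0 => /ltW/weight_boundedP/(_ z).
rewrite linearZ Ap0_valZ normcM cn0 mul1r mulrAC ler_pdivrMr// => h.
by rewrite -mulrA ler_pdivlMl// [M * _]mulrC.
Qed.

Lemma bound_continuous (F : {linear A -> A}) :
  (forall tau, 0 < tau -> exists C tau', [/\ 0 < C, 0 < tau' &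
    forall f M, 0 < M -> weight_bounded p tau' f M ->
      weight_bounded p tau (F f) (C * M)]) ->
  continuous (F : A -> A).
Proof.
move=> Fb x B /nbhs_balls[s sP sB].
suff : nbhs x [set y | forall b, b \in s -> Ap0_ball b (F y)].
  by apply: filterS => y /= yP; apply: sB.
elim: s {sB} sP => [|b s ih] sP; first exact: filterE.
have {}ih := ih (fun b' b's => sP b' (mem_behead (s := b :: s) b's)).
have [b1 b2 b0] := sP b (mem_head _ _).
case: b b1 b2 b0 sP => g [tb db] /= b1 b2 b0 sP.
have [e e0 eP] := ball_slack b1 b0.
have [C [t [C0 t0 CP]]] := Fb tb b1.
have Bx : nbhs x (Ap0_ball (x, (t, e / C))).
  apply: open_nbhs_nbhs; split; first by apply: ball_open => //=; rewrite divr_gt0.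
  apply: (@in_ball _ _ _ _ 0) => //; last by rewrite divr_gt0.
  by move=> z; rewrite subrr Ap0_val0 normc0 mul0r.
apply: filterS (filterI Bx ih) => y [/= yB yP] b; rewrite inE => /predU1P[->|];
  last exact: yP.
apply: eP; rewrite -linearB.
have -> : e = C * (e / C) by field; rewrite gt_eqF.
by apply: CP; [rewrite divr_gt0|exact/weight_boundedP/ltW].
Qed.

End Ap0_topology.

(** * From symbols to operators *)

Section direct.
Context {R : realType} {n : nat} (p : R) (p0 : 0 < p).
Local Notation A := (Ap0_space n p).
Implicit Types (al be : mindex n) (tau M : R) (z w : 'rV[R[i]]_n).
Implicit Types (f g : 'rV[R[i]]_n -> R[i]) (P : foperator R n).

(** The root of m! in deriv_bound makes up for its absence in the bound on the
    coefficients, and al! <= m! for m = |al|. There remains (B e / s) ^ m, which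
    is 4^-m for s = 4 B e. *)
Lemma term_geom_bounded P : P \in Dp0 R n p -> forall tau, 0 < tau ->
  exists C t, [/\ 0 < C, 0 < t & forall f M, entire f -> weight_bounded p t f M ->
    forall z, geom_bounded (C * M * expR (tau * enorm z `^ p)) (op_term P f z)].
Proof.
rewrite inE => -[Pe Pb] tau t0.
have c0 := @shift_cst_gt0 R n p.
have t20 : 0 < tau / 2 by rewrite divr_gt0.
have [B B0 BP] := Pb _ t20.
pose s := 4 * B * expR 1; have s0 : 0 < s by rewrite mulr_gt0 ?expR_gt0// mulr_gt0.
pose k := @shift_cst R n p * (2 * s) `^ p.
have k0 : 0 < k by rewrite mulr_gt0// powR_gt0// mulr_gt0.
(* The first bound is the hypothesis of deriv_bound; the second one leaves half
   of tau to the growth of the coefficients. *)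
pose t := Num.min k^-1 (tau / 2 / @shift_cst R n p).
have t1 : 0 < t by rewrite lt_min invr_gt0 k0 !divr_gt0.
have tk : t * @shift_cst R n p * (2 * s) `^ p <= 1.
  by rewrite -mulrA -/k -ler_pdivlMr// div1r ge_min lexx.
have tc : t * @shift_cst R n p <= tau / 2 by rewrite -ler_pdivlMr// ge_min lexx orbT.
exists (B * 8 ^+ n * expR 1), t; split=> //.
  by rewrite !mulr_gt0 ?expR_gt0 ?exprn_gt0.
move=> f M fe fM z al; have M0 := weight_bounded_ge0 fM; set m := mdeg al.
have F0 := root_fact_gt0 p m.
have f0 : (0 : R) < m`!%:R by rewrite ltr0n fact_gt0.
have D := deriv_bound p0 z al t1 s0 fe fM tk; rewrite -/m in D.
have := BP z al; rewrite fact_powR invf_div -/m => Pz.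
rewrite normcM.
have E1 : expR (t * @shift_cst R n p * enorm z `^ p) <= expR (tau / 2 * enorm z `^ p).
  by rewrite ler_expR ler_wpM2r ?powR_ge0.
have PD : normc (P al z) * normc (mderiv al f z) <=
    B ^+ m.+1 * (root_fact p m / m`!%:R) * expR (tau / 2 * enorm z `^ p) *
      normc (mderiv al f z).
  by rewrite ler_wpM2r ?normc_ge0.
apply: le_trans PD _.
set e2 := expR (tau / 2 * enorm z `^ p) in Pz E1 *.
have e20 : 0 <= e2 := expR_ge0 _.
have -> : B ^+ m.+1 * (root_fact p m / m`!%:R) * e2 * normc (mderiv al f z) =
   (B ^+ m.+1 / m`!%:R * e2) * (normc (mderiv al f z) * root_fact p m).
  by move: (normc _) => u; ring.
have K0 : 0 <= B ^+ m.+1 / m`!%:R * e2.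
  by rewrite mulr_ge0// divr_ge0 ?exprn_ge0 ?(ltW f0)// ltW.
apply: le_trans (ler_wpM2l K0 D) _.
have Z0 : 0 <= 8 ^+ n * M * expR 1 by rewrite mulr_ge0 ?expR_ge0// mulr_ge0 ?exprn_ge0.
have X0 : 0 <= (expR 1 / s) ^+ m by rewrite exprn_ge0// divr_ge0 ?expR_ge0 ?(ltW s0).
have -> : expR (tau * enorm z `^ p) = e2 * e2.
  by rewrite /e2 -expRD -mulrDl -splitr.
have -> : B * 8 ^+ n * expR 1 * M * (e2 * e2) * 4^-1 ^+ m =
   (B ^+ m.+1 / m`!%:R * e2) * (8 ^+ n * M * expR 1 * e2 * m`!%:R * (expR 1 / s) ^+ m).
  have -> : expR 1 / s = 4^-1 / B.
    by rewrite /s; field; rewrite (gt_eqF B0)/= gt_eqF// expR_gt0.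
  rewrite exprMn [B^-1 ^+ m]exprVn exprS; field.
  by rewrite (gt_eqF f0)/= expf_neq0// gt_eqF.
apply: ler_wpM2l => //; apply: ler_wpM2r => //.
apply: ler_pM; rewrite ?normc_ge0 ?mfact_le//.
  by rewrite mulr_ge0 ?expR_ge0.
by rewrite ler_wpM2l.
Qed.

Lemma entire_lbounded f : f \in Ap0 R n p -> locally_bounded f.
Proof. by move=> /Ap0P[_ /(_ 1 ltr01)[M fM]];
  apply: (weight_bounded_lbounded p0 ler01 fM). Qed.

Lemma op_weight_bounded P f tau C t M : entire f -> weight_bounded p t f M ->
  (forall z, geom_bounded (C * M * expR (tau * enorm z `^ p)) (op_term P f z)) ->
  weight_bounded p tau (op_apply P f) (2 ^+ n * C * M).
Proof.
move=> fe fM G z; apply: le_trans (usum_le (G z)) _.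
by rewrite le_eqVlt; apply/orP; left; apply/eqP; ring.
Qed.

Lemma Dp0_op_cvg P f : P \in Dp0 R n p -> f \in Ap0 R n p -> op_cvg P f.
Proof.
move=> hP /Ap0P[fe fw] z; have [C [t [_ t0 H]]] := term_geom_bounded hP ltr01.
have [M fM] := fw t t0; exact: geom_bounded_summable (H f M fe fM z).
Qed.

Lemma op_Ap0 P f : P \in Dp0 R n p -> f \in Ap0 R n p ->
  op_apply P f \in Ap0 R n p.
Proof.
move=> hP fA; have fl := entire_lbounded fA; have /Ap0P[fe fw] := fA.
apply/Ap0P; split=> [z|tau t0]; last first.
  have [C [t [_ t1 H]]] := term_geom_bounded hP t0; have [M fM] := fw t t1.
  by exists (2 ^+ n * C * M); apply: (op_weight_bounded fe fM) => z; exact: H.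
have [C [t [C0 t0 H]]] := term_geom_bounded hP ltr01; have [M fM] := fw t t0.
have M0 := weight_bounded_ge0 fM.
apply: (@weierstrass _ _ (fun al z => op_term P f z al) z 1
  (C * M * expR (1 * (@shift_cst R n p * (enorm z `^ p + 2 `^ p)))) ltr01).
  move=> al w; apply: differentiableM; last exact: entire_mderiv.
  by move: hP; rewrite inE => -[Pe _]; exact: Pe.
move=> al w; rewrite mulr1 => wr; apply: le_trans (H f M fe fM _ al) _.
apply: ler_wpM2r; first by rewrite exprn_ge0.
apply: ler_wpM2l; first by rewrite mulr_ge0// ltW.
by rewrite ler_expR !mul1r enorm_shift_le.
Qed.

Lemma power_series_lin r K M f g (c d : mindex n -> R[i]) a : 0 < r ->
  power_series r K f c -> power_series r M g d ->
  power_series r (normc a * K + M) (fun z => a * f z + g z) (fun al => a * c al + d al).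
Proof.
move=> r0 [cK fE] [dM gE]; split=> [al|z zr].
  rewrite mulrDl; apply: le_trans (le_normcD _ _) _; apply: lerD => //.
  by rewrite normcM -mulrA ler_wpM2l ?normc_ge0.
have Gc := power_series_geom_bounded r0 cK zr;
  have Gd := power_series_geom_bounded r0 dM zr.
rewrite fE// gE// -(usum_Z a Gc) -(usum_D (geom_bounded_Z a Gc) Gd).
by apply: usum_ext => al; ring.
Qed.

(** Taylor series at z can be added; mderiv0 reads off the derivatives. *)
Lemma mderiv_lin f g a al z : f \in Ap0 R n p -> g \in Ap0 R n p ->
  mderiv al (fun w => a * f w + g w) z = a * mderiv al f z + mderiv al g z.
Proof.
move=> /Ap0P[fe /(_ 1 ltr01)[M fM]] /Ap0P[ge /(_ 1 ltr01)[N gN]].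
have b2 h K : weight_bounded p 1 h K -> forall w, polydisc (2 * 1) w -> normc (h (z + w)) <=
    K * expR (1 * @shift_cst R n p * (enorm z `^ p + 2 `^ p)).
  by move=> hK w; rewrite mulr1 => wr; apply: weight_bounded_shift.
have Pf := taylor_power_series ltr01 fe (b2 _ _ fM).
have Pg := taylor_power_series ltr01 ge (b2 _ _ gN).
have PL := power_series_lin a ltr01 Pf Pg.
have PN : taylor_series (fun w => a * f (z + w) + g (z + w))
    (fun al => a * mderiv al f z + mderiv al g z).
  exists 1; eexists; split=> //; congr (power_series _ _ _ _) : PL.
  by apply/funext => be; ring.
have := mderiv0 al PN.
have := @mderiv_shift _ _ (fun w => a * f w + g w) al z => /(congr1 (fun h => h 0)) -> /=.
by rewrite addr0.
Qed.

Section operator.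
Context (P : foperator R n) (hP : P \in Dp0 R n p).

Definition op_map (f : A) : A := Ap0_mk (op_Ap0 hP (Ap0_valP f)).

Lemma op_map_linear : linear op_map.
Proof.
move=> a f g; apply: Ap0_ext => z; rewrite Ap0_valD Ap0_valZ /=.
have [C [t [_ t0 H]]] := term_geom_bounded hP ltr01.
have [M fM] := Ap0_weight_bounded f t0; have [N gN] := Ap0_weight_bounded g t0.
have Gf := H f M (Ap0_entire f) fM z; have Gg := H g N (Ap0_entire g) gN z.
rewrite /op_apply -/(usum _) -/(usum (op_term P f z)) -/(usum (op_term P g z)).
rewrite -(usum_Z a Gf) -(usum_D (geom_bounded_Z a Gf) Gg); apply: usum_ext => al.
rewrite /op_term.
have -> : mderiv al (a *: f + g : A) z = a * mderiv al f z + mderiv al g z.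
  by rewrite -(mderiv_lin a al z (Ap0_valP f) (Ap0_valP g)).
by ring.
Qed.

HB.instance Definition _ := GRing.isLinear.Build R[i] A A _ op_map op_map_linear.

Lemma op_map_continuous : continuous (op_map : A -> A).
Proof.
apply: (@bound_continuous _ _ p op_map) => tau t0.
have [C [t [C0 t1 H]]] := term_geom_bounded hP t0.
exists (2 ^+ n * C), t; split=> //; first by rewrite mulr_gt0// exprn_gt0.
move=> f M M0 fM; apply: (op_weight_bounded (Ap0_entire f) fM).
exact: (H f M (Ap0_entire f) fM).
Qed.

End operator.

End direct.

(** * From operators to symbols *)

Section converse.
Context {R : realType} {n : nat} (p : R) (p0 : 0 < p).
Local Notation A := (Ap0_space n p).
Implicit Types (al be : mindex n) (tau M : R) (z w : 'rV[R[i]]_n) (i : 'I_n).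
Implicit Types (f g : 'rV[R[i]]_n -> R[i]) (P : foperator R n) (u v : A).

Lemma entire_coord i (c : R[i]) : entire (fun w : 'rV[R[i]]_n => w 0 i - c).
Proof.
move=> z; apply: (@differentiableB _ _ _ (fun w : 'rV[R[i]]_n => w 0 i) (cst c)).
  exact: differentiable_coord.
exact: differentiable_cst.
Qed.

Lemma mul_Ap0 i (c : R[i]) u : (fun w => (w 0 i - c) * u w) \in Ap0 R n p.
Proof.
apply/Ap0P; split=> [z|tau t0].
  by apply: differentiableM; [exact: entire_coord|exact: Ap0_entire].
have t20 : 0 < tau / 2 by rewrite divr_gt0.
have [B B0 BP] := pow_le_expR p0 t20.
have [M uM] := Ap0_weight_bounded u t20.
exists ((B ^+ 1 * root_fact p 1 + normc c) * M) => w.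
set e2 := expR (tau / 2 * enorm w `^ p).
have -> : expR (tau * enorm w `^ p) = e2 * e2 by rewrite /e2 -expRD -mulrDl -splitr.
have e21 : 1 <= e2.
  apply: le_trans (expR_ge1Dx _); rewrite lerDl mulr_ge0 ?powR_ge0//.
  by rewrite divr_ge0 ?ltW.
have e20 : 0 <= e2 := expR_ge0 _.
rewrite normcM mulrACA; apply: (ler_pM (normc_ge0 _) (normc_ge0 _) _ (uM w)).
apply: le_trans (le_normcB _ _) _; rewrite mulrDl lerD//.
  apply: le_trans (coord_le_enorm _ _) _.
  by have := BP (enorm w) 1%N (enorm_ge0 w); rewrite expr1.
by rewrite -[leLHS]mulr1 ler_wpM2l ?normc_ge0.
Qed.

Lemma one_Ap0 : (cst 1 : 'rV[R[i]]_n -> R[i]) \in Ap0 R n p.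
Proof.
apply/Ap0P; split=> [z|tau t0]; first exact: differentiable_cst.
exists 1 => z; rewrite normc1 mul1r; apply: le_trans (expR_ge1Dx _).
by rewrite lerDl mulr_ge0 ?powR_ge0 ?ltW.
Qed.

Definition Ap0_one : A := Ap0_mk one_Ap0.
Definition mul_coord i (c : R[i]) u : A := Ap0_mk (mul_Ap0 i c u).

(** The product of u with all w_i - z_i for i in s, as a function of w. Building it
    from multiplications keeps every intermediate function in the space. *)
Definition mul_shifts (s : seq 'I_n) z u : A :=
  foldl (fun v i => mul_coord i (z 0 i) v) u s.

Lemma mul_shiftsE s z u w :
  mul_shifts s z u w = (\prod_(i <- s) (w 0 i - z 0 i)) * u w.
Proof.
elim: s u => [|i s ih] u /=; first by rewrite big_nil mul1r.
by rewrite ih /= big_cons mulrA [_ * (w 0 i - _)]mulrC.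
Qed.

Definition mindex_seq al : seq 'I_n :=
  flatten [seq nseq (al i) i | i <- enum 'I_n].

Definition shifted_monomial z al : A := mul_shifts (mindex_seq al) z Ap0_one.

Lemma shifted_monomialE z al w : shifted_monomial z al w = zpow (w - z) al.
Proof.
rewrite mul_shiftsE mulr1 big_flatten /= big_map big_enum /=; apply: eq_bigr => i _.
by rewrite !mxE; elim: (al i) => [|k ih]; rewrite ?big_nil// big_cons ih exprS.
Qed.

Section functional.
Context (F : {linear A -> A}).

(** As F ((w_i - z_i) v) = F (w_i v) - z_i F v, the argument of F can be freed from
    z one factor at a time; the factors w_i go to u. *)
Lemma entire_eval_mul_shifts s u : entire (fun z => F (mul_shifts s z u) z).
Proof.
elim: s u => [|i s ih] u /=; first exact: Ap0_entire.
have -> : (fun z => F (mul_shifts s z (mul_coord i (z 0 i) u)) z) =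
    (fun z => F (mul_shifts s z (mul_coord i 0 u)) z) - (fun z => (z 0 i - 0) *
      F (mul_shifts s z u) z).
  apply/funext => z; rewrite !fctE.
  have -> : mul_shifts s z (mul_coord i (z 0 i) u) =
    mul_shifts s z (mul_coord i 0 u) - (z 0 i - 0) *: mul_shifts s z u.
    by apply: Ap0_ext => w; rewrite Ap0_valB Ap0_valZ !mul_shiftsE/=; ring.
  by rewrite linearB linearZ Ap0_valB Ap0_valZ.
move=> z; apply: differentiableB; first exact: ih.
by apply: differentiableM; [exact: entire_coord|exact: ih].
Qed.

(** The only possible choice, by op_apply_shifted_monomial. *)
Definition symbol : foperator R n :=
  fun al z => F (shifted_monomial z al) z / mfact al.

(** |w - z| ^ m <= 2 ^ m (|w| ^ m + |z| ^ m), and pow_le_expR bounds both powers. *)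
Lemma shifted_monomial_bound t : 0 < t -> exists2 B, 0 < B & forall z al,
  weight_bounded p t (shifted_monomial z al) (2 * B ^+ mdeg al * root_fact p (mdeg al) *
    expR (t * enorm z `^ p)).
Proof.
move=> t0; have [B B0 BP] := pow_le_expR p0 t0.
exists (2 * B); first by rewrite mulr_gt0.
move=> z al w; rewrite shifted_monomialE; set m := mdeg al.
have z0 := enorm_ge0 z; have w0 := enorm_ge0 w.
apply: (@le_trans _ _ ((enorm w + enorm z) ^+ m)).
  apply: zpow_le => i; rewrite !mxE; apply: le_trans (le_normcB _ _) _.
  by rewrite lerD// coord_le_enorm.
have h (x y : R) : 0 <= x -> x <= y -> (x + y) ^+ m <= 2 ^+ m * (x ^+ m + y ^+ m).
  move=> x0 xy; apply: (@le_trans _ _ ((2 * y) ^+ m)).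
    by apply: lerXn2r; rewrite ?nnegrE; lra.
  by rewrite exprMn ler_wpM2l ?exprn_ge0// lerDr exprn_ge0.
have : (enorm w + enorm z) ^+ m <= 2 ^+ m * (enorm w ^+ m + enorm z ^+ m).
  case: (leP (enorm w) (enorm z)) => [wz|/ltW zw]; first exact: h.
  by rewrite addrC [enorm w ^+ m + _]addrC; exact: h.
move=> /le_trans; apply.
set a := expR (t * enorm z `^ p); set b := expR (t * enorm w `^ p).
have a1 : 1 <= a.
  by apply: le_trans (expR_ge1Dx _); rewrite lerDl mulr_ge0 ?powR_ge0 ?ltW.
have b1 : 1 <= b.
  by apply: le_trans (expR_ge1Dx _); rewrite lerDl mulr_ge0 ?powR_ge0 ?ltW.
have K0 : 0 <= B ^+ m * root_fact p m.
  by rewrite mulr_ge0 ?(ltW (root_fact_gt0 p m))// exprn_ge0 ?ltW.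
have p2 : 0 <= 2 ^+ m :> R by rewrite exprn_ge0.
have h1 : enorm z ^+ m <= B ^+ m * root_fact p m * a := BP _ m z0.
have h2 : enorm w ^+ m <= B ^+ m * root_fact p m * b := BP _ m w0.
apply: (@le_trans _ _ (2 ^+ m * ((B ^+ m * root_fact p m) * b + (B ^+ m *
  root_fact p m) * a))).
  exact: (ler_wpM2l p2 (lerD h2 h1)).
rewrite exprMn.
have -> : 2 * (2 ^+ m * B ^+ m) * root_fact p m * a * b =
   2 ^+ m * ((B ^+ m * root_fact p m) * (2 * a * b)) by ring.
apply: (ler_wpM2l p2).
have ab : b + a <= 2 * a * b.
  by move: a1 b1; move: (a) (b) => x y x1 y1; nra.
by have := ler_wpM2l K0 ab; rewrite [X in X <= _]mulrDr.
Qed.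

Lemma mderiv_shifted_monomial z al be :
  mderiv be (shifted_monomial z al) z = if be == al then mfact al else 0.
Proof.
have PN : taylor_series (fun w => shifted_monomial z al (z + w))
  (fun be => if be == al then mfact al else 0).
  exists 1, 1; split=> //; split=> [ga|w wr].
    rewrite invr1 expr1n mulr1; case: eqP => [->|_]; last by rewrite mul0r normc0.
    by rewrite divff ?mfact_neq0// normc1.
  rewrite shifted_monomialE addrC addKr.
  have H := @has_usum_fset1 _ _ (fun ga =>
    (if ga == al then mfact al else 0) / mfact ga * zpow w ga) al.
  rewrite (has_usumE (H _)) => [|ga /negbTE ->]; last by rewrite !mul0r.
  by rewrite eqxx divff ?mfact_neq0// mul1r.
have := mderiv0 be PN.
have := @mderiv_shift _ _ (shifted_monomial z al) be z => /(congr1 (fun h => h 0)) -> /=.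
by rewrite addr0.
Qed.

(** At z, the only nonzero derivative of (w - z) ^ al is the one of order al. *)
Lemma op_apply_shifted_monomial P z al :
  op_apply P (shifted_monomial z al) z = P al z * mfact al.
Proof.
have H := @has_usum_fset1 _ _ (op_term P (shifted_monomial z al) z) al.
rewrite /op_apply -/(usum _) (has_usumE (H _)) => [|be /negbTE ba].
  by rewrite /op_term mderiv_shifted_monomial eqxx.
by rewrite /op_term mderiv_shifted_monomial ba mulr0.
Qed.

Context (Fc : continuous (F : A -> A)).

(** Continuity bounds F((w - z)^al) by a norm of (w - z)^al, and dividing the
    root of m! in shifted_monomial_bound by al! gives m! ^ (1/p - 1) up to a
    power of 2 ^ n. *)
Lemma symbol_Dp0 : symbol \in Dp0 R n p.
Proof.
rewrite inE; split=> [al z|eps e0].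
  apply: (@differentiableM _ _ (fun z => F (shifted_monomial z al) z) (cst (mfact al)^-1)).
    exact: entire_eval_mul_shifts.
  exact: differentiable_cst.
have e20 : 0 < eps / 2 by rewrite divr_gt0.
have [C [t' [C0 t'0 CP]]] := continuous_bound Fc e20.
(* The norm of the monomial grows with z like exp (t |z| ^ p), so t has to be
   small as well. *)
pose t := Num.min t' (eps / 2).
have t0 : 0 < t by rewrite lt_min t'0 e20.
have tt' : t <= t' by rewrite ge_min lexx.
have te : t <= eps / 2 by rewrite ge_min lexx orbT.
have [B B0 BP] := shifted_monomial_bound t0.
have D0 : 0 < 2 * C + B * 2 ^+ n by rewrite addr_gt0// mulr_gt0// exprn_gt0.
exists (2 * C + B * 2 ^+ n) => // z al.
rewrite fact_powR invf_div; set m := mdeg al.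
have F0 := root_fact_gt0 p m.
have f0 : (0 : R) < m`!%:R by rewrite ltr0n fact_gt0.
have mf0 : 0 < normc (mfact al : R[i]) by rewrite normc_mfact mfact_gt0.
set Mq := 2 * B ^+ m * root_fact p m * expR (t * enorm z `^ p).
have Mq0 : 0 < Mq.
  rewrite mulr_gt0 ?expR_gt0// mulr_gt0// mulr_gt0// exprn_gt0//.
have FM := CP (shifted_monomial z al) Mq Mq0 (weight_bounded_le tt' (BP z al)) z.
rewrite /symbol normcM normcV ler_pdivrMr//.
apply: le_trans FM _.
set e2 := expR (eps / 2 * enorm z `^ p).
have -> : expR (eps * enorm z `^ p) = e2 * e2 by rewrite /e2 -expRD -mulrDl -splitr.
have e20' : 0 <= e2 := expR_ge0 _.
have Mqe : Mq <= 2 * B ^+ m * root_fact p m * e2.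
  by rewrite ler_wpM2l ?mulr_ge0 ?exprn_ge0 ?(ltW B0) ?(ltW F0)// ler_expR ler_wpM2r ?powR_ge0.
apply: (@le_trans _ _ (C * (2 * B ^+ m * root_fact p m * e2) * e2)).
  by rewrite ler_wpM2r// ler_wpM2l// ltW.
have pw : 2 * C * (B * 2 ^+ n) ^+ m <= (2 * C + B * 2 ^+ n) ^+ m.+1.
  have C20 : 0 <= 2 * C by rewrite mulr_ge0// ltW.
  have Bn0 : 0 <= B * 2 ^+ n by rewrite mulr_ge0 ?exprn_ge0// ltW.
  rewrite exprS; apply: ler_pM => //; first by rewrite exprn_ge0.
    by rewrite lerDl.
  by apply: lerXn2r; rewrite ?nnegrE ?addr_ge0// lerDr.
have lm := @le_mfact R n al; rewrite -/m in lm.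
apply: (@le_trans _ _ (2 * C * (B * 2 ^+ n) ^+ m * (root_fact p m / m`!%:R) * (e2 * e2) *
    normc (mfact al : R[i]))); last first.
  rewrite ler_wpM2r ?normc_ge0// ler_wpM2r ?mulr_ge0// ler_wpM2r//.
  by rewrite divr_ge0 ?ltW.
have -> : C * (2 * B ^+ m * root_fact p m * e2) * e2 =
   2 * C * B ^+ m * root_fact p m * (e2 * e2) / m`!%:R * m`!%:R.
  by field; rewrite gt_eqF.
have -> : 2 * C * (B * 2 ^+ n) ^+ m * (root_fact p m / m`!%:R) * (e2 * e2) *
  normc (mfact al : R[i]) =
   2 * C * B ^+ m * root_fact p m * (e2 * e2) / m`!%:R * ((2 ^+ n) ^+ m *
     normc (mfact al : R[i])).
  by rewrite exprMn; ring.
apply: ler_wpM2l lm.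
rewrite divr_ge0 ?(ltW f0)// mulr_ge0 ?mulr_ge0 ?(ltW F0) ?(ltW C0)//.
by rewrite exprn_ge0 ?ltW.
Qed.

(** The Taylor series of f at z converges to f in all the norms: by deriv_bound and
    shifted_monomial_bound its terms are dominated by 4^-|al|. So F can be applied
    to it term by term, and the value at z is the series defining the operator. *)
Lemma symbol_represents (f : A) z : F f z = op_apply symbol f z.
Proof.
have [C [t [C0 t0 CP]]] := continuous_bound Fc ltr01.
have [B B0 BP] := shifted_monomial_bound t0.
have c0 := @shift_cst_gt0 R n p.
pose s := 4 * B * expR 1; have s0 : 0 < s by rewrite mulr_gt0 ?expR_gt0// mulr_gt0.
pose k := @shift_cst R n p * (2 * s) `^ p.
have k0 : 0 < k by rewrite mulr_gt0// powR_gt0// mulr_gt0.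
pose t1 := k^-1.
have t10 : 0 < t1 by rewrite invr_gt0.
have tk : t1 * @shift_cst R n p * (2 * s) `^ p <= 1.
  by rewrite -mulrA -/k mulVf ?gt_eqF.
have [M fM] := Ap0_weight_bounded f t10; have M0 := weight_bounded_ge0 fM.
pose b al := mderiv al f z / mfact al.
pose X := 8 ^+ n * M * expR 1 * expR (t1 * @shift_cst R n p * enorm z `^ p).
have X0 : 0 <= X.
  by rewrite mulr_ge0 ?expR_ge0// mulr_ge0 ?expR_ge0// mulr_ge0 ?exprn_ge0.
pose ez := expR (t * enorm z `^ p).
have ez0 : 0 <= ez := expR_ge0 _.
(* the summand 1 makes K positive, as continuous_bound requires *)
pose K := 2 * X * ez + 1.
have Dz al : normc (mderiv al f z) * root_fact p (mdeg al) <=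
    X * normc (mfact al : R[i]) * (expR 1 / s) ^+ mdeg al.
  exact: (deriv_bound p0 z al t10 s0 (Ap0_entire f) fM tk).
have K0 : 0 < K by rewrite ltr_wpDl// mulr_ge0// mulr_ge0.
have bgeo w : geom_bounded (K * expR (t * enorm w `^ p)) (fun al => b al *
  shifted_monomial z al w).
  move=> al; rewrite normcM; set m := mdeg al.
  have F0 := root_fact_gt0 p m.
  have mf0 : 0 < normc (mfact al : R[i]) by rewrite normc_mfact mfact_gt0.
  have Db : normc (b al) * root_fact p m <=
      X * (expR 1 / s) ^+ m.
    rewrite /b normcM normcV mulrAC ler_pdivrMr//.
    by apply: le_trans (Dz al) _; rewrite -/m mulrAC.
  apply: le_trans (ler_wpM2l (normc_ge0 _) (BP z al w)) _; rewrite -/m.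
  pose ew := expR (t * enorm w `^ p); rewrite -/ez -/ew.
  have ew0 : 0 <= ew := expR_ge0 _.
  have -> : normc (b al) * (2 * B ^+ m * root_fact p m * ez * ew) =
     normc (b al) * root_fact p m * (2 * B ^+ m * ez * ew) by ring.
  have L0 : 0 <= 2 * B ^+ m * ez * ew.
    have Bm0 : 0 <= B ^+ m by rewrite exprn_ge0 ?(ltW B0).
    exact: (mulr_ge0 (mulr_ge0 (mulr_ge0 (ler0n _ 2) Bm0) ez0) ew0).
  apply: le_trans (ler_wpM2r L0 Db) _.
  have -> : X * (expR 1 / s) ^+ m * (2 * B ^+ m * ez * ew) = 2 * X * ez * ew * 4^-1 ^+ m.
    have -> : expR 1 / s = 4^-1 / B.
      by rewrite /s; field; rewrite (gt_eqF B0)/= gt_eqF// expR_gt0.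
    by rewrite exprMn [B^-1 ^+ m]exprVn; field; rewrite expf_neq0// gt_eqF.
  have p4 : 0 <= (4^-1 : R) ^+ m by rewrite exprn_ge0.
  have XK : 2 * X * ez <= K by rewrite lerDl.
  exact: (ler_wpM2r p4 (ler_wpM2r ew0 XK)).
have fE w : f w = usum (fun al => b al * shifted_monomial z al w).
  pose r := 4 * (1 + enorm (w - z)).
  have r0 : 0 < r by rewrite mulr_gt0// ltr_pwDl// enorm_ge0.
  have r20 : 0 <= 2 * r by rewrite mulr_ge0// ltW.
  have [_ /(_ (w - z))] := taylor_power_series r0 (Ap0_entire f)
    (fun x xr => weight_bounded_shift p0 z (ltW t10) r20 fM xr).
  have -> : z + (w - z) = w by rewrite addrC subrK.
  move=> ->.
    by apply: usum_ext => al; rewrite shifted_monomialE.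
  move=> i; apply: le_trans (coord_le_enorm _ _) _; rewrite /r.
  by have := enorm_ge0 (w - z); lra.
have hC := symbol_Dp0.
have [C' [t'' [_ t''0 GH]]] := term_geom_bounded p0 hC ltr01.
have [M' fM'] := Ap0_weight_bounded f t''0.
have Gop := GH _ _ (Ap0_entire f) fM' z.
apply/esym; rewrite /op_apply -/(usum _).
apply: (@usum_box _ _ _ _ _ (C * (4 * K * 2 ^+ n) * expR (1 * enorm z `^ p)) Gop) => N.
pose S : A := \sum_(al <- box n N) b al *: shifted_monomial z al.
have SE w : S w = fsum (fun al => b al * shifted_monomial z al w) (box n N).
  by rewrite Ap0_val_sum; apply: eq_bigr => al _; rewrite Ap0_valZ.
have FS : F S z = fsum (op_term symbol f z) (box n N).
  rewrite /S linear_sum Ap0_val_sum; apply: eq_bigr => al _.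
  by rewrite linearZ Ap0_valZ /op_term /symbol /b; ring.
rewrite -FS normcB -Ap0_valB -linearB.
have L0 : 0 < 4 * K * 2 ^+ n * 2^-1 ^+ N by rewrite !mulr_gt0 ?exprn_gt0 ?invr_gt0.
have W : weight_bounded p t (f - S) (4 * K * 2 ^+ n * 2^-1 ^+ N).
  move=> w; rewrite Ap0_valB SE fE normcB.
  apply: le_trans (geom_bounded_usum_tail (bgeo w) (fsubset_refl _)) _.
  by rewrite le_eqVlt; apply/orP; left; apply/eqP; ring.
apply: le_trans (CP _ _ L0 W z) _.
by rewrite le_eqVlt; apply/orP; left; apply/eqP; ring.
Qed.

End functional.

End converse.

Local Close Scope complex_scope.
Unset Implicit Arguments.

Theorem theorem4p2 (R : realType) (n : nat) (p : R) (hn : (1 <= n)%N)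
    (hp : 0 < p) :
  (forall P : foperator R n, P \in Dp0 R n p ->
     (forall f, f \in Ap0 R n p -> op_cvg P f /\ op_apply P f \in Ap0 R n p) /\
     exists F : {linear Ap0_space n p -> Ap0_space n p},
       continuous (F : Ap0_space n p -> Ap0_space n p) /\
       forall f : Ap0_space n p, F f = op_apply P f :> ('rV[R[i]]_n -> R[i])) /\
  (forall F : {linear Ap0_space n p -> Ap0_space n p}, continuous (F : Ap0_space n p -> Ap0_space n p) ->
     exists! P : foperator R n, P \in Dp0 R n p /\
       forall f : Ap0_space n p, F f = op_apply P f :> ('rV[R[i]]_n -> R[i])).
Proof.
split=> [P hP|F Fc].
  split=> [f fA|]; first by split; [exact: Dp0_op_cvg hP fA|exact: op_Ap0].
  by exists (op_map hp hP); split=> //; exact: op_map_continuous.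
exists (symbol hp F); split.
  split; first exact: symbol_Dp0.
  by move=> f; apply/funext => z; exact: symbol_represents.
move=> P [hP FP]; apply/funext => al; apply/funext => z.
by rewrite /symbol FP op_apply_shifted_monomial mulfK// mfact_neq0.
Qed.
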